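(* Let $d\in\mathbb{N}$, $\alpha\in(0,1)$ and $\beta\in(0,2)$. Assume that the spectral measure $\mu$ has a strictly positive density and that $\omega_\mu$ is strictly positive and $(d+1+[\beta])$-times continuously differentiable on $S^{d-1}$. Let $$\kappa_1=\kappa_1(d,\beta)=\begin{cases}\frac{d}{d-\beta}&\text{if }d>\beta,\\ \infty&\text{otherwise.}\end{cases}$$ For $1\le p<\infty$, the kernel $Z(t,\cdot)$ belongs to $L_p(\mathbb{R}^d)$ for all $t>0$ if and only if $1\le p<\kappa_1$. Moreover, for every $1\le p<\kappa_1$ the two-sided estimate $$\|Z(t,\cdot)\|_p\asymp t^{-\frac{\alpha d}{\beta}\left(1-\frac1p\right)},\quad t>0,$$ holds. In the case $d<\beta$, this two-sided estimate remains true for $p=\infty$.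
   Context: $[\beta]$ is the largest integer not exceeding $\beta$. Let $\mu$ (the spectral measure) be a centrally symmetric finite non-negative Borel measure on the unit sphere $S^{d-1}\subset\mathbb{R}^d$. Saying that $\mu$ has a density means $\mu(d\eta)=\varrho(\eta)\,d\eta$ with $\varrho$ continuous on $S^{d-1}$. Put $\omega_\mu(\theta)=\int_{S^{d-1}}|\theta\cdot\eta|^\beta\mu(d\eta)$ for $\theta\in S^{d-1}$, and $\psi(\xi)=\|\xi\|^\beta\omega_\mu(\xi/\|\xi\|)$ for $\xi\in\mathbb{R}^d$, $\psi(0)=0$. Let $G(t,x)=(2\pi)^{-d}\int_{\mathbb{R}^d}e^{ix\cdot\xi}e^{-t\psi(\xi)}d\xi$, the Green function of $\partial_t v+\Psi_\beta(-i\nabla)v=0$, $v|_{t=0}=\delta_0$, where $\Psi_\beta(-i\nabla)v=\mathcal{F}^{-1}[\psi\,\mathcal{F}v]$. Let $G_\alpha(t,s)$ be the Green function of $\partial_t v(t,s)+\frac{d^\alpha}{ds^\alpha}v(t,s)=0$, $G_\alpha(0,s)=\delta(s)$, where $\frac{d^\alpha}{ds^\alpha}f(s)=\frac{1}{\Gamma(-\alpha)}\int_0^\infty\frac{f(s-\tau)-f(s)}{\tau^{1+\alpha}}d\tau$ (so $G_\alpha(1,\cdot)$ is the one-sided $\alpha$-stable density with Laplace transform $e^{-\sigma^\alpha}$). For $t>0$, $x\in\mathbb{R}^d$ define $$Z(t,x)=\frac1\alpha\int_0^\infty G(t^\alpha s,x)s^{-1-\frac1\alpha}G_\alpha(1,s^{-\frac1\alpha})ds.$$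 $f\asymp g$ for $t>0$ means there are constants $C_1,C_2>0$ (independent of $t$) with $C_1g(t)\le f(t)\le C_2g(t)$ for all $t>0$. *)

(* Defs.v *)
From HB Require Import structures.
From mathcomp Require Import all_boot all_order all_algebra.
From mathcomp Require Import all_classical all_reals all_analysis.
From mathcomp Require Import measurable_realfun.

Set Implicit Arguments.
Unset Strict Implicit.
Unset Printing Implicit Defensive.

Import Order.TTheory GRing.Theory Num.Theory.
Import numFieldNormedType.Exports.

Local Open Scope classical_set_scope.
Local Open Scope ring_scope.

(* 'rV[R]_n carries the product sigma-algebra; measurable_rVE identifies it
   with the Borel one. *)
Definition rV_display : measure_display.
Proof. exact: default_measure_display. Qed.

Section borel_rV.
Context {R : realType} (n : nat).

Let coord (i : 'I_n) (x : 'rV[R]_n) : R := x ord0 i.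

Let rV_set0 : g_sigma_preimage coord set0.
Proof. exact: sigma_algebra0. Qed.

Let rV_setC A : g_sigma_preimage coord A -> g_sigma_preimage coord (~` A).
Proof. exact: sigma_algebraC. Qed.

Let rV_bigcup (F : _^nat) : (forall i, g_sigma_preimage coord (F i)) ->
  g_sigma_preimage coord (\bigcup_i F i).
Proof. exact: sigma_algebra_bigcup. Qed.

HB.instance Definition _ := @isMeasurable.Build rV_display 'rV[R]_n
  (g_sigma_preimage coord) rV_set0 rV_setC rV_bigcup.

End borel_rV.

Lemma measurable_coord (R : realType) n (i : 'I_n) :
  measurable_fun setT (fun x : 'rV[R]_n => x ord0 i).
Proof.
move=> _ Y mY; rewrite setTI; apply: sub_sigma_algebra => /=.
rewrite -bigcup_seq/=; exists i => /=; first by rewrite mem_index_enum.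
by exists Y => //; rewrite setTI.
Qed.

Lemma measurable_fun_rV d (T : measurableType d) (R : realType) n
    (f : T -> 'rV[R]_n) :
  (forall i, measurable_fun setT (fun x => f x ord0 i)) ->
  measurable_fun setT f.
Proof.
move=> mf _ A mA; rewrite setTI.
pose G := [set B : set 'rV[R]_n | measurable (f @^-1` B)].
suff: G A by [].
apply: (smallest_sub _ _ mA).
  split.
  - by rewrite /G/= preimage_set0.
  - by move=> B GB; rewrite /G/= setTD preimage_setC; exact: measurableC.
  - move=> F GF; rewrite /G/= preimage_bigcup; apply: bigcupT_measurable => i.
    exact: GF.
rewrite -bigcup_seq => B [i _ [C mC <-]]; rewrite setTI /G/= -comp_preimage.
by rewrite -[X in measurable X]setTI; exact: mf.
Qed.

Lemma measurable_rV_box (R : realType) n (A : 'I_n -> set R) :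
  (forall i, measurable (A i)) ->
  measurable [set x : 'rV[R]_n | forall i, A i (x ord0 i)].
Proof.
move=> mA.
have -> : [set x : 'rV[R]_n | forall i, A i (x ord0 i)] =
    ~` \bigcup_i ~` [set x | A i (x ord0 i)].
  by rewrite setC_bigcup; apply/seteqP; split=> x /= h i;
    [move=> _|]; have := h i; rewrite ?setCK//; exact.
apply: measurableC; apply: countable_bigcupT_measurable => [|i].
  exact/finite_set_countable.
by apply: measurableC; rewrite -[X in measurable X]setTI; exact: measurable_coord.
Qed.

Lemma measurable_rVE (R : realType) n :
  (@measurable _ 'rV[R]_n) = <<s (@open 'rV[R]_n) >>.
Proof.
apply/seteqP; split; apply: smallest_sub.
- exact: smallest_sigma_algebra.
- rewrite -bigcup_seq => _ [i _ [C mC <-]]; rewrite setTI.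
  have : @measurable_fun _ _ (g_sigma_algebraType (@open 'rV[R]_n)) R setT
      (fun x : 'rV[R]_n => x ord0 i).
    apply: (measurability _ (RGenOpens.measurableE R)).
    move=> _ [_ [a [b ->]] <-]; rewrite setTI; apply: sub_sigma_algebra.
    have /continuousP : continuous (fun x : 'rV[R]_n => x ord0 i).
      exact: coord_continuous.
    by apply; exact: itv_open.
  by move=> /(_ measurableT _ mC); rewrite setTI.
- exact: sigma_algebra_measurable.
- move=> U oU.
  pose B (q : 'rV[rat]_n * nat) : set 'rV[R]_n :=
    [set x | forall i, `|x ord0 i - ratr (q.1 ord0 i)| < q.2.+1%:R^-1].
  have -> : U = \bigcup_q (if `[< B q `<=` U >] then B q else set0).
    apply/seteqP; split=> [x Ux|x [q _]]; last first.
      by case: ifPn => // /asboolP; apply.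
    have /nbhs_ballP[e /= e0 xeU] : nbhs x U by exact: open_nbhs_nbhs.
    pose k := Num.truncn (2 * e^-1).
    have ke : k.+1%:R^-1 * 2 < e.
      rewrite mulrC ltr_pdivrMr ?ltr0n// mulrC -ltr_pdivrMr//.
      exact: truncnS_gt.
    have qP i : {q : rat | `|x ord0 i - ratr q| < k.+1%:R^-1}.
      apply: cid.
      have /rat_in_itvoo[q] : x ord0 i - k.+1%:R^-1 < x ord0 i + k.+1%:R^-1.
        by rewrite ltrD2l gtrN// invr_gt0 ltr0n.
      by rewrite in_itv/= -ltr_distl distrC => ?; exists q.
    exists (\row_i sval (qP i), k) => //.
    rewrite ifT; first by move=> i /=; rewrite mxE; case: (qP i).
    apply/asboolP => y By; apply: xeU; split=> // i' i; rewrite (ord1 i').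
    rewrite /ball/= -(subrK (ratr (sval (qP i))) (x ord0 i)) -addrA.
    apply: le_lt_trans ke; rewrite mulr_natr mulr2n (le_trans (ler_normD _ _))//.
    rewrite lerD//; first by case: (qP i) => q /= /ltW.
    by rewrite distrC; have := By i; rewrite mxE => /ltW.
  apply: countable_bigcupT_measurable => // q; case: ifP => // _.
  apply: (measurable_rV_box (A := fun i =>
    [set y : R | `|y - ratr (q.1 ord0 i)| < q.2.+1%:R^-1])) => i.
  rewrite -[X in measurable X]setTI.
  apply: (@measurable_fun_ltr _ _ _ setT (fun y : R => `|y - ratr (q.1 ord0 i)|) (cst q.2.+1%:R^-1) _ _ measurableT [set true]) => //.
  by apply: measurableT_comp => //; exact: measurable_funB.
Qed.

Section lebesgue_rV.
Context {R : realType}.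

Definition rV_cons n (p : measurableTypeR R * 'rV[R]_n) : 'rV[R]_n.+1 :=
  row_mx (const_mx p.1 : 'rV_1) p.2.

Definition rV_uncons n (x : 'rV[R]_n.+1) : measurableTypeR R * 'rV[R]_n :=
  (x ord0 ord0, \row_j x ord0 (lift ord0 j)).

Lemma rV_cons0 n p : @rV_cons n p ord0 ord0 = p.1.
Proof. rewrite (_ : ord0 = lshift n (ord0 : 'I_1)); last exact: val_inj.
by rewrite [LHS]row_mxEl mxE. Qed.

Lemma rV_consS n p j : @rV_cons n p ord0 (lift ord0 j) = p.2 ord0 j.
Proof. by rewrite -rshift1 [LHS]row_mxEr. Qed.

Lemma rV_consK n : cancel (@rV_cons n) (@rV_uncons n).
Proof.
move=> [a v]; congr pair; first exact: rV_cons0.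
by apply/rowP => j; rewrite mxE rV_consS.
Qed.

Lemma measurable_rV_cons n : measurable_fun setT (@rV_cons n).
Proof.
apply: measurable_fun_rV => i; have [j ->|->] := unliftP ord0 i.
  apply: (eq_measurable_fun (fun p : measurableTypeR R * 'rV[R]_n => p.2 ord0 j)).
    by move=> p _ /=; rewrite rV_consS.
  exact: (measurableT_comp (measurable_coord j) measurable_snd).
apply: (eq_measurable_fun (fst : measurableTypeR R * 'rV[R]_n -> R)); last exact: measurable_fst.
by move=> p _ /=; rewrite rV_cons0.
Qed.

Lemma measurable_rV_uncons n : measurable_fun setT (@rV_uncons n).
Proof.
apply/measurable_fun_pairP; split; first exact: measurable_coord.
apply: measurable_fun_rV => i.
apply: (eq_measurable_fun (fun x : 'rV[R]_n.+1 => x ord0 (lift ord0 i))).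
  by move=> x _ /=; rewrite mxE.
exact: measurable_coord.
Qed.

Section step.
Variables (n : nat) (m : {sigma_finite_measure set 'rV[R]_n -> \bar R}).
Local Open Scope ereal_scope.

Definition lebesgue_rV_step : set 'rV[R]_n.+1 -> \bar R :=
  pushforward (@lebesgue_measure R \x m) (@rV_cons n).

HB.instance Definition _ := Measure.copy lebesgue_rV_step
  (measure_function_pushforward__canonical__measure_function_Measure
    (@lebesgue_measure R \x m) (@measurable_rV_cons n)).

Let step_sigma_finite : sigma_finite setT lebesgue_rV_step.
Proof.
have /sigma_finiteP[F [TF ndF Foo]] := sigma_finiteT (@lebesgue_measure R).
have /sigma_finiteP[G [TG ndG Goo]] := sigma_finiteT m.
exists (fun k => @rV_uncons n @^-1` (F k `*` G k)).
  rewrite -preimage_bigcup (_ : \bigcup_k _ = setT) ?preimage_setT//.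
  rewrite -subTset => -[x y] _.
  have : setT x by []. rewrite TF => -[i _ Fix].
  have : setT y by []. rewrite TG => -[j _ Gjy].
  exists (maxn i j) => //; split.
  - by move: x Fix; exact/subsetPset/ndF/leq_maxl.
  - by move: y Gjy; exact/subsetPset/ndG/leq_maxr.
move=> k; have [mFk Fk] := Foo k; have [mGk Gk] := Goo k; split.
  rewrite -[X in measurable X]setTI; apply: measurable_rV_uncons => //.
  exact: measurableX.
rewrite /lebesgue_rV_step /pushforward -comp_preimage.
rewrite (_ : _ \o _ = id) ?preimage_id; last exact/funext/rV_consK.
by rewrite product_measure1E// lte_mul_pinfty// ge0_fin_numE.
Qed.

HB.instance Definition _ :=
  Measure_isSigmaFinite.Build _ _ _ lebesgue_rV_step step_sigma_finite.
End step.

Fixpoint lebesgue_rV n : {sigma_finite_measure set 'rV[R]_n -> \bar R} :=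
  match n with
  | 0 => \d_(0 : 'rV[R]_0)
  | n'.+1 => lebesgue_rV_step (lebesgue_rV n')
  end.

End lebesgue_rV.

Lemma lebesgue_rV_box (R : realType) n (A : 'I_n -> set (measurableTypeR R)) :
  (forall i, measurable (A i)) ->
  lebesgue_rV n [set x : 'rV[R]_n | forall i, A i (x ord0 i)] =
  (\prod_(i < n) lebesgue_measure (A i))%E.
Proof.
elim: n A => [A _|n IH A mA].
  by rewrite big_ord0 /= diracE mem_set//= => -[].
rewrite big_ord_recl -IH; last by [].
rewrite /= /lebesgue_rV_step /pushforward.
rewrite -product_measure1E; [|exact: mA|]; last first.
  apply: (measurable_rV_box (A := fun i => A (lift ord0 i))) => i.
  exact: mA.
congr product_measure1; apply/seteqP; split=> [[a v]/= h|[a v]/= [Aa Av] i].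
  split; first by have := h ord0; rewrite rV_cons0.
  by move=> i; have := h (lift ord0 i); rewrite rV_consS.
by have [j ->|->] := unliftP ord0 i; rewrite ?rV_consS ?rV_cons0.
Qed.

Section sphere.
Context {R : realType} {d : nat}.
Implicit Types x y : 'rV[R]_d.

Definition dot x y : R := \sum_(i < d) x ord0 i * y ord0 i.

(* The Euclidean norm; `|x| is the sup norm on row vectors. *)
Definition enorm x : R := Num.sqrt (dot x x).

Definition sphere : set 'rV[R]_d := [set x | enorm x = 1].

Definition radial x : 'rV[R]_d := (enorm x)^-1 *: x.

Definition punctured_ball : set 'rV[R]_d := [set x | 0 < enorm x <= 1].

Lemma measurable_enorm : measurable_fun setT enorm.
Proof.
apply: measurableT_comp.
  by apply: continuous_measurable_fun => y; exact: sqrt_continuous.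
by apply: measurable_sum => i; apply: measurable_funM; exact: measurable_coord.
Qed.

Lemma measurable_radial : measurable_fun setT radial.
Proof.
apply: measurable_fun_rV => i.
apply: (eq_measurable_fun (fun x => enorm x `^ (-1) * x ord0 i)).
  by move=> x _; rewrite mxE powR_inv1// sqrtr_ge0.
apply: measurable_funM; last exact: measurable_coord.
exact: (measurableT_comp (measurable_powR _) measurable_enorm).
Qed.

Lemma measurable_punctured_ball : measurable punctured_ball.
Proof.
rewrite (_ : punctured_ball = setT `&` enorm @^-1` `]0, 1]).
  exact: measurable_enorm.
by rewrite setTI; apply/seteqP; split=> x /=; rewrite in_itv.
Qed.

(* The surface measure of S^(d-1), obtained from Lebesgue measure by polar
   coordinates; its total mass is d times the volume of the unit ball. *)
Definition surface_measure (A : set 'rV[R]_d) : \bar R :=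
  (d%:R%:E * lebesgue_rV d (radial @^-1` A `&` punctured_ball))%E.

HB.instance Definition _ := Measure.copy surface_measure
  (mscale d%:R%:nng
    (measure_function_pushforward__canonical__measure_function_Measure
      (mrestr (lebesgue_rV d) measurable_punctured_ball) measurable_radial)).

End sphere.

Section spectral.
Context {R : realType} {d : nat}.
Local Notation Rd := 'rV[R]_d.

(* A measure on the sphere is represented by a Borel measure on the ambient
   space that vanishes off the sphere. *)
Definition spectral_measure (mu : {measure set Rd -> \bar R}) : Prop :=
  [/\ (mu setT < +oo)%E,
      mu (~` sphere) = 0%E &
      forall A : set Rd, measurable A -> mu (-%R @^-1` A) = mu A].

Definition has_positive_density (mu : {measure set Rd -> \bar R}) : Prop :=
  exists rho : Rd -> R,
    [/\ {within sphere, continuous rho},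
        forall eta, sphere eta -> 0 < rho eta &
        forall A : set Rd, measurable A ->
          mu A = (\int[surface_measure]_(eta in A `&` sphere) (rho eta)%:E)%E].

Fixpoint Ck (k : nat) (U : set Rd) (f : Rd -> R) : Prop :=
  (forall x, U x -> {for x, continuous f}) /\
  match k with
  | 0 => True
  | k'.+1 => forall i : 'I_d,
      (forall x, U x -> derivable f x (delta_mx ord0 i)) /\
      Ck k' U (fun x => 'D_(delta_mx ord0 i) f x)
  end.

(* As usual for a closed submanifold: f is C^k on the sphere iff it is the
   restriction of a C^k function defined on an open neighbourhood. *)
Definition sphere_Ck (k : nat) (f : Rd -> R) : Prop :=
  exists (U : set Rd) (g : Rd -> R),
    [/\ open U, sphere `<=` U, forall x, sphere x -> g x = f x & Ck k U g].

Variables (beta : R) (mu : {measure set Rd -> \bar R}).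

Definition omega (theta : Rd) : R :=
  \int[mu]_(eta in sphere) (`|dot theta eta| `^ beta).

Definition psi (xi : Rd) : R :=
  if xi == 0 then 0 else enorm xi `^ beta * omega (radial xi).

(* psi is even, so that e^(i x.xi) may be replaced by its real part. *)
Definition G (t : R) (x : Rd) : R :=
  (2 * pi) ^- d * \int[lebesgue_rV d]_xi (cos (dot x xi) * expR (- t * psi xi)).

End spectral.

Section fractional.
Context {R : realType}.
Implicit Types alpha t s : R.

Definition gamma_fun (x : R) : R :=
  \int[lebesgue_measure]_(u in `]0%R, +oo[) (u `^ (x - 1) * expR (- u)).

(* Gamma(-alpha), through the functional equation. *)
Definition gamma_neg alpha : R := gamma_fun (1 - alpha) / - alpha.

Definition frac_quotient alpha (f : R -> R) s (tau : R) : R :=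
  (f (s - tau) - f s) / tau `^ (1 + alpha).

Definition frac_derive alpha (f : R -> R) s : R :=
  (gamma_neg alpha)^-1 *
  \int[lebesgue_measure]_(tau in `]0%R, +oo[) frac_quotient alpha f s tau.

Definition frac_green alpha (Ga : R -> R -> R) : Prop :=
  [/\ forall t s, 0 < t ->
        (@lebesgue_measure R).-integrable `]0%R, +oo[
          (EFin \o frac_quotient alpha (Ga t) s) /\
        is_derive t 1 (Ga^~ s) (- frac_derive alpha (Ga t) s),
      forall t, 0 < t ->
        (@lebesgue_measure R).-integrable setT (EFin \o Ga t) &
      forall phi : R -> R, continuous phi ->
        (exists M, forall s, `|phi s| <= M) ->
        \int[lebesgue_measure]_s (phi s * Ga t s) @[t --> 0^'+] --> phi 0].

Definition one_sided_stable_density alpha (g : R -> R) : Prop :=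
  [/\ continuous g,
      forall s, 0 <= g s,
      forall s, s <= 0 -> g s = 0 &
      forall sigma, 0 <= sigma ->
        (\int[lebesgue_measure]_(s in `]0%R, +oo[)
           (expR (- sigma * s) * g s)%:E)%E = (expR (- sigma `^ alpha))%:E].

End fractional.

Section kernel.
Context {R : realType} {d : nat}.

(* Extended-real valued, since the integral diverges at x = 0 when
   beta <= d. *)
Definition Z (alpha beta : R) (mu : {measure set 'rV[R]_d -> \bar R})
    (Ga : R -> R -> R) (t : R) (x : 'rV[R]_d) : \bar R :=
  (alpha^-1%:E * \int[lebesgue_measure]_(s in `]0%R, +oo[)
    (G beta mu (t `^ alpha * s) x * s `^ (- 1 - alpha^-1) *
     Ga 1 (s `^ (- alpha^-1)))%:E)%E.

Definition in_Lp (p : \bar R) (f : 'rV[R]_d -> \bar R) : Prop :=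
  measurable_fun setT f /\ ('N[lebesgue_rV d]_p[f] < +oo)%E.

Definition two_sided (f : R -> \bar R) (g : R -> R) : Prop :=
  exists C1 C2 : R, [/\ 0 < C1, 0 < C2 &
    forall t, 0 < t -> ((C1 * g t)%:E <= f t <= (C2 * g t)%:E)%E].

End kernel.

Definition kappa1 (R : realType) (d : nat) (beta : R) : \bar R :=
  if beta < d%:R then (d%:R / (d%:R - beta))%:E else +oo%E.

(* Main.v *)
(* Scaling G(t,x) = t^(-d/beta) G(1, t^(-1/beta) x) gives
   Z(t,x) = t^(-alpha d/beta) Z1 (t^(-alpha/beta) x) with
   Z1 x = int_0^oo G(s,x) M(s) ds, where M is the law of the inverse
   alpha-stable subordinator at time 1, so everything reduces to deciding
   whether 0 < ||Z1||_p < oo.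

   G >= 0: exp(-psi) multiplies nonnegative Fourier transforms to nonnegative
   ones, because c |u|^beta = int_0^oo (1 - cos (ru)) r^(-1-beta) dr and
   cos(xi.y) is such a multiplier (it averages two translations); the
   regularisation exp(-delta |xi|_1), whose transform is explicit, makes every
   integral absolutely convergent. Moreover psi >= c |xi|^beta by compactness
   of the sphere, so that G(1,.) is bounded, of total mass at most 1, and
   bounded below near 0.

   Upper bound: M has moments of order -theta for theta < 1; Jensen's
   inequality for the weight s^(-theta) M with theta = (d/beta)(1 - 1/p) gives
   ||Z1||_p < oo when theta < 1, i.e. when p < kappa1.
   Lower bound: int_0^oo exp(-sigma s^(-1/alpha)) M(s) ds = exp(-sigma^alpha)
   shows that M puts mass at least sigma^alpha / 4 on
   {e < sigma s^(-1/alpha) <= A}; with sigma of order |x|^(beta/alpha) this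
   yields Z1 x >= c |x|^(beta-d) near 0, and |x|^(-q) is not integrable at 0
   when q >= d. *)
From HB Require Import structures.
Require Import Defs.
From mathcomp Require Import all_boot all_order all_algebra.
From mathcomp Require Import all_classical all_reals all_analysis.
From mathcomp Require Import measurable_realfun ess_sup_inf ring lra.

Set Implicit Arguments.
Unset Strict Implicit.
Unset Printing Implicit Defensive.

Import Order.TTheory GRing.Theory Num.Theory.
Import numFieldNormedType.Exports.

Local Open Scope classical_set_scope.
Local Open Scope ring_scope.

(** * Dilation and slicing of Lebesgue measure *)

(** Positivity of G underlies every estimate: with it part of the integral over s may be discarded,
    integrals exchanged by Tonelli and Jensen applied, all in [0,+oo]. It is phrased for multipliers
    because products of multipliers are compositions and limits follow by dominated convergence,
    without convolution or Fourier inversion.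

    The behaviour of G(1,.) at infinity enters only through its total mass, by G(1,.)^p <= sup^(p-1)
    G(1,.). The L_p norm of G(s,.) is a multiple of s^(-theta), which is where the order of the
    moment of M comes from.

    The order |x|^(beta-d) comes from times s comparable to |x|^beta: there G(s,x) is at least of
    order |x|^(-d), and M has mass at least of order |x|^beta. M is accessible only through the
    Laplace transform of the stable density, so the moment and this mass are both extracted from 1 -
    exp(-sigma^alpha): the moment by integrating against a power of sigma, the mass by comparing
    three values of sigma. *)

Section line.
Context {R : realType}.
Local Notation leb := (@lebesgue_measure R).
Local Open Scope ereal_scope.

(** By uniqueness: [c] times the image of Lebesgue measure under the dilation gives half-open
    intervals their length. *)
Lemma lebesgue_measure_dilation (c : R) (A : set R) : (0 < c)%R -> measurable A ->
  leb ((fun x : R => (c * x)%R) @^-1` A) = c^-1%:E * leb A.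
Proof.
move=> c0 mA.
have mc : measurable_fun setT ((fun x : R => (c * x)%R) : measurableTypeR R -> measurableTypeR R).
  exact: measurable_funM.
pose m := mscale (NngNum (ltW c0))
  (measure_function_pushforward__canonical__measure_function_Measure leb mc).
have := @lebesgue_measure_unique R m.
move=> /(_ _ A mA) ->; last first.
  move=> _ [[a b]] _ <-.
  rewrite /m/= /mscale/= /pushforward/=.
  rewrite (_ : _ @^-1` _ = `](a / c)%R, (b / c)%R]%classic); last first.
    by apply/seteqP; split=> x/=; rewrite !in_itv/= ltr_pdivrMr// ler_pdivlMr// (mulrC c).
  rewrite !lebesgue_measure_itv/= !lte_fin ltr_pM2r ?invr_gt0//.
  case: ifPn => _; last by rewrite mule0.
  by rewrite -!EFinD -EFinM; congr EFin; field; rewrite gt_eqF.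
by rewrite /m/= /mscale/= /pushforward muleA -EFinM mulVf ?mul1e// gt_eqF.
Qed.

Lemma ge0_integral_dilation (c : R) (D : set R) (f : R -> \bar R) : (0 < c)%R ->
  measurable D -> measurable_fun D f -> (forall x, D x -> 0 <= f x) ->
  \int[leb]_(x in (fun x : R => (c * x)%R) @^-1` D) f (c * x)%R =
  c^-1%:E * \int[leb]_(x in D) f x.
Proof.
move=> c0 mD mf f0.
have mc : measurable_fun setT ((fun x : R => (c * x)%R) : measurableTypeR R -> measurableTypeR R).
  exact: measurable_funM.
have c0' : (0 <= c^-1)%R by rewrite invr_ge0 ltW.
transitivity (\int[pushforward leb ((fun x : R => (c * x)%R) : measurableTypeR R -> measurableTypeR R)]_(x in D) f x).
  by rewrite ge0_integral_pushforward// => x; rewrite inE; exact: f0.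
rewrite (eq_measure_integral (mscale (NngNum c0') leb)); last first.
  by move=> A mA _; exact: lebesgue_measure_dilation.
by rewrite ge0_integral_mscale.
Qed.

Lemma ge0_integral_dilationT (c : R) (f : R -> \bar R) : (0 < c)%R ->
  measurable_fun setT f -> (forall x, 0 <= f x) ->
  \int[leb]_x f (c * x)%R = c^-1%:E * \int[leb]_x f x.
Proof. by move=> c0 mf f0; rewrite -ge0_integral_dilation. Qed.

Lemma ge0_integral_dilation0y (c : R) (f : R -> \bar R) : (0 < c)%R ->
  measurable_fun (`]0%R, +oo[%classic : set R) f -> (forall x, (0 < x)%R -> 0 <= f x) ->
  \int[leb]_(x in `]0%R, +oo[) f (c * x)%R = c^-1%:E * \int[leb]_(x in `]0%R, +oo[) f x.
Proof.
move=> c0 mf f0; rewrite -ge0_integral_dilation//; last first.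
  by move=> x; rewrite /= in_itv/= andbT; exact: f0.
congr integral; apply/seteqP; split=> x/=; rewrite !in_itv/= !andbT.
  by move=> ?; rewrite mulr_gt0.
by rewrite pmulr_rgt0.
Qed.

End line.

Section space.
Context {R : realType}.
Local Notation leb := (@lebesgue_measure R).
Local Open Scope ereal_scope.

Lemma measurable_fun_rV_consl n (f : 'rV[R]_n.+1 -> \bar R) (a : R) :
  measurable_fun setT f -> measurable_fun setT (fun v => f (rV_cons (a, v))).
Proof.
move=> mf; apply: (measurableT_comp mf).
apply: (@measurableT_comp _ _ _ _ _ _ (@rV_cons R n)) => //.
exact: measurable_rV_cons.
Qed.

Lemma ge0_integral_rVS n (f : 'rV[R]_n.+1 -> \bar R) : measurable_fun setT f ->
  (forall x, 0 <= f x) ->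
  \int[lebesgue_rV n.+1]_x f x =
  \int[leb]_a \int[lebesgue_rV n]_v f (rV_cons (a, v)).
Proof.
move=> mf f0.
transitivity (\int[pushforward (leb \x lebesgue_rV n) (@rV_cons R n)]_x f x).
  rewrite [LHS](eq_measure_integral
    (measure_function_pushforward__canonical__measure_function_Measure
      (leb \x lebesgue_rV n) (@measurable_rV_cons R n)))//.
rewrite ge0_integral_pushforward//=; last exact: measurable_rV_cons.
rewrite preimage_setT fubini_tonelli1//=.
by apply: measurableT_comp => //; exact: measurable_rV_cons.
Qed.

Lemma measurable_fun_integral_rV_cons n (f : 'rV[R]_n.+1 -> \bar R) :
  measurable_fun setT f -> (forall x, 0 <= f x) ->
  measurable_fun (setT : set R) (fun a => \int[lebesgue_rV n]_v f (rV_cons (a, v))).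
Proof.
move=> mf f0.
apply: (@measurable_fun_fubini_tonelli_F _ _ _ _ _ (lebesgue_rV n) (f \o @rV_cons R n)) => //=.
by apply: measurableT_comp => //; exact: measurable_rV_cons.
Qed.

Lemma integral_rV0 (f : 'rV[R]_0 -> \bar R) :
  \int[lebesgue_rV 0]_x f x = f 0%R.
Proof.
have -> : f = cst (f 0%R) by apply/funext => x; rewrite /= (_ : x = 0%R)//; apply/rowP => -[].
by rewrite integral_cst//= diracT mule1.
Qed.

End space.

(** * Fourier transform of the two-sided exponential *)

Section laplace_line.
Context {R : realType}.
Local Notation leb := (@lebesgue_measure R).

(** Adding 1 to the cosine keeps the integrand nonnegative, so that the half-line integral is a
    limit of values of an explicit antiderivative. The bare exponential is the case [x = 0], and the
    cosine part is recovered by subtraction. *)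
Lemma integral_exp_cos0y (delta x : R) : 0 < delta ->
  (\int[leb]_(u in `[0%R, +oo[) (expR (- delta * u) * (1 + cos (x * u)))%:E =
  (delta^-1 + delta / (delta ^+ 2 + x ^+ 2))%:E)%E.
Proof.
move=> d0; have D0 : 0 < delta ^+ 2 + x ^+ 2 by rewrite ltr_pwDl ?exprn_gt0 ?sqr_ge0.
pose g (u : R) : R := (x * sin (x * u) - delta * cos (x * u)) / (delta ^+ 2 + x ^+ 2) - delta^-1.
pose F (u : R) : R := expR (- delta * u) * g u.
have dF (u : R) : is_derive u 1 F (expR (- delta * u) * (1 + cos (x * u))).
  rewrite /F /g; apply: is_derive_eq; rewrite /GRing.scale/=.
  by field; rewrite !gt_eqF.
have cF : continuous F.
  by move=> u; apply: differentiable_continuous; apply/derivable1_diffP; apply: ex_derive.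
have cf : continuous (fun u : R => expR (- delta * u) * (1 + cos (x * u))).
  move=> u; apply: differentiable_continuous; apply/derivable1_diffP.
  exact: ex_derive.
rewrite (@ge0_continuous_FTC2y _ _ F 0 0)//.
- rewrite /F /g !mulr0 expR0 sin0 cos0; congr EFin.
  by field; rewrite !gt_eqF.
- by apply: continuous_subspaceT.
- pose C := (`|x| + delta) / (delta ^+ 2 + x ^+ 2) + delta^-1.
  have gC u : `|g u| <= C.
    rewrite /g /C (le_trans (ler_normB _ _))//.
    rewrite (ger0_norm (ltW (_ : 0 < delta^-1))) ?invr_gt0// lerD2r.
    rewrite normrM (ger0_norm (_ : 0 <= _^-1)) ?invr_ge0 ?(ltW D0)//.
    rewrite ler_wpM2r ?invr_ge0 ?(ltW D0)// (le_trans (ler_normB _ _))//.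
    rewrite lerD// normrM ?(ger0_norm (ltW d0)).
      by rewrite ler_piMr// sin_max.
    by rewrite ler_piMr ?cos_max// ltW.
  have E0 : expR (- delta * u) @[u --> +oo] --> 0.
    have -> : (fun u => expR (- delta * u)) = (fun u : R => expR (- u)) \o (fun u => delta * u).
      by apply/funext => u/=; rewrite mulNr.
    apply: cvg_comp; last exact: cvgr_expR.
    by apply: gt0_cvgMry => //; exact: cvg_id.
  apply/norm_cvg0P.
  apply: (@squeeze_cvgr _ _ _ _ (cst 0) (fun u => expR (- delta * u) * C)).
  + apply: nearW => u /=; rewrite normr_ge0/= normrM (ger0_norm (expR_ge0 _)).
    by rewrite ler_wpM2l ?expR_ge0.
  + exact: cvg_cst.
  + by rewrite -(mul0r C); apply: cvgM => //; exact: cvg_cst.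
- by apply: cvg_at_right_filter; exact: cF.
- by move=> u _; rewrite derive1E; exact: derive_val.
Qed.

Lemma integral_exp_norm_cos (delta x : R) : 0 < delta ->
  (\int[leb]_u (expR (- delta * `|u|) * (1 + cos (x * u)))%:E =
  (2 / delta + 2 * delta / (delta ^+ 2 + x ^+ 2))%:E)%E.
Proof.
move=> d0; rewrite ge0_symfun_integralT.
- rewrite -set_itvcy (eq_integral (fun u : measurableTypeR R => (expR (- delta * u) * (1 + cos (x * u)))%:E)).
    by rewrite integral_exp_cos0y// -EFinM mulrDr mulrA.
  by move=> u; rewrite inE/= in_itv/= andbT => u0; rewrite ger0_norm.
- move=> u /=; by rewrite mulr_ge0 ?expR_ge0// -lerBlDl sub0r cos_geN1.
- move=> u; apply: cvgM.
    apply: continuous_comp; last exact: continuous_expR.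
    by apply: cvgM; [exact: cvg_cst|exact: norm_continuous].
  apply: cvgD; first exact: cvg_cst.
  apply: continuous_comp; last exact: continuous_cos.
  by apply: cvgM; [exact: cvg_cst|exact: cvg_id].
- by move=> u /=; rewrite normrN mulrN cosN.
Qed.

Lemma measurable_exp_norm (delta : R) :
  measurable_fun setT (fun u : R => expR (- delta * `|u|)).
Proof.
apply: measurableT_comp => //; apply: measurable_funM => //.
Qed.

Lemma integral_exp_norm (delta : R) : 0 < delta ->
  (\int[leb]_u (expR (- delta * `|u|))%:E = (2 / delta)%:E)%E.
Proof.
move=> d0; have := integral_exp_norm_cos 0 d0.
rewrite (eq_integral (fun u : measurableTypeR R => 2%:E * (expR (- delta * `|u|))%:E)%E); last first.
  by move=> u _; rewrite mul0r cos0 -EFinM mulrC.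
rewrite ge0_integralZl//; last by apply/measurable_EFinP; exact: measurable_exp_norm.
move=> h; rewrite -[LHS]mul1e (_ : 1%E = (2^-1)%:E * 2%:E)%E; last first.
  by rewrite -EFinM mulVf.
rewrite -muleA h -EFinM; congr EFin.
by rewrite expr0n/= addr0; field; rewrite gt_eqF.
Qed.

Lemma ge0_integral_reflect (f : R -> \bar R) :
  measurable_fun setT f -> (forall x, 0 <= f x)%E ->
  (\int[leb]_u f (- u)%R = \int[leb]_u f u)%E.
Proof.
move=> mf f0.
have mN : measurable_fun setT (-%R : measurableTypeR R -> measurableTypeR R) by [].
transitivity (\int[pushforward leb (-%R : measurableTypeR R -> measurableTypeR R)]_u f u)%E.
  by rewrite ge0_integral_pushforward.
by apply: eq_measure_integral => A mA _; exact: lebesgue_measureN.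
Qed.

Lemma integral_reflect (f : R -> \bar R) : measurable_fun setT f ->
  (\int[leb]_u f (- u)%R = \int[leb]_u f u)%E.
Proof.
move=> mf; rewrite [LHS]integralE [RHS]integralE.
rewrite -[in RHS](ge0_integral_reflect (f := f^\+%E))//; last exact: measurable_funepos.
rewrite -[in RHS](ge0_integral_reflect (f := f^\-%E))//; last exact: measurable_funeneg.
by congr (_ - _)%E; apply: eq_integral => u _; rewrite ?funeposE ?funenegE.
Qed.

(** The Poisson (Cauchy) kernel times 2 pi, that is, the Fourier transform of exp(-delta |u|). Its
    total mass 2 pi does not depend on [delta]. *)
Definition exp_kernel (delta x : R) : R := 2 * delta / (delta ^+ 2 + x ^+ 2).

Lemma exp_kernel_ge0 delta x : 0 < delta -> 0 <= exp_kernel delta x.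
Proof.
by move=> d0; rewrite divr_ge0 ?mulr_ge0 ?addr_ge0 ?sqr_ge0// ltW.
Qed.

Lemma integrable_exp_norm (delta : R) : 0 < delta ->
  leb.-integrable setT (EFin \o (fun u : R => expR (- delta * `|u|))).
Proof.
move=> d0; apply/integrableP; split.
  by apply/measurable_EFinP; exact: measurable_exp_norm.
rewrite (eq_integral (fun u : measurableTypeR R => (expR (- delta * `|u|))%:E)) ?integral_exp_norm ?ltry//.
by move=> u _ /=; rewrite ger0_norm ?expR_ge0.
Qed.

Lemma measurable_cos_affine (x a : R) : measurable_fun setT (fun u : R => cos (x * u + a)).
Proof.
apply: measurableT_comp.
  by apply: continuous_measurable_fun; exact: continuous_cos.
by apply: measurable_funD => //; exact: measurable_funM.
Qed.

Lemma measurable_sin_scale (x : R) : measurable_fun setT (fun u : R => sin (x * u)).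
Proof.
apply: measurableT_comp.
  by apply: continuous_measurable_fun; exact: continuous_sin.
exact: measurable_funM.
Qed.

Lemma integrable_scale d (T : measurableType d)
    (m : {measure set T -> \bar R}) (D : set T) (k : R) (f : T -> R) : measurable D ->
  m.-integrable D (EFin \o f) -> m.-integrable D (EFin \o (fun x => k * f x)).
Proof. by move=> mD intf; exact: (integrableZl mD k intf). Qed.

Lemma integrable_bounded_mul d (T : measurableType d)
    (m : {measure set T -> \bar R}) (D : set T) (b f : T -> R) (M : R) : measurable D ->
  measurable_fun D b -> (forall x, D x -> `|b x| <= M) ->
  m.-integrable D (EFin \o f) -> m.-integrable D (EFin \o (fun x => b x * f x)).
Proof.
move=> mD mb bM intf; apply: (@le_integrable _ _ _ _ D _ _ (EFin \o (fun x => M * f x))) => //.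
- apply/measurable_EFinP; apply: measurable_funM => //.
  exact/measurable_EFinP/(measurable_int _ intf).
- move=> x Dx /=; rewrite lee_fin !normrM ler_wpM2r//.
  by rewrite (le_trans (bM x Dx))// ler_norm.
- exact: integrable_scale.
Qed.

(** The sine part vanishes by oddness, and the cosine part is the integral with [1 + cos] minus that
    of the bare exponential. The phase [a] is carried along for the induction on the dimension. *)
Lemma Rintegral_exp_cos (delta x a : R) : 0 < delta ->
  \int[leb]_u (cos (x * u + a) * expR (- delta * `|u|)) = cos a * exp_kernel delta x.
Proof.
move=> d0.
pose e (u : R) := expR (- delta * `|u|).
have ie := integrable_exp_norm d0.
have icos b : leb.-integrable setT (EFin \o (fun u => cos (x * u + b) * e u)).
  apply: (@integrable_bounded_mul _ _ _ _ _ _ 1) => //.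
    exact: measurable_cos_affine.
  by move=> u _; exact: cos_max.
have isin : leb.-integrable setT (EFin \o (fun u => sin (x * u) * e u)).
  apply: (@integrable_bounded_mul _ _ _ _ _ _ 1) => //.
    exact: measurable_sin_scale.
  by move=> u _; exact: sin_max.
have icos0 : leb.-integrable setT (EFin \o (fun u => cos (x * u) * e u)).
  by have := icos 0; congr (integrable _ _ _); apply/funext => u/=; rewrite addr0.
have Icos : \int[leb]_u (cos (x * u) * e u) = exp_kernel delta x.
  have -> : \int[leb]_u (cos (x * u) * e u) =
      \int[leb]_u (e u * (1 + cos (x * u)) - e u).
    by apply: eq_Rintegral => u _; ring.
  rewrite RintegralB//.
    by rewrite /Rintegral integral_exp_norm_cos// integral_exp_norm//= addrAC subrr add0r.
  have := integrableD measurableT ie icos0.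
  by congr (integrable _ _ _); apply/funext => u/=; rewrite -EFinD; congr EFin; rewrite /e; ring.
have Isin : \int[leb]_u (sin (x * u) * e u) = 0.
  have : \int[leb]_u (sin (x * u) * e u) = - \int[leb]_u (sin (x * u) * e u).
    rewrite -[RHS]mulN1r -RintegralZl//.
    transitivity (\int[leb]_u ((fun v => sin (x * v) * e v) (- u))).
      congr fine; rewrite (integral_reflect (f := EFin \o (fun u => sin (x * u) * e u)))//.
      exact: measurable_int isin.
    by apply: eq_Rintegral => u _; rewrite /e normrN mulrN sinN mulN1r mulNr.
  by move=> /eqP; rewrite -subr_eq0 opprK -mulr2n mulrn_eq0/= => /eqP.
transitivity (\int[leb]_u (cos a * (cos (x * u) * e u) - sin a * (sin (x * u) * e u))).
  by apply: eq_Rintegral => u _; rewrite cosD /e; ring.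
rewrite RintegralB//; last 2 first.
- exact: integrable_scale.
- exact: integrable_scale.
by rewrite !RintegralZl// Icos Isin mulr0 subr0.
Qed.

Lemma exp_kernelE (delta u : R) : 0 < delta ->
  exp_kernel delta u = (2 / delta) * (oneDsqr (delta^-1 * u))^-1.
Proof.
move=> d0; rewrite /exp_kernel /oneDsqr.
have u0 : 0 < 1 + (delta^-1 * u) ^+ 2 by rewrite ltr_pwDl ?sqr_ge0.
have u1 : 0 < delta ^+ 2 + u ^+ 2 by rewrite ltr_pwDl ?sqr_ge0 ?exprn_gt0.
have -> : (delta ^+ 2 + u ^+ 2) = delta ^+ 2 * (1 + (delta^-1 * u) ^+ 2).
  by field; rewrite gt_eqF.
by field; rewrite !gt_eqF.
Qed.

Lemma measurable_exp_kernel (delta : R) : 0 < delta ->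
  measurable_fun setT (exp_kernel delta).
Proof.
move=> d0.
apply: (eq_measurable_fun (fun u => (2 / delta) * (oneDsqr (delta^-1 * u))^-1)).
  by move=> u _; rewrite exp_kernelE.
apply: measurable_funM => //.
apply: (@measurableT_comp _ _ _ _ _ _ (fun u : R => (oneDsqr u)^-1)).
  by apply: continuous_measurable_fun; exact: continuous_oneDsqrV.
exact: measurable_funM.
Qed.

Lemma integral_exp_kernel (delta : R) : 0 < delta ->
  (\int[leb]_u (exp_kernel delta u)%:E = (2 * pi)%:E)%E.
Proof.
move=> d0.
have k0 u : 0 <= exp_kernel delta u by exact: exp_kernel_ge0.
have cV : continuous (fun u : R => (oneDsqr u)^-1) by exact: continuous_oneDsqrV.
have -> : (fun u : R => (exp_kernel delta u)%:E) =
    (fun u : R => ((2 / delta) * (oneDsqr (delta^-1 * u))^-1)%:E).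
  by apply/funext => u; rewrite exp_kernelE.
rewrite (@ge0_integral_dilationT R delta^-1 (fun v => ((2 / delta) * (oneDsqr v)^-1)%:E)) ?invr_gt0//; last 2 first.
- apply/measurable_EFinP; apply: measurable_funM => //.
  exact: continuous_measurable_fun.
- by move=> v; rewrite lee_fin mulr_ge0// ?invr_ge0 ?divr_ge0 ?ltW//.
have -> : (fun u : R => ((2 / delta) * (oneDsqr u)^-1)%:E) =
    (fun u : R => (2 / delta)%:E * ((oneDsqr u)^-1)%:E)%E.
  by apply/funext => u; rewrite EFinM.
rewrite ge0_integralZl//; last 2 first.
- by apply/measurable_EFinP; exact: continuous_measurable_fun.
- by rewrite lee_fin divr_ge0// ltW.
rewrite ge0_symfun_integralT//; last by move=> u /=; rewrite /oneDsqr sqrrN.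
rewrite -set_itvcy integral0y_oneDsqr -!EFinM; congr EFin.
by rewrite invrK; field; rewrite gt_eqF.
Qed.

End laplace_line.

(** * Dilations, products and iterated integrals on row vectors *)

Section space_integrals.
Context {R : realType}.
Local Notation leb := (@lebesgue_measure R).

Lemma rV_cons_scale n (c a : R) (v : 'rV[R]_n) :
  c *: rV_cons (a, v) = rV_cons (c * a, c *: v).
Proof.
apply/rowP => i; rewrite mxE; have [j ->|->] := unliftP ord0 i.
  by rewrite !rV_consS mxE.
by rewrite !rV_cons0.
Qed.

Lemma measurable_rV_scale n (c : R) : measurable_fun setT (fun x : 'rV[R]_n => c *: x).
Proof.
apply: measurable_fun_rV => i.
apply: (eq_measurable_fun (fun x : 'rV[R]_n => c * x ord0 i)).
  by move=> x _; rewrite mxE.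
by apply: measurable_funM => //; exact: measurable_coord.
Qed.

Lemma ge0_integral_rV_dilation n (c : R) (f : 'rV[R]_n -> \bar R) : 0 < c ->
  measurable_fun setT f -> (forall x, 0 <= f x)%E ->
  (\int[lebesgue_rV n]_x f (c *: x)%R = (c ^- n)%:E * \int[lebesgue_rV n]_x f x)%E.
Proof.
move=> c0; elim: n f => [|n IH] f mf f0.
  by rewrite !integral_rV0 scaler0 expr0 invr1 mul1e.
rewrite !ge0_integral_rVS//; last first.
  by apply: measurableT_comp => //; exact: measurable_rV_scale.
pose F (b : R) := (\int[lebesgue_rV n]_v f (rV_cons (b, v)))%E.
have mF : measurable_fun setT F by exact: measurable_fun_integral_rV_cons.
have F0 b : (0 <= F b)%E by exact: integral_ge0.
transitivity (\int[leb]_a ((c ^- n)%:E * F (c * a)%R))%E.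
  apply: eq_integral => a _; rewrite -IH//; last exact: measurable_fun_rV_consl.
  by apply: eq_integral => v _; rewrite rV_cons_scale.
have mFc : measurable_fun setT (fun a => F (c * a)%R).
  by apply: (measurableT_comp mF); exact: measurable_funM.
have Fc0 a : setT a -> (0 <= F (c * a)%R)%E by move=> _; exact: F0.
have cn0 : (0 <= (c ^- n)%:E)%E by rewrite lee_fin invr_ge0 exprn_ge0// ltW.
have := ge0_integralZl leb measurableT mFc Fc0 cn0 => ->.
rewrite ge0_integral_dilationT// muleA -EFinM; congr (_%:E * _)%E.
by rewrite exprS invfM mulrC.
Qed.

Lemma integral_rV_dilation n (c : R) (f : 'rV[R]_n -> \bar R) : 0 < c ->
  (lebesgue_rV n).-integrable setT f ->
  (\int[lebesgue_rV n]_x f (c *: x)%R = (c ^- n)%:E * \int[lebesgue_rV n]_x f x)%E.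
Proof.
move=> c0 intf; have mf := measurable_int _ intf.
rewrite [LHS]integralE [in RHS]integralE muleBr//; last first.
  apply: fin_num_adde_defr; apply: integrable_fin_num => //.
  exact: integrable_funepos.
rewrite -!ge0_integral_rV_dilation//; last 2 first.
- exact: measurable_funeneg.
- exact: measurable_funepos.
by congr (_ - _)%E; apply: eq_integral => u _; rewrite ?funeposE ?funenegE.
Qed.

Lemma Rintegral_rV_dilation n (c : R) (f : 'rV[R]_n -> R) : 0 < c ->
  (lebesgue_rV n).-integrable setT (EFin \o f) ->
  \int[lebesgue_rV n]_x f (c *: x) = c ^- n * \int[lebesgue_rV n]_x f x.
Proof.
move=> c0 intf; rewrite /Rintegral (integral_rV_dilation (f := EFin \o f))// fineM//.
exact: integrable_fin_num.
Qed.

Lemma measurable_rV_prod n (f : R -> R) : measurable_fun setT f ->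
  measurable_fun setT (fun x : 'rV[R]_n => \prod_(i < n) f (x ord0 i)).
Proof.
move=> mf; apply: measurable_prod => i _.
by apply: measurableT_comp => //; exact: measurable_coord.
Qed.

Lemma rV_prod_cons n (f : R -> R) a (v : 'rV[R]_n) :
  \prod_(i < n.+1) f (rV_cons (a, v) ord0 i) = f a * \prod_(i < n) f (v ord0 i).
Proof.
rewrite big_ord_recl rV_cons0; congr (_ * _).
by apply: eq_bigr => i _; rewrite rV_consS.
Qed.

Lemma ge0_integral_rV_prod n (f : R -> R) : measurable_fun setT f ->
  (forall u, 0 <= f u) ->
  (\int[lebesgue_rV n]_x (\prod_(i < n) f (x ord0 i))%:E =
   (\int[leb]_u (f u)%:E) ^+ n)%E.
Proof.
move=> mf f0; elim: n => [|n IH].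
  by rewrite integral_rV0 big_ord0 expe0.
have p0 m (v : 'rV[R]_m) : 0 <= \prod_(i < m) f (v ord0 i) by exact: prodr_ge0.
rewrite ge0_integral_rVS//; last 2 first.
- by apply/measurable_EFinP; exact: measurable_rV_prod.
- by move=> v; rewrite lee_fin.
transitivity (\int[leb]_a ((f a)%:E * (\int[leb]_u (f u)%:E) ^+ n))%E.
  apply: eq_integral => a _; rewrite -IH -ge0_integralZl//; last 3 first.
  - by apply/measurable_EFinP; exact: measurable_rV_prod.
  - by move=> v _; rewrite lee_fin.
  - by rewrite lee_fin.
  by apply: eq_integral => v _; rewrite rV_prod_cons.
rewrite ge0_integralZr//; last 3 first.
- exact/measurable_EFinP.
- by move=> u _; rewrite lee_fin.
- by rewrite expe_ge0// integral_ge0// => u _; rewrite lee_fin.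
by rewrite expeS.
Qed.

Lemma integrable_rV_prod n (f : R -> R) : measurable_fun setT f ->
  (forall u, 0 <= f u) -> (\int[leb]_u (f u)%:E < +oo)%E ->
  (lebesgue_rV n).-integrable setT (EFin \o (fun x : 'rV[R]_n => \prod_(i < n) f (x ord0 i))).
Proof.
move=> mf f0 foo; apply/integrableP; split.
  by apply/measurable_EFinP; exact: measurable_rV_prod.
rewrite (eq_integral (fun x : 'rV[R]_n => (\prod_(i < n) f (x ord0 i))%:E)); last first.
  by move=> x _ /=; rewrite ger0_norm// prodr_ge0.
rewrite ge0_integral_rV_prod//; move: foo.
have : (0 <= \int[leb]_u (f u)%:E)%E by rewrite integral_ge0// => u _; rewrite lee_fin.
by case: (\int[leb]_u (f u)%:E)%E => // r _ _; rewrite -EFin_expe ltry.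
Qed.

Lemma integrable_rV_cons n (f : 'rV[R]_n.+1 -> \bar R) :
  (lebesgue_rV n.+1).-integrable setT f ->
  (leb \x lebesgue_rV n)%E.-integrable setT (f \o @rV_cons R n).
Proof.
move=> /integrableP[mf foo]; apply/integrableP; split.
  by apply: measurableT_comp => //; exact: measurable_rV_cons.
apply: le_lt_trans foo.
rewrite [leRHS](_ : _ = \int[pushforward (leb \x lebesgue_rV n)%E (@rV_cons R n)]_x `|f x|)%E; last first.
  rewrite [LHS](eq_measure_integral
    (measure_function_pushforward__canonical__measure_function_Measure
      (leb \x lebesgue_rV n)%E (@measurable_rV_cons R n)))//.
rewrite ge0_integral_pushforward//=; first exact: measurable_rV_cons.
exact: measurableT_comp.
Qed.

Lemma integral_rVS n (f : 'rV[R]_n.+1 -> \bar R) :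
  (lebesgue_rV n.+1).-integrable setT f ->
  (\int[lebesgue_rV n.+1]_x f x =
   \int[leb]_a \int[lebesgue_rV n]_v f (rV_cons (a, v)))%E.
Proof.
move=> intf; have mf := measurable_int _ intf.
transitivity (\int[pushforward (leb \x lebesgue_rV n)%E (@rV_cons R n)]_x f x)%E.
  rewrite [LHS](eq_measure_integral
    (measure_function_pushforward__canonical__measure_function_Measure
      (leb \x lebesgue_rV n)%E (@measurable_rV_cons R n)))//.
rewrite integral_pushforward//=; last 2 first.
- exact: measurable_rV_cons.
- by rewrite preimage_setT; exact: integrable_rV_cons.
rewrite preimage_setT -integral12_prod_meas1//.
exact: integrable_rV_cons.
Qed.

End space_integrals.

(** * Cosine transform of the l1 exponential *)

Section dot.
Context {R : realType}.

Lemma dot_rV_cons n (x : 'rV[R]_n.+1) (b : R) (w : 'rV[R]_n) :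
  dot x (rV_cons (b, w)) = x ord0 ord0 * b + dot (rV_uncons x).2 w.
Proof.
rewrite /dot big_ord_recl rV_cons0; congr (_ + _).
by apply: eq_bigr => i _; rewrite rV_consS mxE.
Qed.

Lemma dotC n (x y : 'rV[R]_n) : dot x y = dot y x.
Proof. by apply: eq_bigr => i _; rewrite mulrC. Qed.

Lemma dotDl n (x y z : 'rV[R]_n) : dot (x + y) z = dot x z + dot y z.
Proof. by rewrite -big_split; apply: eq_bigr => i _; rewrite mxE mulrDl. Qed.

Lemma dotZl n (c : R) (x y : 'rV[R]_n) : dot (c *: x) y = c * dot x y.
Proof. by rewrite /dot mulr_sumr; apply: eq_bigr => i _; rewrite mxE mulrA. Qed.

Lemma dotNl n (x y : 'rV[R]_n) : dot (- x) y = - dot x y.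
Proof. by rewrite -scaleN1r dotZl mulN1r. Qed.

Lemma dot0l n (x : 'rV[R]_n) : dot 0 x = 0.
Proof. by rewrite /dot big1// => i _; rewrite mxE mul0r. Qed.

Lemma dotZr n (c : R) (x y : 'rV[R]_n) : dot x (c *: y) = c * dot x y.
Proof. by rewrite dotC dotZl dotC. Qed.

Lemma measurable_dot_comp d (T : measurableType d) n (f g : T -> 'rV[R]_n) :
  measurable_fun setT f -> measurable_fun setT g ->
  measurable_fun setT (fun z => dot (f z) (g z)).
Proof.
move=> mf mg; apply: measurable_sum => i; apply: measurable_funM.
  by apply: (measurableT_comp (measurable_coord i)).
by apply: (measurableT_comp (measurable_coord i)).
Qed.

Lemma measurable_dotr n (x : 'rV[R]_n) : measurable_fun setT (dot x).
Proof. exact: measurable_dot_comp. Qed.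

Lemma measurable_cos_comp d (T : measurableType d) (f : T -> R) :
  measurable_fun setT f -> measurable_fun setT (fun z => cos (f z)).
Proof.
by apply: measurableT_comp; apply: continuous_measurable_fun; exact: continuous_cos.
Qed.

(** The l1 norm makes this a product of functions of one variable, so that its transform is a
    product of Poisson kernels. *)
Definition exp_l1 n (delta : R) (x : 'rV[R]_n) : R :=
  \prod_(i < n) expR (- delta * `|x ord0 i|).

Lemma integrable_exp_l1 n (delta : R) : 0 < delta ->
  (lebesgue_rV n).-integrable setT (EFin \o @exp_l1 n delta).
Proof.
move=> d0; apply: (@integrable_rV_prod _ _ (fun u => expR (- delta * `|u|))).
- exact: measurable_exp_norm.
- by move=> u; exact: expR_ge0.
- by rewrite integral_exp_norm// ltry.
Qed.

(** The arbitrary phase makes the statement inductive: for a fixed first coordinate [b], the term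
    [x ord0 ord0 * b] joins the phase of the integral over the remaining coordinates. *)
Lemma Rintegral_exp_l1_cos n (delta : R) (x : 'rV[R]_n) (a : R) : 0 < delta ->
  \int[lebesgue_rV n]_xi (cos (dot x xi + a) * exp_l1 delta xi) =
  cos a * \prod_(i < n) exp_kernel delta (x ord0 i).
Proof.
move=> d0.
have icos m (y : 'rV[R]_m) b : (lebesgue_rV m).-integrable setT
    (EFin \o (fun xi => cos (dot y xi + b) * exp_l1 delta xi)).
  apply: (@integrable_bounded_mul _ _ _ _ _ _ _ 1) => //.
  - apply: measurable_cos_comp; apply: measurable_funD => //; exact: measurable_dotr.
  - by move=> u _; exact: cos_max.
  - exact: integrable_exp_l1.
elim: n x a => [|n IH] x a.
  rewrite /Rintegral (integral_rV0 (fun xi => (cos (dot x xi + a) * exp_l1 delta xi)%:E))/=.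
  by rewrite /dot /exp_l1 !big_ord0 add0r.
have -> : \int[lebesgue_rV n.+1]_xi (cos (dot x xi + a) * exp_l1 delta xi) =
  \int[lebesgue_measure]_b ((\prod_(i < n) exp_kernel delta ((rV_uncons x).2 ord0 i)) *
      (cos (x ord0 ord0 * b + a) * expR (- delta * `|b|))).
  congr fine; rewrite (integral_rVS (f := EFin \o (fun xi => cos (dot x xi + a) * exp_l1 delta xi)))//.
  apply: eq_integral => b _.
  transitivity (\int[lebesgue_rV n]_w ((expR (- delta * `|b|))%:E *
      (cos (dot (rV_uncons x).2 w + (x ord0 ord0 * b + a)) * exp_l1 delta w)%:E))%E.
    apply: eq_integral => w _ /=.
    rewrite dot_rV_cons /exp_l1 (rV_prod_cons (fun u => expR (- delta * `|u|))).
    rewrite -EFinM; congr EFin; rewrite (_ : _ + _ + a = dot (rV_uncons x).2 w + (x ord0 ord0 * b + a)); last by ring.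
    by ring.
  rewrite integralZl//; last exact: icos.
  rewrite -[X in (_ * X)%E]fineK; last by apply: integrable_fin_num => //; exact: icos.
  rewrite -EFinM; congr EFin.
  have := IH (rV_uncons x).2 (x ord0 ord0 * b + a); rewrite /Rintegral => ->.
  by ring.
rewrite RintegralZl//; last first.
  apply: (@integrable_bounded_mul _ _ _ _ _ _ _ 1) => //.
  - exact: measurable_cos_affine.
  - by move=> u _; exact: cos_max.
  - exact: integrable_exp_norm.
rewrite Rintegral_exp_cos// big_ord_recl mulrCA; congr (_ * _).
by rewrite mulrC; congr (_ * _); apply: eq_bigr => i _; rewrite mxE.
Qed.

End dot.

(** * Fourier multipliers preserving positivity *)

Lemma Rintegral_dominated_cvg d (T : measurableType d) (R : realType)
    (m : {measure set T -> \bar R}) (D : set T) (f_ : nat -> T -> R) (f g : T -> R) :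
  measurable D -> (forall k, measurable_fun D (f_ k)) ->
  (forall x, D x -> f_ ^~ x @ \oo --> f x) ->
  m.-integrable D (EFin \o g) -> (forall k x, D x -> `|f_ k x| <= g x) ->
  \int[m]_(x in D) f_ k x @[k --> \oo] --> \int[m]_(x in D) f x.
Proof.
move=> mD mf_ f_f intg fg.
have mf : measurable_fun D f by exact: measurable_fun_cvg f_f.
have [intf _ Icvg] : [/\ m.-integrable D (EFin \o f),
    [sequence \int[m]_(x in D) `|(f_ k x)%:E - (f x)%:E|]_k @ \oo --> 0 &
    [sequence \int[m]_(x in D) (f_ k x)%:E]_k @ \oo --> \int[m]_(x in D) (f x)%:E]%E.
  apply: (dominated_convergence _ _ _ _ intg) => //.
  - by move=> k; apply/measurable_EFinP.
  - exact/measurable_EFinP.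
  - apply: aeW => x Dx; apply: cvg_EFin; first exact: nearW.
    exact: f_f.
  - by apply: aeW => x k Dx; rewrite /= lee_fin; exact: fg.
apply: fine_cvg; rewrite fineK//; exact: integrable_fin_num.
Qed.

Section positivity.
Context {R : realType} {n : nat}.
Local Notation Rn := 'rV[R]_n.
Local Notation L := (@lebesgue_rV R n).
Implicit Types (f g h : Rn -> R) (x y xi : Rn).

(** Only the cosine transform is tested: a product of two cosines is again a combination of cosines,
    so the class is stable under multiplication by [cos (dot y xi)]. *)
Definition fourier_nonneg (h : Rn -> R) : Prop :=
  L.-integrable setT (EFin \o h) /\
  forall x, 0 <= \int[L]_xi (cos (dot x xi) * h xi).

(** Acting on a class of integrable functions lets [f] itself be non-integrable, such as a constant
    or a cosine. Measurability and the bound keep the product with [h] integrable. *)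
Definition fourier_multiplier (f : Rn -> R) : Prop :=
  [/\ measurable_fun setT f, exists M : R, forall xi, `|f xi| <= M &
      forall h, fourier_nonneg h -> fourier_nonneg (fun xi => f xi * h xi)].

Lemma integrable_cos_mul x (h : Rn -> R) : L.-integrable setT (EFin \o h) ->
  L.-integrable setT (EFin \o (fun xi => cos (dot x xi) * h xi)).
Proof.
move=> inth; apply: (@integrable_bounded_mul _ _ _ _ _ _ _ 1) => //.
- by apply: measurable_cos_comp; exact: measurable_dotr.
- by move=> u _; exact: cos_max.
Qed.

Lemma fourier_multiplier_intro f : measurable_fun setT f ->
  (exists M : R, forall xi, `|f xi| <= M) ->
  (forall h, fourier_nonneg h ->
    forall x, 0 <= \int[L]_xi (cos (dot x xi) * (f xi * h xi))) ->
  fourier_multiplier f.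
Proof.
move=> mf [M fM] fP; split => //; first by exists M.
move=> h hP; split; last exact: fP.
case: hP => inth _.
exact: (@integrable_bounded_mul _ _ _ _ _ _ _ M).
Qed.

Lemma fourier_multiplier_cos y : fourier_multiplier (fun xi => cos (dot y xi)).
Proof.
apply: fourier_multiplier_intro.
- by apply: measurable_cos_comp; exact: measurable_dotr.
- by exists 1 => xi; exact: cos_max.
move=> h [inth h0] x.
rewrite (_ : \int[L]_xi _ = \int[L]_xi (2^-1 * (cos (dot (x + y) xi) * h xi + cos (dot (x - y) xi) * h xi))).
  rewrite RintegralZl//; last first.
    by have := integrableD measurableT (integrable_cos_mul (x + y) inth)
      (integrable_cos_mul (x - y) inth).
  by rewrite RintegralD ?mulr_ge0 ?addr_ge0//; exact: integrable_cos_mul.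
by apply: eq_Rintegral => xi _; rewrite !dotDl dotNl cosD cosB; field.
Qed.

Lemma fourier_multiplierM f g : fourier_multiplier f -> fourier_multiplier g ->
  fourier_multiplier (fun xi => f xi * g xi).
Proof.
move=> [mf [M fM] fP] [mg [N gN] gP]; apply: fourier_multiplier_intro.
- exact: measurable_funM.
- exists (M * N) => xi; rewrite normrM ler_pM//.
move=> h /gP/fP[_ fg0] x.
rewrite (_ : \int[L]_xi _ = \int[L]_xi (cos (dot x xi) * (f xi * (g xi * h xi))))//.
by apply: eq_Rintegral => xi _; rewrite !mulrA.
Qed.

Lemma fourier_multiplierD f g : fourier_multiplier f -> fourier_multiplier g ->
  fourier_multiplier (fun xi => f xi + g xi).
Proof.
move=> [mf [M fM] fP] [mg [N gN] gP]; apply: fourier_multiplier_intro.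
- exact: measurable_funD.
- by exists (M + N) => xi; rewrite (le_trans (ler_normD _ _))// lerD.
move=> h hP x; have [intf f0] := fP _ hP; have [intg g0] := gP _ hP.
rewrite (_ : \int[L]_xi _ = \int[L]_xi (cos (dot x xi) * (f xi * h xi) + cos (dot x xi) * (g xi * h xi))).
  by rewrite RintegralD ?addr_ge0//; exact: integrable_cos_mul.
by apply: eq_Rintegral => xi _; ring.
Qed.

Lemma fourier_multiplier_cst c : 0 <= c -> fourier_multiplier (cst c).
Proof.
move=> c0; apply: fourier_multiplier_intro => //; first by exists `|c|.
move=> h [inth h0] x.
rewrite (_ : \int[L]_xi _ = \int[L]_xi (c * (cos (dot x xi) * h xi))).
  by rewrite RintegralZl ?mulr_ge0//; exact: integrable_cos_mul.
by apply: eq_Rintegral => xi _ /=; ring.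
Qed.

(** For a fixed [h] the transforms converge by dominated convergence with majorant M |h|, which is
    why the bound is uniform in [k]. *)
Lemma fourier_multiplier_cvg (f_ : nat -> Rn -> R) f (M : R) :
  (forall k, fourier_multiplier (f_ k)) -> (forall k xi, `|f_ k xi| <= M) ->
  (forall xi, f_ ^~ xi @ \oo --> f xi) -> fourier_multiplier f.
Proof.
move=> f_P fM f_f.
have mf_ k : measurable_fun setT (f_ k) by have [] := f_P k.
have mf : measurable_fun setT f by apply: (measurable_fun_cvg mf_) => xi _.
apply: fourier_multiplier_intro => //.
  exists M => xi; have /cvg_norm fN := f_f xi.
  rewrite -(cvg_lim _ fN)//; apply: limr_le; first exact: cvgP fN.
  exact: nearW.
move=> h hP x; have [inth _] := hP.
have Icvg : \int[L]_xi (cos (dot x xi) * (f_ k xi * h xi)) @[k --> \oo] -->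
    \int[L]_xi (cos (dot x xi) * (f xi * h xi)).
  apply: (@Rintegral_dominated_cvg _ _ _ _ _ _ _ (fun xi => M * `|h xi|)) => //.
  - move=> k; apply: measurable_funM.
      by apply: measurable_cos_comp; exact: measurable_dotr.
    by apply: measurable_funM => //; move/measurable_int: inth => /measurable_EFinP.
  - move=> xi _; apply: cvgM; first exact: cvg_cst.
    by apply: cvgM => //; exact: cvg_cst.
  - apply: integrable_scale => //.
    exact: (integrable_norm inth).
  - move=> k xi _; rewrite normrM normrM -[leRHS]mul1r ler_pM//.
      exact: cos_max.
    by rewrite ler_wpM2r.
rewrite -(cvg_lim _ Icvg)//; apply: limr_ge; first exact: cvgP Icvg.
by apply: nearW => k; have [_ _ /(_ _ hP)[_]] := f_P k; exact.
Qed.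

Lemma fourier_multiplierX f k : fourier_multiplier f ->
  fourier_multiplier (fun xi => f xi ^+ k).
Proof.
move=> fP; elim: k => [|k IH]; first exact: fourier_multiplier_cst.
rewrite (_ : (fun xi => _) = (fun xi => f xi * f xi ^+ k)).
  exact: fourier_multiplierM.
by apply/funext => xi; rewrite exprS.
Qed.

(** The Taylor polynomials of the exponential have nonnegative coefficients, and at [f xi] they are
    bounded by [expR M] uniformly in the degree. *)
Lemma fourier_multiplier_expR f : fourier_multiplier f ->
  fourier_multiplier (fun xi => expR (f xi)).
Proof.
move=> fP; have [_ [M fM] _] := fP.
apply: (@fourier_multiplier_cvg (fun k xi => series (exp_coeff (f xi)) k) _ (expR M)).
- elim=> [|k IH].
    rewrite (_ : (fun xi => _) = cst 0); first exact: fourier_multiplier_cst.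
    by apply/funext => xi; rewrite /series/= big_geq.
  rewrite (_ : (fun xi => _) = (fun xi => series (exp_coeff (f xi)) k + (k`!%:R)^-1 * f xi ^+ k)).
    apply: fourier_multiplierD => //.
    apply: (@fourier_multiplierM (cst _)); last exact: fourier_multiplierX.
    by apply: fourier_multiplier_cst; rewrite invr_ge0.
  by apply/funext => xi; rewrite /series/= big_nat_recr//= exp_coeffE.
- move=> k xi; apply: (@le_trans _ _ (series (exp_coeff `|f xi|) k)).
    rewrite -normed_series_exp_coeff /series/=; exact: ler_norm_sum.
  apply: (@le_trans _ _ (expR `|f xi|)); last by rewrite ler_expR.
  apply: nondecreasing_cvgn_le; last exact: is_cvg_series_exp_coeff.
  by apply: nondecreasing_series => *; exact: exp_coeff_ge0.
- move=> xi; exact: is_cvg_series_exp_coeff.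
Qed.

End positivity.

(** * Fubini for integrands dominated by a tensor product *)

Section tensor_fubini.
Context d1 d2 (T1 : measurableType d1) (T2 : measurableType d2) (R : realType).
Variables (m1 : {sigma_finite_measure set T1 -> \bar R})
  (m2 : {sigma_finite_measure set T2 -> \bar R}).
Variables (a : T1 -> R) (b : T2 -> R) (g : T1 * T2 -> R).
Hypotheses (mg : measurable_fun setT g)
  (inta : m1.-integrable setT (EFin \o a)) (intb : m2.-integrable setT (EFin \o b))
  (gab : forall x y, `|g (x, y)| <= a x * b y).

Lemma integrable_tensor_section1 x : m2.-integrable setT (EFin \o (fun y => g (x, y))).
Proof.
apply: (@le_integrable _ _ _ _ _ _ _ (EFin \o (fun y => a x * b y))) => //.
- by apply/measurable_EFinP; apply: (measurableT_comp mg); exact: measurable_pair1.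
- by move=> y _; rewrite /= lee_fin (le_trans (gab x y))// ler_norm.
- exact: integrable_scale.
Qed.

Lemma integrable_tensor_section2 y : m1.-integrable setT (EFin \o (fun x => g (x, y))).
Proof.
apply: (@le_integrable _ _ _ _ _ _ _ (EFin \o (fun x => b y * a x))) => //.
- by apply/measurable_EFinP; apply: (measurableT_comp mg); exact: measurable_pair2.
- by move=> x _; rewrite /= lee_fin (le_trans (gab x y))// mulrC ler_norm.
- exact: integrable_scale.
Qed.

Lemma integrable_tensor : (m1 \x m2)%E.-integrable setT (EFin \o g).
Proof.
apply/integrable12ltyP; first exact/measurable_EFinP.
have [ma _] := integrableP _ _ _ inta; have [mb _] := integrableP _ _ _ intb.
apply: (@le_lt_trans _ _ (\int[m1]_x (`|(a x)%:E| * \int[m2]_y `|(b y)%:E|))%E).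
  apply: ge0_le_integral => //.
  - by move=> x _; exact: integral_ge0.
  - apply: (@measurable_fun_fubini_tonelli_F _ _ _ _ _ m2 (fun z => `|(EFin \o g) z|%E)) => //.
    by apply: measurableT_comp => //; exact/measurable_EFinP.
  - by apply: emeasurable_funM => //; apply: measurableT_comp.
  - move=> x _; rewrite -ge0_integralZl//; last exact: measurableT_comp.
    apply: ge0_le_integral => //.
    + apply: measurableT_comp => //; apply/measurable_EFinP.
      by apply: (measurableT_comp mg); exact: measurable_pair1.
    + by apply: emeasurable_funM => //; apply: measurableT_comp.
    + by move=> y _; rewrite /= lee_fin (le_trans (gab x y))// -normrM ler_norm.
rewrite ge0_integralZr//; last 2 first.
- exact: measurableT_comp.
- exact: integral_ge0.
by apply: lte_mul_pinfty;
  [exact: integral_ge0|by have := integrableP _ _ _ inta => -[_]; rewrite ge0_fin_numE ?integral_ge0|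
   by have := integrableP _ _ _ intb => -[_]].
Qed.

Lemma Rintegral_tensor_fubini :
  \int[m1]_x \int[m2]_y g (x, y) = \int[m2]_y \int[m1]_x g (x, y).
Proof.
rewrite /Rintegral; congr fine.
transitivity (\int[m1]_x \int[m2]_y (g (x, y))%:E)%E.
  apply: eq_integral => x _; rewrite fineK//; apply: integrable_fin_num => //.
  exact: integrable_tensor_section1.
rewrite (integral12_prod_meas1 integrable_tensor) -(integral21_prod_meas1 integrable_tensor).
apply: eq_integral => y _; rewrite fineK//; apply: integrable_fin_num => //.
exact: integrable_tensor_section2.
Qed.

End tensor_fubini.

Section mixture.
Context {R : realType} {n : nat}.
Local Notation Rn := 'rV[R]_n.
Local Notation L := (@lebesgue_rV R n).

(** Fubini, with majorant the product of |h| and [w], brings the integral over [y] outside; each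
    cosine then contributes a nonnegative transform with a nonnegative weight. *)
Lemma fourier_multiplier_mixture d (Y : measurableType d)
    (m : {sigma_finite_measure set Y -> \bar R}) (w : Y -> R) (k : Y -> Rn) :
  measurable_fun setT k -> (forall y, 0 <= w y) -> m.-integrable setT (EFin \o w) ->
  fourier_multiplier (fun xi => \int[m]_y (w y * cos (dot (k y) xi))).
Proof.
move=> mk w0 intw.
have mw : measurable_fun setT w by move/measurable_int: intw => /measurable_EFinP.
have mc (xi : Rn) : measurable_fun setT (fun y => cos (dot (k y) xi)).
  by apply: measurable_cos_comp; exact: measurable_dot_comp.
have intwc (xi : Rn) : m.-integrable setT (EFin \o (fun y => w y * cos (dot (k y) xi))).
  have := @integrable_bounded_mul _ _ _ m setT (fun y => cos (dot (k y) xi)) w 1 measurableT (mc xi) (fun y _ => cos_max _) intw.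
  by congr (integrable _ _ _); apply/funext => y/=; rewrite mulrC.
have mg : measurable_fun setT (fun z : Rn * Y => cos (dot (k z.2) z.1)).
  apply: measurable_cos_comp; apply: measurable_dot_comp => //.
  exact: (measurableT_comp mk).
apply: fourier_multiplier_intro.
(* Since [1 + cos] is nonnegative, Tonelli gives measurability; the mass of [w] is subtracted
   afterwards. *)
- pose G (xi : Rn) := (\int[m]_y (w y * (1 + cos (dot (k y) xi)))%:E)%E.
  have mG : measurable_fun setT G.
    apply: (@measurable_fun_fubini_tonelli_F _ _ _ _ _ m (fun z => (w z.2 * (1 + cos (dot (k z.2) z.1)))%:E)).
      apply/measurable_EFinP; apply: measurable_funM.
        exact: (measurableT_comp mw).
      exact: measurable_funD.
    by move=> z; rewrite lee_fin mulr_ge0// -lerBlDl sub0r cos_geN1.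
  apply: (eq_measurable_fun (fun xi => fine (G xi) - \int[m]_y w y)).
    move=> xi _; rewrite /G -RintegralB//; last first.
      have := integrableD measurableT intw (intwc xi).
      by congr (integrable _ _ _); apply/funext => y/=; rewrite -EFinD mulrDr mulr1.
    by apply: eq_Rintegral => y _; ring.
  apply: measurable_funB => //.
  exact: measurableT_comp.
- exists (\int[m]_y w y) => xi; apply: (le_trans (le_normr_Rintegral _ _)) => //.
  apply: le_Rintegral => //; first exact: (integrable_norm (intwc xi)).
  by move=> y _; rewrite normrM ger0_norm// ler_piMr// cos_max.
move=> h [inth h0] x.
have mh : measurable_fun setT h by move/measurable_int: inth => /measurable_EFinP.
pose g (z : Rn * Y) := w z.2 * (cos (dot x z.1) * (cos (dot (k z.2) z.1) * h z.1)).
have -> : \int[L]_xi (cos (dot x xi) * (\int[m]_y (w y * cos (dot (k y) xi)) * h xi)) =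
    \int[L]_xi \int[m]_y g (xi, y).
  apply: eq_Rintegral => xi _; rewrite mulrCA mulrC -RintegralZl//.
  by apply: eq_Rintegral => y _; rewrite /g/=; ring.
rewrite (@Rintegral_tensor_fubini _ _ _ _ _ L m (fun xi => `|h xi|) w g) //; last 3 first.
- apply: measurable_funM; first exact: (measurableT_comp mw).
  apply: measurable_funM.
    apply: measurable_cos_comp; exact: (measurableT_comp (measurable_dotr x)).
  by apply: measurable_funM => //; exact: (measurableT_comp mh).
- exact: (integrable_norm inth).
- move=> xi y; rewrite /g/= !normrM (ger0_norm (w0 y)) mulrC ler_wpM2r//.
  by rewrite mulrA ler_piMl// mulr_ile1// cos_max.
apply: Rintegral_ge0 => y _; rewrite /g/=.
have [_ _ /(_ h (conj inth h0))[intch c0]] := fourier_multiplier_cos (k y).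
rewrite RintegralZl ?mulr_ge0//.
exact: integrable_cos_mul.
Qed.

Lemma fourier_nonneg_exp_l1 (delta : R) : 0 < delta -> fourier_nonneg (@exp_l1 R n delta).
Proof.
move=> d0; split; first exact: integrable_exp_l1.
move=> x; have := Rintegral_exp_l1_cos x 0 d0.
under eq_Rintegral do rewrite addr0.
move=> ->; rewrite cos0 mul1r prodr_ge0// => i _; exact: exp_kernel_ge0.
Qed.

Lemma measurable_exp_l1 (delta : R) : measurable_fun setT (@exp_l1 R n delta).
Proof. exact: (measurable_rV_prod (measurable_exp_norm delta)). Qed.

Lemma exp_l1_ge0 (delta : R) (x : Rn) : 0 <= exp_l1 delta x.
Proof. by rewrite prodr_ge0// => i _; exact: expR_ge0. Qed.

Lemma exp_l1_le1 (delta : R) (x : Rn) : 0 <= delta -> exp_l1 delta x <= 1.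
Proof.
move=> d0; apply: prodr_ile1 => i _.
by rewrite expR_ge0 expR_le1 mulNr oppr_le0 mulr_ge0.
Qed.

Lemma cvg_exp_l1 (x : Rn) : exp_l1 (k.+1%:R^-1) x @[k --> \oo] --> (1 : R).
Proof.
have E1 : 1 = \prod_(i < n) 1 :> R by rewrite big1.
rewrite /exp_l1 [X in _ --> X]E1.
apply: cvg_big => [|i _]; first exact: mul_continuous.
rewrite -[X in _ --> X]expR0; apply: continuous_cvg; first exact: continuous_expR.
have z : - 0 * `|x ord0 i| = 0 by rewrite oppr0 mul0r.
rewrite -[X in _ --> X]z.
apply: cvgM; last exact: cvg_cst.
by apply: cvgN; exact: cvg_harmonic.
Qed.

(** Testing [f] on [exp_l1 delta] and letting [delta] tend to 0 replaces the test function by 1; the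
    majorant is |f|, integrable by assumption. *)
Lemma fourier_multiplier_nonneg (f : Rn -> R) x : fourier_multiplier f ->
  L.-integrable setT (EFin \o f) -> 0 <= \int[L]_xi (cos (dot x xi) * f xi).
Proof.
move=> [mf _ fP] intf.
have Icvg : \int[L]_xi (cos (dot x xi) * (f xi * exp_l1 k.+1%:R^-1 xi)) @[k --> \oo] -->
    \int[L]_xi (cos (dot x xi) * f xi).
  apply: (@Rintegral_dominated_cvg _ _ _ _ _ _ _ (fun xi => `|f xi|)) => //.
  - move=> k; apply: measurable_funM.
      by apply: measurable_cos_comp; exact: measurable_dotr.
    apply: measurable_funM => //.
    exact: measurable_exp_l1.
  - move=> xi _; apply: cvgM; first exact: cvg_cst.
    rewrite -[X in _ --> X]mulr1; apply: cvgM; first exact: cvg_cst.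
    exact: cvg_exp_l1.
  - exact: (integrable_norm intf).
  - move=> k xi _; rewrite !normrM (ger0_norm (exp_l1_ge0 _ _)).
    rewrite -[leRHS]mul1r ler_pM ?mulr_ge0 ?exp_l1_ge0 ?cos_max//.
    by rewrite ler_piMr// exp_l1_le1.
rewrite -(cvg_lim _ Icvg)//; apply: limr_ge; first exact: cvgP Icvg.
apply: nearW => k; have k0 : 0 < k.+1%:R^-1 :> R by rewrite invr_gt0 ltr0n.
by have [_] := fP _ (fourier_nonneg_exp_l1 k0); exact.
Qed.

End mixture.

(** * Integrals of power weights *)

Section power_weights.
Context {R : realType}.
Local Notation leb := (@lebesgue_measure R).

Lemma powRD_gt0 (x r s : R) : 0 < x -> x `^ (r + s) = x `^ r * x `^ s.
Proof. by move=> x0; rewrite powRD// (gt_eqF x0) implybT. Qed.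

Lemma integral_bigcup_le (F : (set R)^nat) (f : R -> \bar R) (C : \bar R) :
  nondecreasing_seq F -> (forall k, measurable (F k)) ->
  measurable_fun setT f -> (forall k x, F k x -> 0 <= f x)%E ->
  (forall k, \int[leb]_(x in F k) f x <= C)%E ->
  (\int[leb]_(x in \bigcup_k F k) f x <= C)%E.
Proof.
move=> ndF mF mf f0 fC.
have cvgI : (\int[leb]_(x in F k) f x @[k --> \oo] --> \int[leb]_(x in \bigcup_k F k) f x)%E.
  apply: ge0_nondecreasing_set_cvg_integral => // k; exact: measurable_funTS.
rewrite -(cvg_lim _ cvgI)//; apply: lime_le; first exact: cvgP cvgI.
exact: nearW.
Qed.

Lemma integral_powR_segment (a x y : R) : a != 0 -> 0 < x -> x < y ->
  (\int[leb]_(r in `[x, y]) (r `^ (a - 1))%:E = (a^-1 * (y `^ a - x `^ a))%:E)%E.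
Proof.
move=> a0 x0 xy.
have cp (b r : R) : 0 < r -> {for r, continuous (fun u : R => u `^ b)}.
  move=> r0; apply: differentiable_continuous; apply/derivable1_diffP.
  by apply: derivable_powR; rewrite in_itv/= andbT.
have dF (r : R) : 0 < r -> is_derive r 1 (fun u : R => a^-1 * u `^ a) (r `^ (a - 1)).
  move=> r0; have ? := is_derive1_powR a r0.
  apply: is_derive_eq; rewrite /GRing.scale/=; by rewrite mulrA mulVf// mul1r.
rewrite (@continuous_FTC2 _ _ (fun u => a^-1 * u `^ a))//.
- by rewrite mulrBr.
- apply: continuous_in_subspaceT => r; rewrite inE/= in_itv/= => /andP[xr _].
  exact/cp/(lt_le_trans x0).
- split.
  + move=> r; rewrite in_itv/= => /andP[xr _].
    by have [] := dF r (lt_trans x0 xr).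
  + apply: cvg_at_right_filter; apply: cvgM; first exact: cvg_cst.
    exact: cp.
  + apply: cvg_at_left_filter; apply: cvgM; first exact: cvg_cst.
    exact/cp/(lt_trans x0).
- move=> r; rewrite in_itv/= => /andP[xr _].
  by have [_ <-] := dF r (lt_trans x0 xr); rewrite derive1E.
Qed.

Lemma integral_powR_01 (s : R) : 0 < s ->
  (\int[leb]_(r in `]0%R, 1%R]) (r `^ (s - 1))%:E <= (s^-1)%:E)%E.
Proof.
move=> s0; rewrite itv_open_bnd_bigcup.
apply: integral_bigcup_le => //.
- apply/nondecreasing_seqP => k; apply/subsetPset => r/=; rewrite !in_itv/= !add0r.
  move=> /andP[kr ->]; rewrite andbT (le_trans _ kr)// lef_pV2 ?posrE ?ltr0n// ler_nat//.
- by apply/measurable_EFinP; exact: measurable_powR.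
- by move=> k r _; rewrite lee_fin powR_ge0.
move=> k; rewrite add0r; have [->|k0] := eqVneq k 0%N.
  by rewrite invr1 set_itv1 integral_set1 lee_fin invr_ge0 ltW.
rewrite integral_powR_segment ?gt_eqF ?invr_gt0 ?ltr0n//.
  by rewrite lee_fin powR1 ler_piMr ?invr_ge0 ?(ltW s0)// lerBlDr lerDl powR_ge0.
by rewrite invf_lt1 ?ltr0n// ltr1n ltnS lt0n.
Qed.

Lemma integral_powR_1y (s : R) : 0 < s ->
  (\int[leb]_(r in `[1%R, +oo[) (r `^ (- s - 1))%:E <= (s^-1)%:E)%E.
Proof.
move=> s0; rewrite itv_bndy_bigcup_BRight.
apply: integral_bigcup_le => //.
- apply/nondecreasing_seqP => k; apply/subsetPset => r/=; rewrite !in_itv/=.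
  by move=> /andP[-> /= rk]; rewrite (le_trans rk)// lerD2l ler_nat.
- by apply/measurable_EFinP; exact: measurable_powR.
- by move=> k r _; rewrite lee_fin powR_ge0.
move=> k; have [->|k0] := eqVneq k 0%N.
  by rewrite addr0 set_itv1 integral_set1 lee_fin invr_ge0 ltW.
rewrite integral_powR_segment ?oppr_eq0 ?gt_eqF//; last by rewrite ltrDl ltr0n lt0n.
by rewrite lee_fin powR1 invrN mulNr -mulrN opprB ler_piMr ?invr_ge0 ?(ltW s0).
Qed.

(** The constant bound controls the integral at infinity since [k > 0], the bound by r^q controls it
    at 0 since [k < q]. *)
Lemma integral_power_weight_lty (phi : R -> R) (K q k : R) : 0 < k -> k < q ->
  measurable_fun setT phi -> (forall r, 0 < r -> 0 <= phi r) ->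
  (forall r, 0 < r -> phi r <= K) -> (forall r, 0 < r -> phi r <= K * r `^ q) ->
  (\int[leb]_(r in `]0%R, +oo[) (phi r * r `^ (- k - 1))%:E < +oo)%E.
Proof.
move=> k0 kq mphi phi0 phiK phiq.
have K0 : 0 <= K by rewrite (le_trans (phi0 1 _) (phiK 1 _)).
have -> : (`]0%R, +oo[%classic : set R) = `]0%R, 1%R] `|` `]1%R, +oo[.
  apply/seteqP; split=> r/=; rewrite !in_itv/= !andbT.
    by move=> ->/=; case: (leP r 1); [left|right].
  by case=> [/andP[]//|]; exact: lt_trans.
have mf : measurable_fun (setT : set R) (fun r => (phi r * r `^ (- k - 1))%:E).
  by apply/measurable_EFinP; apply: measurable_funM.
rewrite ge0_integral_setU//; last 3 first.
- exact: measurable_funTS.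
- move=> r; rewrite /= !in_itv/= andbT => -[/andP[r0 _]|r1]; rewrite lee_fin mulr_ge0 ?powR_ge0// phi0//.
  exact: lt_trans r1.
- apply/eqP/seteqP; split => // r; rewrite /= !in_itv/= andbT => -[/andP[_ r1]].
  by rewrite ltNge r1.
apply: lte_add_pinfty.
- apply: (@le_lt_trans _ _ (\int[leb]_(r in `]0%R, 1%R]) (K%:E * (r `^ (q - k - 1))%:E))%E).
    apply: ge0_le_integral => //.
    + move=> r/=; rewrite in_itv/= => /andP[r0 _].
      by rewrite lee_fin mulr_ge0 ?powR_ge0// phi0.
    + exact: measurable_funTS.
    + apply: measurable_funTS; apply/measurable_EFinP; exact: measurable_funM.
    + move=> r/=; rewrite in_itv/= => /andP[r0 _].
      rewrite lee_fin -addrA (powRD_gt0 q)//.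
      by rewrite mulrA ler_wpM2r ?powR_ge0// phiq.
  rewrite ge0_integralZl//; last 2 first.
  - by apply: measurable_funTS; apply/measurable_EFinP; exact: measurable_powR.
  - by move=> r _; rewrite lee_fin powR_ge0.
  apply: lte_mul_pinfty; rewrite ?lee_fin//.
  by apply: le_lt_trans (integral_powR_01 _) _; rewrite ?subr_gt0 ?ltry.
- apply: (@le_lt_trans _ _ (\int[leb]_(r in `[1%R, +oo[) (K%:E * (r `^ (- k - 1))%:E))%E).
    apply: (@le_trans _ _ (\int[leb]_(r in `]1%R, +oo[) (K%:E * (r `^ (- k - 1))%:E))%E).
      apply: ge0_le_integral => //.
      + move=> r/=; rewrite in_itv/= andbT => r1.
        by rewrite lee_fin mulr_ge0 ?powR_ge0// phi0// (lt_trans _ r1).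
      + exact: measurable_funTS.
      + apply: measurable_funTS; apply/measurable_EFinP; exact: measurable_funM.
      + move=> r/=; rewrite in_itv/= andbT => r1.
        by rewrite lee_fin ler_wpM2r ?powR_ge0// phiK// (lt_trans _ r1).
    apply: ge0_subset_integral => //.
    + apply: measurable_funTS; apply/measurable_EFinP; exact: measurable_funM.
    + by move=> r _; rewrite lee_fin mulr_ge0 ?powR_ge0.
    + by move=> r/=; rewrite !in_itv/= !andbT => /ltW.
  rewrite ge0_integralZl//; last 2 first.
  - by apply: measurable_funTS; apply/measurable_EFinP; exact: measurable_powR.
  - by move=> r _; rewrite lee_fin powR_ge0.
  apply: lte_mul_pinfty; rewrite ?lee_fin//.
  by apply: le_lt_trans (integral_powR_1y _) _; rewrite ?ltry.
Qed.

Lemma integral_power_weight_gt0 (phi : R -> R) (e k : R) : 0 < e -> 0 < k ->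
  measurable_fun setT phi -> (forall r, 0 < r -> 0 <= phi r) ->
  (forall r, 1 <= r <= 2 -> e <= phi r) ->
  (0 < \int[leb]_(r in `]0%R, +oo[) (phi r * r `^ (- k - 1))%:E)%E.
Proof.
move=> e0 k0 mphi phi0 ephi.
have mf : measurable_fun (setT : set R) (fun r => (phi r * r `^ (- k - 1))%:E).
  by apply/measurable_EFinP; apply: measurable_funM.
pose c := e * 2 `^ (- k - 1).
have c0 : 0 < c by rewrite mulr_gt0// powR_gt0.
apply: (@lt_le_trans _ _ (\int[leb]_(r in `[1%R, 2%R]) c%:E)%E).
  rewrite integral_cst//= lebesgue_measure_itv/= lte_fin ltr1n/= -EFinD.
  by rewrite mule_gt0// lte_fin subr_gt0 ltr1n.
apply: (@le_trans _ _ (\int[leb]_(r in `[1%R, 2%R]) (phi r * r `^ (- k - 1))%:E)%E).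
  apply: ge0_le_integral => //.
  - by move=> r _; rewrite lee_fin ltW.
  - exact: measurable_funTS.
  - move=> r/=; rewrite in_itv/= => /andP[r1 r2].
    have r0 : 0 < r by rewrite (lt_le_trans _ r1).
    rewrite lee_fin ler_pM ?powR_ge0 ?(ltW e0)//; first by rewrite ephi ?r1.
    rewrite -opprD !powRN lef_pV2 ?posrE ?powR_gt0//.
    by rewrite ge0_ler_powR ?nnegrE ?(ltW r0)// addr_ge0// ltW.
apply: ge0_subset_integral => //; first exact: measurable_funTS.
- move=> r/=; rewrite in_itv/= andbT => r0.
  by rewrite lee_fin mulr_ge0 ?powR_ge0// phi0.
- by apply: subset_itv; rewrite bnd_simp.
Qed.

(** This homogeneity produces |u|^beta from 1 - cos, and later s^(-theta) from 1 - exp. *)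
Lemma integral_power_weight_dilation (phi : R -> R) (k c : R) : 0 < c ->
  measurable_fun setT phi -> (forall r, 0 < r -> 0 <= phi r) ->
  (\int[leb]_(r in `]0%R, +oo[) (phi (c * r)%R * r `^ (- k - 1))%:E =
   (c `^ k)%:E * \int[leb]_(r in `]0%R, +oo[) (phi r * r `^ (- k - 1))%:E)%E.
Proof.
move=> c0 mphi phi0.
pose f r := (phi r * r `^ (- k - 1))%:E.
have mf : measurable_fun (setT : set R) f.
  by apply/measurable_EFinP; apply: measurable_funM.
transitivity (\int[leb]_(r in `]0%R, +oo[) ((c `^ (k + 1))%:E * f (c * r)%R))%E.
  apply: eq_integral => r; rewrite inE/= in_itv/= andbT => r0.
  rewrite /f -EFinM; congr EFin; rewrite powRM ?(ltW c0) ?(ltW r0)//.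
  rewrite -opprD (powRN c) -/(powR _ _).
  by field; rewrite gt_eqF// powR_gt0.
have f0 r : 0 < r -> (0 <= f r)%E.
  by move=> r0; rewrite lee_fin mulr_ge0 ?powR_ge0// phi0.
have mD : measurable (`]0%R, +oo[%classic : set (measurableTypeR R)) by [].
have mfc : measurable_fun (`]0%R, +oo[%classic : set R) (fun r => f (c * r)%R).
  by apply: measurable_funTS; apply: (measurableT_comp mf); exact: measurable_funM.
have fc0 r : `]0%R, +oo[%classic r -> (0 <= f (c * r)%R)%E.
  by rewrite /= in_itv/= andbT => r0; rewrite f0// mulr_gt0.
have ck0 : (0 <= (c `^ (k + 1))%:E)%E by rewrite lee_fin powR_ge0.
have := ge0_integralZl leb mD mfc fc0 ck0 => ->.
rewrite ge0_integral_dilation0y//; last exact: measurable_funTS.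
rewrite muleA -EFinM; congr (_%:E * _)%E.
rewrite powRD_gt0// powRr1 ?(ltW c0)// mulfK// gt_eqF//.
Qed.

End power_weights.

(** * The symbol psi *)

Section trig_bounds.
Context {R : realType}.

Lemma sin_le_id (x : R) : 0 <= x -> sin x <= x.
Proof.
move=> x0.
have dF (u : R) : is_derive u 1 (fun v : R => v - sin v) (1 - cos u).
  by apply: is_derive_eq.
have [|c _] := @MVT_segment R (fun v => v - sin v) (fun u => 1 - cos u) 0 x x0 (fun u _ => dF u).
  apply: continuous_subspaceT => u.
  by apply: differentiable_continuous; apply/derivable1_diffP.
rewrite sin0 !subr0 => E; rewrite -subr_ge0 E mulr_ge0// subr_ge0 cos_le1//.
Qed.

Lemma one_sub_cos_ge0 (x : R) : 0 <= 1 - cos x.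
Proof. by rewrite subr_ge0 cos_le1. Qed.

Lemma one_sub_cos_le2 (x : R) : 1 - cos x <= 2.
Proof. by have := cos_geN1 x; lra. Qed.

Lemma sqr_sin_le (x : R) : sin x ^+ 2 <= x ^+ 2.
Proof.
wlog x0 : x / 0 <= x.
  move=> h; have [|/ltW x0] := leP 0 x; first exact: h.
  by rewrite -sqrrN -sinN -(sqrrN x) h// oppr_ge0.
have := cos2Dsin2 x; have := sqr_ge0 (cos x).
have [x1 _ _|x1 h1 h2] := leP x 1; last by nra.
rewrite lerXn2r ?nnegrE// ?sin_le_id// sin_ge0_pi// x0/=.
by rewrite (le_trans x1)// (le_trans _ (pi_ge2 R))// ler1n.
Qed.

Lemma one_sub_cos_le_sqr (x : R) : 1 - cos x <= x ^+ 2.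
Proof.
have -> : x = (x / 2) *+ 2 by rewrite mulr2n; field.
rewrite cos_mulr2n cos2sin2; have := sqr_sin_le (x / 2).
have := sqr_ge0 (x / 2); set y := x / 2; rewrite !mulr2n; nra.
Qed.

Lemma one_sub_cos_ge (r : R) : 1 <= r <= 2 -> 1 - cos 1 <= 1 - cos r.
Proof.
move=> /andP[r1 r2]; rewrite lerD2l lerN2.
have pi2 := pi_ge2 R.
have ge0 : (0 : R) <= 1 by [].
rewrite le_eqVlt; have [->|/eqP r1'] := eqVneq r 1; first by rewrite eqxx.
apply/orP; right; rewrite ltr_cos ?in_itv/=; lra.
Qed.

Lemma one_sub_cos1_gt0 : 0 < 1 - cos 1 :> R.
Proof.
rewrite subr_gt0 -[ltRHS]cos0 ltr_cos ?in_itv/= ?lexx ?ltr01// ?ler01/=.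
- exact: pi_ge0.
- by apply: (le_trans _ (pi_ge2 R)); rewrite ler1n.
Qed.

End trig_bounds.

Lemma integral_indicl d (T : measurableType d) (R : realType)
    (m : {measure set T -> \bar R}) (D : set T) (f : T -> R) :
  (\int[m]_(x in D) (f x)%:E = \int[m]_x (\1_D x * f x)%:E)%E.
Proof.
rewrite integral_mkcond; apply: eq_integral => x _; rewrite patchE indicE.
by case: ifP => _; rewrite ?mul1r ?mul0r.
Qed.

Section euclid.
Context {R : realType} {d : nat}.
Local Notation Rd := 'rV[R]_d.
Implicit Types (x y : Rd).

Lemma dot_ge0 x : 0 <= dot x x.
Proof. by apply: sumr_ge0 => i _; rewrite -expr2 sqr_ge0. Qed.

Lemma sqr_enorm x : enorm x ^+ 2 = dot x x.
Proof. by rewrite sqr_sqrtr// dot_ge0. Qed.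

Lemma enorm_ge0 x : 0 <= enorm x.
Proof. exact: sqrtr_ge0. Qed.

Lemma coord_le_enorm x i : `|x ord0 i| <= enorm x.
Proof.
rewrite -(ler_sqr (normr_ge0 _) (enorm_ge0 _)) sqr_enorm real_normK ?num_real//.
rewrite /dot (bigD1 i)//= -expr2 lerDl; apply: sumr_ge0 => j _.
by rewrite -expr2 sqr_ge0.
Qed.

Lemma enorm_eq0 x : (enorm x == 0) = (x == 0).
Proof.
apply/eqP/eqP => [x0|->]; last by rewrite /enorm dot0l sqrtr0.
apply/rowP => i; rewrite mxE; apply/eqP; rewrite -normr_le0.
by rewrite -x0 coord_le_enorm.
Qed.

Lemma enorm_gt0 x : (0 < enorm x) = (x != 0).
Proof. by rewrite lt_def enorm_ge0 andbT enorm_eq0. Qed.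

Lemma enormZ (c : R) x : 0 <= c -> enorm (c *: x) = c * enorm x.
Proof.
by move=> c0; rewrite /enorm dotZl dotZr mulrA sqrtrM ?mulr_ge0// -expr2 sqrtr_sqr ger0_norm.
Qed.

Lemma sphere_radial x : x != 0 -> sphere (radial x).
Proof.
rewrite -enorm_gt0 => x0; rewrite /sphere/= /radial enormZ ?invr_ge0 ?ltW//.
by rewrite mulVf// gt_eqF.
Qed.

Lemma enorm_radial x : enorm x *: radial x = x.
Proof.
have [->|x0] := eqVneq x 0; first by rewrite /radial !scaler0.
by rewrite /radial scalerA mulfV ?scale1r// enorm_eq0.
Qed.

Lemma measurable_sphere : measurable (@sphere R d).
Proof.
rewrite (_ : sphere = enorm @^-1` [set 1])//.
by rewrite -[X in measurable X]setTI; exact: measurable_enorm.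
Qed.

Lemma norm_dot_sphere_le x y : sphere y -> `|dot x y| <= \sum_(i < d) `|x ord0 i|.
Proof.
move=> y1; apply: (le_trans (ler_norm_sum _ _ _)); apply: ler_sum => i _.
by rewrite normrM ler_piMr// (le_trans (coord_le_enorm _ _))// y1.
Qed.

End euclid.

Section symbol.
Context {R : realType} {d : nat}.
Local Notation Rd := 'rV[R]_d.
Local Notation leb := (@lebesgue_measure R).
Variables (beta : R) (beta02 : 0 < beta < 2) (mu : {finite_measure set Rd -> \bar R}).

Let beta0 : 0 < beta. Proof. by case/andP: beta02. Qed.

Lemma measurable_norm_dot_powR : measurable_fun setT (fun z : Rd * Rd => `|dot z.1 z.2| `^ beta).
Proof.
apply: (measurableT_comp (measurable_powR beta)).
apply: measurableT_comp => //; exact: measurable_dot_comp.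
Qed.

Lemma integrable_norm_dot_powR (xi : Rd) :
  mu.-integrable sphere (EFin \o (fun eta => `|dot xi eta| `^ beta)).
Proof.
pose M := (\sum_(i < d) `|xi ord0 i|) `^ beta.
apply: (@le_integrable _ _ _ _ _ _ _ (EFin \o cst M)).
- exact: measurable_sphere.
- apply: measurable_funTS; apply/measurable_EFinP.
  apply: (measurableT_comp (measurable_powR beta)).
  by apply: measurableT_comp => //; exact: measurable_dotr.
- move=> eta seta; rewrite /= lee_fin !(ger0_norm (powR_ge0 _ _)) /M.
  by rewrite ge0_ler_powR ?(ltW beta0)// ?nnegrE ?sumr_ge0// norm_dot_sphere_le.
- apply: finite_measure_integrable_cst; exact: measurable_sphere.
Qed.

(** Homogeneity absorbs the norm into the dot product and removes the polar splitting; at the origin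
    both sides vanish because beta > 0. *)
Lemma psiE (xi : Rd) : psi beta mu xi = \int[mu]_(eta in sphere) (`|dot xi eta| `^ beta).
Proof.
rewrite /psi; case: ifPn => [/eqP->|xi0].
  under eq_Rintegral do rewrite dot0l normr0 powR0 ?gt_eqF//.
  by rewrite Rintegral_cst ?mul0r//; exact: measurable_sphere.
rewrite /omega -RintegralZl; last 2 first.
- exact: measurable_sphere.
- exact: integrable_norm_dot_powR.
apply: eq_Rintegral => eta _; rewrite -powRM ?enorm_ge0//; congr (_ `^ _).
by rewrite -[in RHS](enorm_radial xi) dotZl normrM ger0_norm ?enorm_ge0.
Qed.

Lemma psi_EFin (xi : Rd) :
  (psi beta mu xi)%:E = (\int[mu]_eta (\1_sphere eta * `|dot xi eta| `^ beta)%:E)%E.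
Proof.
rewrite psiE /Rintegral fineK; first exact: integral_indicl.
apply: integrable_fin_num; first exact: measurable_sphere.
exact: integrable_norm_dot_powR.
Qed.

Lemma psi_ge0 (xi : Rd) : 0 <= psi beta mu xi.
Proof. by rewrite psiE; apply: Rintegral_ge0 => eta _; exact: powR_ge0. Qed.

Lemma psiZ (c : R) (xi : Rd) : 0 <= c -> psi beta mu (c *: xi) = c `^ beta * psi beta mu xi.
Proof.
move=> c0; rewrite !psiE -RintegralZl; last 2 first.
- exact: measurable_sphere.
- exact: integrable_norm_dot_powR.
by apply: eq_Rintegral => eta _; rewrite dotZl normrM ger0_norm// powRM.
Qed.

Lemma measurable_psi : measurable_fun setT (psi beta mu).
Proof.
apply/measurable_EFinP.
rewrite (_ : _ \o _ = (fun xi => \int[mu]_eta (\1_sphere eta * `|dot xi eta| `^ beta)%:E)%E); last first.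
  by apply/funext => xi; exact: psi_EFin.
apply: (@measurable_fun_fubini_tonelli_F _ _ _ _ _ mu (fun z : Rd * Rd => (\1_sphere z.2 * `|dot z.1 z.2| `^ beta)%:E)).
  apply/measurable_EFinP; apply: measurable_funM; last exact: measurable_norm_dot_powR.
  apply: measurableT_comp => //; exact: measurable_indic measurable_sphere.
by move=> z; rewrite lee_fin mulr_ge0 ?powR_ge0.
Qed.

End symbol.

(** * The Levy-Khintchine representation *)

Lemma integrable_mul_bounded d (T : measurableType d) (R : realType)
    (m : {measure set T -> \bar R}) (D : set T) (f b : T -> R) (M : R) : measurable D ->
  measurable_fun D b -> (forall x, D x -> `|b x| <= M) ->
  m.-integrable D (EFin \o f) -> m.-integrable D (EFin \o (fun x => f x * b x)).
Proof.
move=> mD mb bM intf; have := integrable_bounded_mul mD mb bM intf.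
by congr (integrable _ _ _); apply/funext => x /=; rewrite mulrC.
Qed.

(* The library's sigma-finiteness instance on products is shadowed by a later
   instance for subprobabilities, hence this alias. *)
Section sigma_finite_product.
Context d1 d2 (T1 : measurableType d1) (T2 : measurableType d2) (R : realType).
Variables (m1 : {sigma_finite_measure set T1 -> \bar R})
  (m2 : {sigma_finite_measure set T2 -> \bar R}).

Definition sigma_finite_product : set (T1 * T2) -> \bar R := (m1 \x m2)%E.

HB.instance Definition _ := Measure.copy sigma_finite_product (m1 \x m2)%E.

Let sigma_finite_productT : sigma_finite setT sigma_finite_product.
Proof.
have /sigma_finiteP[F [TF ndF Foo]] := sigma_finiteT m1.
have /sigma_finiteP[G [TG ndG Goo]] := sigma_finiteT m2.
exists (fun k => F k `*` G k).
  apply/seteqP; split=> // -[x y] _.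
  have : setT x by []. rewrite TF => -[i _ Fix].
  have : setT y by []. rewrite TG => -[j _ Gjy].
  exists (maxn i j) => //; split.
  - by move: x Fix; exact/subsetPset/ndF/leq_maxl.
  - by move: y Gjy; exact/subsetPset/ndG/leq_maxr.
move=> k; have [mFk Fk] := Foo k; have [mGk Gk] := Goo k; split.
  exact: measurableX.
by rewrite /sigma_finite_product product_measure1E// lte_mul_pinfty// ge0_fin_numE.
Qed.

HB.instance Definition _ :=
  Measure_isSigmaFinite.Build _ _ _ sigma_finite_product sigma_finite_productT.

End sigma_finite_product.

Section levy_khintchine.
Context {R : realType} {d : nat}.
Local Notation Rd := 'rV[R]_d.
Local Notation leb := (@lebesgue_measure R).
Variables (beta : R) (beta02 : 0 < beta < 2) (mu : {finite_measure set Rd -> \bar R}).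

Let beta0 : 0 < beta. Proof. by case/andP: beta02. Qed.
Let beta2 : beta < 2. Proof. by case/andP: beta02. Qed.

Definition levy_constant : R :=
  \int[leb]_(r in `]0%R, +oo[) ((1 - cos r) * r `^ (- beta - 1)).

Let measurable_one_sub_cos : measurable_fun setT (fun r : R => 1 - cos r).
Proof. by apply: measurable_funB => //; exact: measurable_cos_comp. Qed.

Lemma levy_constant_lty :
  (\int[leb]_(r in `]0%R, +oo[) ((1 - cos r) * r `^ (- beta - 1))%:E < +oo)%E.
Proof.
apply: (@integral_power_weight_lty _ _ 2 2) => //.
- by move=> r _; exact: one_sub_cos_le2.
- move=> r r0; rewrite powR_mulrn ?(ltW r0)//.
  have := one_sub_cos_le_sqr r; have := sqr_ge0 r; lra.
Qed.

Lemma levy_constantE : (\int[leb]_(r in `]0%R, +oo[) ((1 - cos r) * r `^ (- beta - 1))%:E =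
  levy_constant%:E)%E.
Proof.
rewrite /levy_constant /Rintegral fineK// ge0_fin_numE ?levy_constant_lty//.
by apply: integral_ge0 => r _; rewrite lee_fin mulr_ge0 ?powR_ge0// one_sub_cos_ge0.
Qed.

Lemma levy_constant_gt0 : 0 < levy_constant.
Proof.
rewrite -lte_fin -levy_constantE.
apply: (@integral_power_weight_gt0 _ _ (1 - cos 1)) => //.
- exact: one_sub_cos1_gt0.
- exact: one_sub_cos_ge.
Qed.

Lemma levy_integral (u : R) :
  (\int[leb]_(r in `]0%R, +oo[) ((1 - cos (r * u)) * r `^ (- beta - 1))%:E =
   (levy_constant * `|u| `^ beta)%:E)%E.
Proof.
have [->|u0] := eqVneq u 0.
  rewrite normr0 powR0 ?gt_eqF// mulr0 integral0_eq// => r _.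
  by rewrite mulr0 cos0 subrr mul0r.
rewrite mulrC EFinM -levy_constantE.
rewrite -(@integral_power_weight_dilation _ (fun r => 1 - cos r)) ?normr_gt0//.
apply: eq_integral => r; rewrite inE/= in_itv/= andbT => r0.
by rewrite -(cos_norm (r * u)) normrM (gtr0_norm r0) (mulrC `|u|).
Qed.

(** The Levy density of psi in polar coordinates, cut off at radius [e] because r^(-beta-1) is not
    integrable at 0. The factor [levy_constant^-1] is normalised so that [e = 0] reproduces psi. *)
Let wt (e : R) (z : Rd * R) : R :=
  levy_constant^-1 * (\1_sphere z.1 * (\1_`]e, +oo[ z.2 * z.2 `^ (- beta - 1))).

Let wt_ge0 e z : 0 <= wt e z.
Proof. by rewrite !mulr_ge0 ?powR_ge0// invr_ge0 ltW// levy_constant_gt0. Qed.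

Let measurable_wt e : measurable_fun setT (wt e).
Proof.
apply: measurable_funM => //; apply: measurable_funM.
  by apply: measurableT_comp => //; exact: measurable_indic measurable_sphere.
apply: measurable_funM.
  by apply: measurableT_comp => //; exact: measurable_indic.
by apply: (measurableT_comp (measurable_powR _)).
Qed.

Let wt_integrable e : 0 < e -> (mu \x leb)%E.-integrable setT (EFin \o wt e).
Proof.
move=> e0.
pose b r := levy_constant^-1 * (\1_(`]e, +oo[%classic : set R) r * r `^ (- beta - 1)).
apply: (@integrable_tensor _ _ _ _ _ mu leb (cst 1) b) => //.
- exact: measurable_wt.
- exact: finite_measure_integrable_cst.
- apply: integrable_scale => //; apply/integrableP; split.
    apply/measurable_EFinP; apply: measurable_funM; last exact: measurable_powR.
    exact: measurable_indic.
  apply: (@le_lt_trans _ _ (\int[leb]_(r in `]0%R, +oo[) (\1_(`]e, +oo[%classic : set R) r * r `^ (- beta - 1))%:E)%E).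
    rewrite [leRHS]integral_indicl le_eqVlt; apply/orP; left; apply/eqP.
    apply: eq_integral => r _ /=; rewrite ger0_norm ?mulr_ge0 ?powR_ge0//.
    rewrite !indicE; have [re|re] := boolP (r \in `]e, +oo[%classic); last by rewrite !mul0r mulr0.
    rewrite mem_set ?mul1r//=; move: re; rewrite inE/= !in_itv/= !andbT.
    exact: lt_trans.
  (* On r > e one has 1 <= (r / e)^2, which supplies the growth condition with exponent 2. *)
  apply: (@integral_power_weight_lty _ _ (Num.max 1 (e^-1 `^ 2)) 2) => //.
  + by move=> r _; rewrite le_max; apply/orP; left; rewrite indicE; case: (_ \in _); rewrite ?ler01 ?lexx.
  + move=> r r0; rewrite indicE; have [re|re] := boolP (r \in `]e, +oo[%classic); last first.
      by rewrite mulr_ge0 ?powR_ge0// le_max ler01.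
    rewrite (@le_trans _ _ (e^-1 `^ 2 * r `^ 2))//; last first.
      by rewrite ler_wpM2r ?powR_ge0// le_max lexx orbT.
    rewrite -powRM ?(ltW r0) ?invr_ge0 ?(ltW e0)// powR_mulrn ?mulr_ge0 ?invr_ge0 ?(ltW e0) ?(ltW r0)//.
    rewrite exprn_ege1// mulrC ler_pdivlMr// mul1r ltW//.
    by move: re; rewrite inE/= in_itv/= andbT.
- move=> x y; rewrite ger0_norm ?wt_ge0// mul1r /wt/= ler_wpM2l ?invr_ge0 ?(ltW levy_constant_gt0)//.
  by rewrite ler_piMl ?mulr_ge0 ?powR_ge0.
Qed.

Let osc (xi : Rd) (z : Rd * R) : R := 1 - cos (dot (z.2 *: z.1) xi).

Let measurable_scaled : measurable_fun setT (fun z : Rd * R => z.2 *: z.1).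
Proof.
apply: measurable_fun_rV => i.
apply: (eq_measurable_fun (fun z : Rd * R => z.2 * z.1 ord0 i)).
  by move=> z _; rewrite mxE.
apply: measurable_funM => //.
exact: (measurableT_comp (measurable_coord i)).
Qed.

Let measurable_osc xi : measurable_fun setT (osc xi).
Proof.
apply: measurable_funB => //; apply: measurable_cos_comp.
by apply: measurable_dot_comp => //.
Qed.

(** Tonelli integrates first over the radius, where [levy_integral] yields a multiple of |xi .
    eta|^beta, and then over the sphere. *)
Let integral_wt0_osc xi :
  (\int[mu \x leb]_z (wt 0 z * osc xi z)%:E = (psi beta mu xi)%:E)%E.
Proof.
rewrite fubini_tonelli1//; last 2 first.
- by apply/measurable_EFinP; apply: measurable_funM; [exact: measurable_wt|exact: measurable_osc].
- by move=> z; rewrite lee_fin mulr_ge0 ?wt_ge0// one_sub_cos_ge0.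
rewrite psi_EFin//; apply: eq_integral => eta _.
rewrite /fubini_F.
pose c := levy_constant^-1 * \1_sphere eta.
have c0 : 0 <= c by rewrite mulr_ge0// invr_ge0 ltW// levy_constant_gt0.
transitivity (c%:E * \int[leb]_(r in `]0%R, +oo[) ((1 - cos (r * dot xi eta)) * r `^ (- beta - 1))%:E)%E.
  rewrite [X in (_ * X)%E]integral_indicl -ge0_integralZl//; last 2 first.
  - apply/measurable_EFinP; apply: measurable_funM; first exact: measurable_indic.
    apply: measurable_funM; last exact: measurable_powR.
    apply: measurable_funB => //; apply: measurable_cos_comp.
    exact: measurable_funM.
  - by move=> r _; rewrite lee_fin !mulr_ge0 ?powR_ge0// one_sub_cos_ge0.
  apply: eq_integral => r _; rewrite -EFinM; congr EFin.
  by rewrite /wt /osc/= dotZl (dotC eta) /c; ring.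
rewrite levy_integral -EFinM; congr EFin.
by rewrite /c; field; rewrite gt_eqF// levy_constant_gt0.
Qed.

(** With a cut-off, exp(kk - lam) is the characteristic function of a symmetric compound Poisson
    law: [kk] is a finite mixture of cosines, hence its exponential is a multiplier, and exp(-lam)
    is a positive constant. Removing the cut-off makes lam - kk increase to psi, although lam by
    itself may diverge. *)
Lemma fourier_multiplier_exp_psi : fourier_multiplier (fun xi => expR (- psi beta mu xi)).
Proof.
pose e (k : nat) : R := k.+1%:R^-1.
have e0 k : 0 < e k by rewrite invr_gt0 ltr0n.
pose lam k := \int[(mu \x leb)%E]_z wt (e k) z.
pose kk k xi := \int[(mu \x leb)%E]_z (wt (e k) z * cos (dot (z.2 *: z.1) xi)).
have kkP k : fourier_multiplier (kk k).
  exact: (@fourier_multiplier_mixture _ _ _ _ (sigma_finite_product mu leb) (wt (e k))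
    (fun z => z.2 *: z.1) measurable_scaled (wt_ge0 (e k)) (wt_integrable (e0 k))).
have intc k xi : (mu \x leb)%E.-integrable setT (EFin \o (fun z => wt (e k) z * cos (dot (z.2 *: z.1) xi))).
  apply: (@integrable_mul_bounded _ _ _ _ _ _ _ 1) => //.
  - by apply: measurable_cos_comp; apply: measurable_dot_comp.
  - by move=> z _; exact: cos_max.
  - exact: wt_integrable.
have lamkk k xi : lam k - kk k xi = \int[(mu \x leb)%E]_z (wt (e k) z * osc xi z).
  rewrite -RintegralB//; last exact: wt_integrable.
  by apply: eq_Rintegral => z _; rewrite /osc; ring.
have lamkk0 k xi : 0 <= lam k - kk k xi.
  rewrite lamkk; apply: Rintegral_ge0 => z _.
  by rewrite mulr_ge0 ?wt_ge0// one_sub_cos_ge0.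
have lamkk_cvg xi : lam k - kk k xi @[k --> \oo] --> psi beta mu xi.
  under eq_fun do rewrite lamkk.
  rewrite (_ : psi beta mu xi = \int[(mu \x leb)%E]_z (wt 0 z * osc xi z)); last first.
    by rewrite /Rintegral integral_wt0_osc.
  apply: (@Rintegral_dominated_cvg _ _ _ (mu \x leb)%E setT
    (fun k z => wt (e k) z * osc xi z) (fun z => wt 0 z * osc xi z)
    (fun z => wt 0 z * osc xi z)) => //.
  - by move=> k; apply: measurable_funM; [exact: measurable_wt|exact: measurable_osc].
  (* Pointwise the sequence is eventually constant: at a radius <= 0 both cut-offs give 0, and a
     positive radius eventually exceeds [e k]. *)
  - move=> z _; apply: cvg_near_cst.
    have [z0|z0] := leP z.2 0.
      apply: nearW => k; congr (_ * _); rewrite /wt; do 2 congr (_ * _).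
      rewrite !indicE !memNset ?mul0r//=; rewrite in_itv/= andbT.
        by apply/negP; rewrite -leNgt.
      by apply/negP; rewrite -leNgt (le_trans z0)// ltW.
    have := near_infty_natSinv_lt (PosNum z0).
    apply: filterS => k /= kz; congr (_ * _); rewrite /wt; do 2 congr (_ * _).
    by rewrite !indicE !mem_set ?mul0r//= in_itv/= andbT.
  - apply/integrableP; split.
      by apply/measurable_EFinP; apply: measurable_funM; [exact: measurable_wt|exact: measurable_osc].
    rewrite [ltLHS](_ : _ = (psi beta mu xi)%:E) ?ltry// -integral_wt0_osc.
    apply: eq_integral => z _ /=; rewrite ger0_norm//.
    by rewrite mulr_ge0 ?wt_ge0// one_sub_cos_ge0.
  - move=> k z _; rewrite ger0_norm ?mulr_ge0 ?wt_ge0 ?one_sub_cos_ge0//.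
    rewrite ler_wpM2r ?one_sub_cos_ge0// /wt ler_wpM2l ?invr_ge0 ?(ltW levy_constant_gt0)//.
    rewrite ler_wpM2l// ler_wpM2r ?powR_ge0// !indicE.
    have [zk|zk] := boolP (z.2 \in `]e k, +oo[%classic) => //.
    rewrite mem_set//=; move: zk; rewrite inE/= !in_itv/= !andbT.
    + exact: lt_trans.
    + by rewrite invr_ge0 ltW// levy_constant_gt0.
    + exact: powR_ge0.
apply: (@fourier_multiplier_cvg _ _ (fun k xi => expR (- lam k) * expR (kk k xi)) _ 1).
- move=> k; apply: (@fourier_multiplierM _ _ (cst _)).
    by apply: fourier_multiplier_cst; exact: expR_ge0.
  exact: fourier_multiplier_expR.
- move=> k xi; rewrite -expRD ger0_norm ?expR_ge0// expR_le1.
  by rewrite addrC -opprB oppr_le0.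
- move=> xi; under eq_fun do rewrite -expRD addrC -opprB.
  apply: continuous_cvg; first exact: continuous_expR.
  by apply: cvgN; exact: lamkk_cvg.
Qed.

End levy_khintchine.

(** * The stable density G(1,x) *)

Section exp_powR_decay.
Context {R : realType}.
Local Notation leb := (@lebesgue_measure R).

(** The Poisson kernel is taken as majorant because its integral is already known. The weight 1 +
    |u| prepares the first moment used to bound G from below near 0. *)
Lemma exp_powR_decay (a beta : R) : 0 < a -> 0 < beta ->
  exists K, 0 <= K /\ forall u, (1 + `|u|) * expR (- (a * `|u| `^ beta)) <= K * exp_kernel 1 u.
Proof.
(* Chosen so that |u|^3 <= |u|^(beta (n+1)) for |u| >= 1; the latter power occurs in the term of
   order n+1 of the exponential series. *)
move=> a0 beta0; pose n := (Num.truncn (3 / beta)).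
have nb : 3 <= beta * n.+1%:R.
  rewrite mulrC -ler_pdivrMr// ltW//; exact: truncnS_gt.
have an : 0 < a ^+ n.+1 by rewrite exprn_gt0.
(* The 4 comes from (1 + v)(1 + v^2), which is at most 4 for v <= 1 and at most 4 v^3 for v >= 1. *)
pose K := 4 * (1 + (n.+1)`!%:R / a ^+ n.+1) : R.
have K4 : 4 <= K by rewrite /K ler_peMr// lerDl divr_ge0// ltW.
have K0 : 0 <= K by rewrite (le_trans _ K4).
exists K; split => // u.
have u0 := normr_ge0 u.
have u2 : 0 < 1 + `|u| ^+ 2 by rewrite ltr_pwDl ?sqr_ge0.
suff H : (1 + `|u|) * (1 + `|u| ^+ 2) <= K * expR (a * `|u| `^ beta).
  rewrite expRN ler_pdivrMr ?expR_gt0// mulrAC /exp_kernel expr1n mulr1.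
  rewrite -(real_normK (num_real u)) mulrA ler_pdivlMr//.
  rewrite (le_trans H)// -mulrA (mulrC (expR _)) mulrA ler_wpM2r ?expR_ge0//.
  by rewrite ler_peMr// ler1n.
have [u1|u1] := leP `|u| 1.
  apply: (@le_trans _ _ 4).
    have : `|u| ^+ 2 <= 1 by rewrite exprn_ile1.
    have := sqr_ge0 `|u|; nra.
  rewrite (le_trans K4)// ler_peMr//.
  by rewrite -expR0 ler_expR mulr_ge0 ?powR_ge0// ltW.
apply: (@le_trans _ _ (4 * `|u| `^ (beta * n.+1%:R))).
  apply: (@le_trans _ _ (4 * `|u| ^+ 3)).
    have := u1; set v := `|u| in u0 u2 u1 *; nra.
  rewrite ler_wpM2l// -powR_mulrn// ler_powR// ltW//.
have := @expR_ge1Dxn R (a * `|u| `^ beta) n (mulr_ge0 (ltW a0) (powR_ge0 _ _)).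
rewrite exprMn powRrM powR_mulrn ?powR_ge0//.
set P := `|u| `^ beta ^+ n.+1; set E := expR _ => h.
have P0 : 0 <= P by rewrite exprn_ge0 ?powR_ge0.
have f0 : 0 < (n.+1)`!%:R :> R by rewrite ltr0n fact_gt0.
rewrite /K -mulrA ler_wpM2l//.
have hP : P <= (n.+1)`!%:R / a ^+ n.+1 * E.
  rewrite mulrAC ler_pdivlMr// mulrC -ler_pdivrMl// mulrC.
  by apply: le_trans h; rewrite -subr_ge0 (_ : _ - _ = 1) ?ler01//; ring.
rewrite mulrDl mul1r; apply: (le_trans hP); rewrite lerDr expR_ge0//.
Qed.

Lemma integral_exp_powR_lty (a beta : R) : 0 < a -> 0 < beta ->
  (\int[leb]_u ((1 + `|u|) * expR (- (a * `|u| `^ beta)))%:E < +oo)%E.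
Proof.
move=> a0 beta0; have [K [K0 KP]] := exp_powR_decay a0 beta0.
have mk : measurable_fun setT (fun u : R => (exp_kernel 1 u)%:E).
  by apply/measurable_EFinP; exact: measurable_exp_kernel.
apply: (@le_lt_trans _ _ (\int[leb]_u (K%:E * (exp_kernel 1 u)%:E))%E).
  apply: ge0_le_integral => //.
  - apply/measurable_EFinP; apply: measurable_funM; first exact: measurable_funD.
    apply: measurableT_comp => //; apply: measurableT_comp => //.
    apply: measurable_funM => //.
    by apply: (measurableT_comp (measurable_powR _)).
  - by apply: emeasurable_funM.
  - by move=> u _; rewrite lee_fin; exact: KP.
rewrite ge0_integralZl//; last by move=> u _; rewrite lee_fin exp_kernel_ge0.
by rewrite integral_exp_kernel// -EFinM ltry.
Qed.

End exp_powR_decay.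

Lemma one_add_sum_le_prod (R : realDomainType) (I : Type) (r : seq I) (v : I -> R) :
  (forall i, 0 <= v i) -> 1 + \sum_(i <- r) v i <= \prod_(i <- r) (1 + v i).
Proof.
move=> v0; elim: r => [|i r IH]; first by rewrite !big_nil addr0.
rewrite !big_cons; have S0 : 0 <= \sum_(j <- r) v j by exact: sumr_ge0.
have vi := v0 i; nra.
Qed.

Section stable_density.
Context {R : realType} {d : nat}.
Local Notation Rd := 'rV[R]_d.
Local Notation leb := (@lebesgue_measure R).
Local Notation L := (@lebesgue_rV R d).
Variables (beta : R) (mu : {finite_measure set Rd -> \bar R}) (c : R).
Hypotheses (d_gt0 : (0 < d)%N) (beta02 : 0 < beta < 2) (c0 : 0 < c)
  (psi_ge : forall xi, c * enorm xi `^ beta <= psi beta mu xi).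
Implicit Types x xi : Rd.

Let beta0 : 0 < beta. Proof. by case/andP: beta02. Qed.

Let E xi := expR (- psi beta mu xi).

Let measurable_E : measurable_fun setT E.
Proof.
apply: measurableT_comp => //; apply: measurableT_comp => //.
exact: measurable_psi.
Qed.

(** The lower bound on psi is weakened to c times the mean of the |xi_i|^beta, whence [a = c / d];
    with [one_add_sum_le_prod] the integrand is then dominated by a product of functions of one
    variable. *)
Lemma integrable_exp_psi_moment :
  L.-integrable setT (EFin \o (fun xi => (1 + \sum_(i < d) `|xi ord0 i|) * expR (- psi beta mu xi))).
Proof.
pose a := c / d%:R.
have a0 : 0 < a by rewrite divr_gt0// ltr0n.
pose b (u : R) := (1 + `|u|) * expR (- (a * `|u| `^ beta)).
have b0 u : 0 <= b u by rewrite mulr_ge0 ?expR_ge0// addr_ge0.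
have mb : measurable_fun setT b.
  apply: measurable_funM; first exact: measurable_funD.
  apply: measurableT_comp => //; apply: measurableT_comp => //.
  by apply: measurable_funM => //; apply: (measurableT_comp (measurable_powR _)).
apply: (@le_integrable _ _ _ _ _ _ _ (EFin \o (fun xi => \prod_(i < d) b (xi ord0 i)))) => //.
- apply/measurable_EFinP; apply: measurable_funM => //.
  apply: measurable_funD => //; apply: measurable_sum => i.
  by apply: measurableT_comp => //; exact: measurable_coord.
- move=> xi _; rewrite /= lee_fin ger0_norm; last first.
    by rewrite mulr_ge0 ?expR_ge0// addr_ge0// sumr_ge0.
  rewrite ger0_norm ?prodr_ge0// /b big_split/= ler_pM ?expR_ge0//.
  + by rewrite addr_ge0// sumr_ge0.
  + exact: one_add_sum_le_prod.
  + rewrite -expR_sum ler_expR sumrN lerN2 -mulr_sumr.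
    apply: le_trans (psi_ge xi); rewrite /a -mulrA ler_wpM2l ?(ltW c0)//.
    rewrite mulrC ler_pdivrMr ?ltr0n// mulr_natr -[X in _ *+ X]card_ord -sumr_const.
    apply: ler_sum => i _; rewrite ge0_ler_powR ?(ltW beta0) ?nnegrE ?enorm_ge0//.
    exact: coord_le_enorm.
- by apply: integrable_rV_prod => //; exact: integral_exp_powR_lty.
Qed.

Lemma integrable_exp_psi : L.-integrable setT (EFin \o (fun xi => expR (- psi beta mu xi))).
Proof.
apply: le_integrable integrable_exp_psi_moment => //; first exact/measurable_EFinP.
move=> xi _; rewrite /= lee_fin normrM ler_peMl//.
by rewrite ger0_norm ?lerDl ?addr_ge0 ?sumr_ge0.
Qed.

Let intE := integrable_exp_psi.

Let g x := G beta mu 1 x.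

Let gE x : g x = (2 * pi) ^- d * \int[L]_xi (cos (dot x xi) * E xi).
Proof. by rewrite /g /G; congr (_ * _); apply: eq_Rintegral => xi _; rewrite mulN1r. Qed.

Let k0 : 0 < (2 * pi) ^- d :> R.
Proof. by rewrite invr_gt0 exprn_gt0// mulr_gt0// pi_gt0. Qed.

Lemma G1_ge0 x : 0 <= G beta mu 1 x.
Proof.
rewrite -/(g x) gE mulr_ge0 ?(ltW k0)//.
apply: fourier_multiplier_nonneg => //; exact: fourier_multiplier_exp_psi.
Qed.

Definition G1_sup : R := (2 * pi) ^- d * \int[L]_xi expR (- psi beta mu xi).

Lemma G1_le x : G beta mu 1 x <= G1_sup.
Proof.
rewrite -/(g x) gE ler_wpM2l ?(ltW k0)//; apply: le_Rintegral => //.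
  exact: integrable_cos_mul.
by move=> xi _; rewrite ler_piMl ?expR_ge0// cos_le1.
Qed.

Lemma measurable_G1 : measurable_fun setT (G beta mu 1).
Proof.
pose F x := (\int[L]_xi ((1 + cos (dot x xi)) * E xi)%:E)%E.
have mF : measurable_fun setT F.
  apply: (@measurable_fun_fubini_tonelli_F _ _ _ _ _ L (fun z : Rd * Rd => ((1 + cos (dot z.1 z.2)) * E z.2)%:E)).
    apply/measurable_EFinP; apply: measurable_funM.
      apply: measurable_funD => //; apply: measurable_cos_comp.
      exact: measurable_dot_comp.
    exact: (measurableT_comp measurable_E).
  by move=> z; rewrite lee_fin mulr_ge0 ?expR_ge0// -lerBlDl sub0r cos_geN1.
apply: (eq_measurable_fun (fun x => (2 * pi) ^- d * (fine (F x) - \int[L]_xi E xi))).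
  move=> x _; rewrite -/(g x) gE; congr (_ * _).
  rewrite -[fine _]/(\int[L]_xi ((1 + cos (dot x xi)) * E xi)) -RintegralB//.
    by apply: eq_Rintegral => xi _; ring.
  apply: (@integrable_bounded_mul _ _ _ _ _ _ _ 2) => //.
    by apply: measurable_funD => //; apply: measurable_cos_comp; exact: measurable_dotr.
  move=> xi _; rewrite (le_trans (ler_normD _ _))// normr1.
  by have := cos_max (dot x xi); lra.
apply: measurable_funM => //; apply: measurable_funB => //.
exact: measurableT_comp.
Qed.

Lemma lebesgue_rVT_gt0 : (0 < L setT)%E.
Proof.
have h := lebesgue_rV_box (R := R) (n := d) (A := fun=> `[0, 1]%classic) (fun _ => measurable_itv _).
apply: (@lt_le_trans _ _ (L [set x : Rd | forall i, (`[0, 1]%classic : set R) (x ord0 i)])).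
  rewrite h big1 ?lte01// => i _.
  by rewrite lebesgue_measure_itv/= lte_fin ltr01 oppr0 adde0.
apply: le_measure; rewrite ?inE//.
by apply: (@measurable_rV_box R d (fun=> `[0, 1]%classic)) => i; exact: measurable_itv.
Qed.

Lemma Rintegral_exp_psi_gt0 : 0 < \int[L]_xi expR (- psi beta mu xi).
Proof.
rewrite lt_neqAle Rintegral_ge0 ?andbT; last by move=> xi _; exact: expR_ge0.
apply/eqP => h.
have : (\int[L]_xi `|(E xi)%:E| = 0)%E.
  under eq_integral do rewrite gee0_abs ?lee_fin ?expR_ge0//.
  rewrite -[LHS]fineK; last exact: integrable_fin_num.
  by congr EFin; rewrite h.
have mE : measurable_fun setT (EFin \o E) by exact/measurable_EFinP.
move/(ae_eq_integral_abs L measurableT mE).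
move=> [N [mN N0 sN]]; have := lebesgue_rVT_gt0.
rewrite ltNge => /negP; apply; rewrite -N0; apply: le_measure; rewrite ?inE//.
by move=> x _; apply: sN => /= /(_ Logic.I) [] /eqP; rewrite gt_eqF// expR_gt0.
Qed.

(** The loss 1 - cos(x . xi) is at most 2 |x| times the sum of the |xi_i|, so replacing the cosine
    by 1 costs at most 2 |x| B. The radius A / (4 B) makes this cost half of A. *)
Lemma G1_lower : exists r0 e0, [/\ 0 < r0, 0 < e0 &
  forall x, enorm x <= r0 -> e0 <= G beta mu 1 x].
Proof.
pose A := \int[L]_xi E xi.
pose B := \int[L]_xi ((1 + \sum_(i < d) `|xi ord0 i|) * E xi).
have A0 : 0 < A by exact: Rintegral_exp_psi_gt0.
have B0 : 0 < B.
  rewrite (lt_le_trans A0)//; apply: le_Rintegral => //.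
    exact: integrable_exp_psi_moment.
  by move=> xi _; rewrite ler_peMl ?expR_ge0// lerDl sumr_ge0.
exists (A / (4 * B)), ((2 * pi) ^- d * (A / 2)); split.
- by rewrite divr_gt0// mulr_gt0.
- by rewrite mulr_gt0// divr_gt0.
move=> x xr; rewrite -/(g x) gE ler_wpM2l ?(ltW k0)//.
have H : A - \int[L]_xi (cos (dot x xi) * E xi) <= 2 * enorm x * B.
  rewrite /A /B -RintegralB//; last exact: integrable_cos_mul.
  rewrite -RintegralZl//; last exact: integrable_exp_psi_moment.
  apply: le_Rintegral => //.
  - have := integrableB measurableT intE (integrable_cos_mul x intE).
    by congr (integrable _ _ _); apply/funext => xi/=; rewrite -EFinB.
  - by apply: integrable_scale => //; exact: integrable_exp_psi_moment.
  move=> xi _; rewrite -{1}(mul1r (E xi)) -mulrBl mulrA ler_wpM2r ?expR_ge0//.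
  have h1 : `|dot x xi| <= enorm x * \sum_(i < d) `|xi ord0 i|.
    rewrite mulr_sumr (le_trans (ler_norm_sum _ _ _))//; apply: ler_sum => i _.
    by rewrite normrM ler_wpM2r// coord_le_enorm.
  have h2 : 1 - cos (dot x xi) <= 2 * `|dot x xi|.
    have := one_sub_cos_le2 (dot x xi); have := one_sub_cos_le_sqr (dot x xi).
    rewrite -(real_normK (num_real (dot x xi))); set y := `|_|.
    have : 0 <= y by exact: normr_ge0.
    have [y1|y1] := leP y 1; nra.
  have := enorm_ge0 x; nra.
have : 2 * enorm x * B <= A / 2.
  have -> : A / 2 = 2 * (A / (4 * B)) * B by field; rewrite gt_eqF.
  by rewrite ler_wpM2r ?(ltW B0)// ler_wpM2l.
by move: H; lra.
Qed.

(** Against exp(-delta |x|_1), Fubini turns the integral of G into that of exp(-psi) <= 1 against a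
    product of Poisson kernels of mass (2 pi)^d. Nonnegativity of G lets monotone convergence remove
    the regularisation. *)
Lemma integral_G1_lty : (\int[L]_x (G beta mu 1 x)%:E <= 1)%E.
Proof.
pose e k : Rd -> R := exp_l1 (k.+1%:R^-1).
have kp k : 0 < k.+1%:R^-1 :> R by rewrite invr_gt0 ltr0n.
have me k : measurable_fun setT (e k) by exact: measurable_exp_l1.
have bound k : (\int[L]_x (g x * e k x)%:E <= 1)%E.
  have intge : L.-integrable setT (EFin \o (fun x => g x * e k x)).
    apply: (@integrable_bounded_mul _ _ _ _ _ _ _ G1_sup) => //.
    - exact: measurable_G1.
    - by move=> x _; rewrite ger0_norm ?G1_ge0 ?G1_le.
    - exact: integrable_exp_l1.
  rewrite -[leLHS]fineK; last exact: integrable_fin_num.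
  rewrite lee_fin -[leLHS]/(\int[L]_x (g x * e k x)).
  have -> : \int[L]_x (g x * e k x) =
      \int[L]_x \int[L]_xi ((2 * pi) ^- d * (e k x * (cos (dot x xi) * E xi))).
    apply: eq_Rintegral => x _; rewrite gE RintegralZl//; last first.
      by apply: integrable_scale => //; exact: integrable_cos_mul.
    by rewrite RintegralZl//; [ring|exact: integrable_cos_mul].
  rewrite (@Rintegral_tensor_fubini _ _ _ _ _ L L (e k) (fun xi => (2 * pi) ^- d * E xi)
    (fun z => (2 * pi) ^- d * (e k z.1 * (cos (dot z.1 z.2) * E z.2)))) //; last 4 first.
  - apply: measurable_funM => //; apply: measurable_funM.
      exact: (measurableT_comp (me k)).
    apply: measurable_funM; last exact: (measurableT_comp measurable_E).
    by apply: measurable_cos_comp; exact: measurable_dot_comp.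
  - exact: integrable_exp_l1.
  - exact: integrable_scale.
  - move=> x xi; rewrite /= !normrM (ger0_norm (ltW k0)) (ger0_norm (exp_l1_ge0 _ _)) (ger0_norm (expR_ge0 _)).
    rewrite mulrCA ler_wpM2l ?exp_l1_ge0// ler_wpM2l ?(ltW k0)//.
    by rewrite ler_piMl ?expR_ge0// cos_max.
  have kerP : (\int[leb]_u (exp_kernel k.+1%:R^-1 u)%:E < +oo)%E.
    by rewrite integral_exp_kernel// ltry.
  have mker : measurable_fun setT (exp_kernel (k.+1%:R^-1 : R)).
    exact: measurable_exp_kernel.
  pose K xi := \prod_(i < d) exp_kernel (k.+1%:R^-1 : R) (xi ord0 i).
  have intK : L.-integrable setT (EFin \o K).
    by apply: integrable_rV_prod => // u; exact: exp_kernel_ge0.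
  have IK : \int[L]_xi K xi = (2 * pi) ^+ d.
    rewrite /Rintegral ge0_integral_rV_prod//; last by move=> u; exact: exp_kernel_ge0.
    by rewrite integral_exp_kernel// -EFin_expe.
  rewrite [leLHS](_ : _ = \int[L]_xi ((2 * pi) ^- d * (E xi * K xi))); last first.
    apply: eq_Rintegral => xi _.
    have Ie : L.-integrable setT (EFin \o (fun x => cos (dot xi x) * e k x)).
      by apply: integrable_cos_mul; exact: integrable_exp_l1.
    transitivity (\int[L]_x (((2 * pi) ^- d * E xi) * (cos (dot xi x) * e k x))).
      by apply: eq_Rintegral => x _ /=; rewrite dotC; ring.
    rewrite RintegralZl// -mulrA; congr (_ * (_ * _)).
    have := Rintegral_exp_l1_cos xi 0 (kp k); rewrite cos0 mul1r -/(K xi) => <-.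
    by apply: eq_Rintegral => x _; rewrite addr0.
  have intEK : L.-integrable setT (EFin \o (fun xi => E xi * K xi)).
    apply: (@integrable_bounded_mul _ _ _ _ _ _ _ 1) => //.
    by move=> xi _; rewrite ger0_norm ?expR_ge0// expR_le1 oppr_le0 psi_ge0.
  rewrite RintegralZl//.
  rewrite mulrC ler_pdivrMr ?exprn_gt0 ?mulr_gt0 ?pi_gt0// mul1r -IK.
  apply: le_Rintegral => //.
  move=> xi _; rewrite ler_piMl ?prodr_ge0//; last by rewrite expR_le1 oppr_le0 psi_ge0.
  by move=> i _; exact: exp_kernel_ge0.
have cvgI : (\int[L]_x (g x * e k x)%:E @[k --> \oo] --> \int[L]_x (g x)%:E)%E.
  have -> : (\int[L]_x (g x)%:E = \int[L]_x limn (fun k => (g x * e k x)%:E))%E.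
    apply: eq_integral => x _; apply/esym/cvg_lim => //.
    apply: cvg_EFin; first exact: nearW.
    rewrite -[X in _ --> X]mulr1; apply: cvgM; first exact: cvg_cst.
    exact: cvg_exp_l1.
  apply: cvg_monotone_convergence => //.
  - move=> k; apply/measurable_EFinP; apply: measurable_funM => //.
    exact: measurable_G1.
  - by move=> k x _; rewrite lee_fin mulr_ge0 ?exp_l1_ge0// G1_ge0.
  - move=> x _ k l kl; rewrite lee_fin ler_wpM2l ?G1_ge0//.
    rewrite /e /exp_l1 ler_prod// => i _; rewrite expR_ge0 ler_expR !mulNr lerN2.
    by rewrite ler_wpM2r// lef_pV2 ?posrE ?ltr0n// ler_nat.
rewrite -(cvg_lim _ cvgI)//; apply: lime_le; first exact: cvgP cvgI.
exact: nearW.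
Qed.

End stable_density.

(** * Lower bound of the symbol by its minimum on the sphere *)

Section symbol_lower_bound.
Context {R : realType} {d : nat}.
Local Notation Rd := 'rV[R]_d.

Lemma continuous_enorm : continuous (@enorm R d).
Proof.
move=> x; apply: continuous_comp; last exact: sqrt_continuous.
apply: (@cvg_big _ _ +%R 0 xpredT _ _ (nbhs x)); first exact: add_continuous.
move=> i _.
have ci : (fun y : Rd => y ord0 i) @ x --> x ord0 i by exact: coord_continuous.
exact: (cvgM ci ci).
Qed.

Lemma compact_sphere : compact (@sphere R d).
Proof.
apply: bounded_closed_compact.
- exists 1; split; first exact: num_real.
  move=> M M1 x x1 /=; rewrite (le_trans _ (ltW M1))//.
  rewrite [`|x|]mx_normrE; apply/bigmax_leP; split=> // -[i j] _ /=.
  by rewrite (ord1 i) (le_trans (coord_le_enorm _ _))// x1.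
- rewrite (_ : sphere = @enorm R d @^-1` [set 1])//.
  by apply: closed_comp; [move=> x _; exact: continuous_enorm|exact: closed_eq].
Qed.

Lemma sphere_nonempty : (0 < d)%N -> @sphere R d !=set0.
Proof.
move=> d0; exists (delta_mx ord0 (Ordinal d0)).
rewrite /sphere/= /enorm /dot (bigD1 (Ordinal d0))//= !mxE !eqxx/= mulr1.
rewrite big1 ?addr0 ?sqrtr1// => i /negbTE i0.
by rewrite !mxE i0 andbF mul0r.
Qed.

Lemma psi_lower_bound (beta : R) (mu : {measure set Rd -> \bar R}) k : (0 < d)%N -> 0 < beta ->
  (forall theta, sphere theta -> 0 < omega beta mu theta) ->
  sphere_Ck k (omega beta mu) ->
  exists2 c, 0 < c & forall xi, c * enorm xi `^ beta <= psi beta mu xi.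
Proof.
move=> d0 beta0 om0 [U [f [oU sU fom ckf]]].
(* Continuity of omega on the sphere is read off the extension [f]. *)
have cf : {within sphere, continuous f}.
  apply: continuous_in_subspaceT => x /set_mem sx.
  by case: k ckf => [|k] [+ _]; apply; exact: sU.
have [th0 sth0 Hmin] : exists2 th0, sphere th0 & forall th, sphere th -> f th0 <= f th.
  have [th0 /set_mem ? h] := EVT_min_rV (sphere_nonempty d0) compact_sphere cf.
  by exists th0 => // th sth; apply: h; rewrite inE.
exists (f th0); first by rewrite fom// om0.
move=> xi; rewrite /psi; case: ifPn => [/eqP ->|xi0].
  have -> : enorm (0 : Rd) = 0 by apply/eqP; rewrite enorm_eq0.
  by rewrite powR0 ?mulr0// gt_eqF.
rewrite mulrC ler_wpM2l ?powR_ge0// -(fom _ (sphere_radial xi0)).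
exact/Hmin/sphere_radial.
Qed.

End symbol_lower_bound.

(** * The inverse stable subordinator *)

Section inverse_subordinator.
Context {R : realType}.
Local Notation leb := (@lebesgue_measure R).
Variables (alpha : R) (g : R -> R).
Hypotheses (alpha01 : 0 < alpha < 1) (gP : one_sided_stable_density alpha g).

Let a0 : 0 < alpha. Proof. by case/andP: alpha01. Qed.
Let g_cont : continuous g. Proof. by case: gP. Qed.
Let g_ge0 s : 0 <= g s. Proof. by case: gP. Qed.

(* When g is the one-sided alpha-stable density, this is the Mittag-Leffler law,
   the density at time 1 of the inverse subordinator. *)
Definition ml_density (s : R) : R := alpha^-1 * (s `^ (- 1 - alpha^-1) * g (s `^ (- alpha^-1))).

Lemma ml_density_ge0 s : 0 <= ml_density s.
Proof. by rewrite !mulr_ge0 ?powR_ge0// invr_ge0 ltW. Qed.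

Lemma measurable_ml_density : measurable_fun setT ml_density.
Proof.
apply: measurable_funM => //; apply: measurable_funM; first exact: measurable_powR.
apply: (measurableT_comp (continuous_measurable_fun g_cont)).
exact: measurable_powR.
Qed.

Let F (s : R) : R := s `^ (- alpha^-1).

Let continuous_powR_gt0 (b r : R) : 0 < r -> {for r, continuous (fun u : R => u `^ b)}.
Proof.
move=> r0; apply: differentiable_continuous; apply/derivable1_diffP.
by apply: derivable_powR; rewrite in_itv/= andbT.
Qed.

Let F_decr (x y : R) : 0 < x -> x < y -> F y < F x.
Proof.
move=> x0 xy; have y0 := lt_trans x0 xy.
rewrite /F !powRN ltf_pV2 ?posrE ?powR_gt0// gt0_ltr_powR ?invr_gt0 ?nnegrE//; exact: ltW.
Qed.

Let dF (s : R) : 0 < s -> is_derive s 1 F (- alpha^-1 * s `^ (- alpha^-1 - 1)).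
Proof. by move=> s0; exact: is_derive1_powR. Qed.

Let dFE (s : R) : 0 < s -> F^`()%classic s = - alpha^-1 * s `^ (- alpha^-1 - 1).
Proof. by move=> s0; rewrite derive1E; have [_ ->] := dF s0. Qed.

(** The substitution u = s^(-1/alpha) is decreasing, and the factors in front of [g] in [ml_density]
    are the absolute value of its derivative. *)
Lemma subordinator_substitution_segment (h : R -> R) (x y : R) : 0 < x -> x < y ->
  continuous h ->
  (\int[leb]_(u in `[F y, F x]) (h u * g u)%:E =
   \int[leb]_(s in `[x, y]) (h (F s) * ml_density s)%:E)%E.
Proof.
move=> x0 xy ch.
have pos s : s \in `[x, y]%R -> 0 < s by rewrite in_itv/= => /andP[+ _]; exact: lt_le_trans.
have poso s : s \in `]x, y[%R -> 0 < s by rewrite in_itv/= => /andP[+ _]; exact: lt_trans.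
have y0 := lt_trans x0 xy.
have cdF (s : R) : 0 < s -> F^`()%classic r @[r --> s] --> - alpha^-1 * s `^ (- alpha^-1 - 1).
  move=> s0; apply: (@cvg_trans _ ((- alpha^-1 * r `^ (- alpha^-1 - 1)) @[r --> s])).
    apply: near_eq_cvg; near=> r; rewrite dFE//; near: r; exact: lt_nbhsr.
  have c := @continuous_powR_gt0 (- alpha^-1 - 1) s s0.
  exact: (@cvgM _ _ (nbhs s) _ (cst (- alpha^-1)) _ _ _ (cvg_cst _) c).
rewrite (@integration_by_substitution_decreasing _ F (fun u => h u * g u) x y (ltW xy)).
- apply: eq_integral => s; rewrite inE/= => sxy; have s0 := pos _ sxy.
  congr EFin; rewrite /= !fctE dFE// /ml_density -/(F s) (addrC (- alpha^-1)).
  ring.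
- move=> u v uxy vxy uv; apply: F_decr => //; exact: pos.
- move=> s sxy; have s0 := poso _ sxy.
  rewrite /continuous_at dFE//; exact: cdF.
- apply/cvg_ex; exists (- alpha^-1 * x `^ (- alpha^-1 - 1)).
  by apply: cvg_at_right_filter; exact: cdF.
- apply/cvg_ex; exists (- alpha^-1 * y `^ (- alpha^-1 - 1)).
  by apply: cvg_at_left_filter; exact: cdF.
- split.
  + by move=> s sxy; have [] := dF (poso _ sxy).
  + by apply: cvg_at_right_filter; exact: continuous_powR_gt0.
  + by apply: cvg_at_left_filter; exact: continuous_powR_gt0.
- by apply: continuous_subspaceT => u; apply: cvgM; [exact: ch|exact: g_cont].
Unshelve. all: by end_near. Qed.

(** Both half-line integrals are limits over increasing segments that the substitution maps onto
    each other. *)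
Lemma subordinator_substitution (h : R -> R) : continuous h -> (forall u, 0 <= h u) ->
  (\int[leb]_(s in `]0%R, +oo[) (h (F s) * ml_density s)%:E =
   \int[leb]_(u in `]0%R, +oo[) (h u * g u)%:E)%E.
Proof.
move=> ch h0.
(* The shift by 2 keeps the segments nondegenerate: with k + 1 the first one would be the single
   point 1. *)
pose x (k : nat) : R := k.+2%:R^-1.
pose y (k : nat) : R := k.+2%:R.
have x0 k : 0 < x k by rewrite invr_gt0 ltr0n.
have y1 k : 1 < y k by rewrite ltr1n.
have xy k : x k < y k by rewrite (lt_trans _ (y1 k))// invf_lt1 ?ltr0n ?ltr1n.
have mh : measurable_fun setT h by exact: continuous_measurable_fun.
have mF : measurable_fun setT F by exact: measurable_powR.
have xd k : x k.+1 <= x k by rewrite lef_pV2 ?posrE ?ltr0n// ler_nat.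
have yd k : y k <= y k.+1 by rewrite ler_nat.
have nd1 : nondecreasing_seq (fun k => `[x k, y k]%classic).
  apply/nondecreasing_seqP => k; apply/subsetPset => s/=; rewrite !in_itv/=.
  by move=> /andP[xs sy]; rewrite (le_trans _ xs)// (le_trans sy).
have Fle (u v : R) : 0 < u -> u <= v -> F v <= F u.
  by move=> u0; rewrite le_eqVlt => /predU1P[->//|uv]; rewrite ltW// F_decr.
have y0 k : 0 < y k by exact: lt_trans (y1 k).
have nd2 : nondecreasing_seq (fun k => `[F (y k), F (x k)]%classic).
  apply/nondecreasing_seqP => k; apply/subsetPset => s/=; rewrite !in_itv/=.
  by move=> /andP[ys sx]; rewrite (le_trans (Fle _ _ (y0 k) (yd k)))// (le_trans sx)// Fle.
have bigN (s : R) : 0 < s -> exists k, x k <= s <= y k.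
  move=> s0; exists (maxn (Num.truncn s) (Num.truncn s^-1)); apply/andP; split.
    rewrite /x invf_ple ?posrE ?ltr0n// ltW// (lt_le_trans (truncnS_gt _))// ler_nat.
    by rewrite ltnS leqW// leq_maxr.
  rewrite /y ltW// (lt_le_trans (truncnS_gt _))// ler_nat.
  by rewrite ltnS leqW// leq_maxl.
have U1 : `]0%R, +oo[%classic = \bigcup_k `[x k, y k]%classic.
  apply/seteqP; split=> s/=; rewrite in_itv/= andbT.
    by move=> /bigN[k kP]; exists k => //=; rewrite in_itv.
  by move=> [k _ /=]; rewrite in_itv/= => /andP[+ _]; exact: lt_le_trans.
have U2 : `]0%R, +oo[%classic = \bigcup_k `[F (y k), F (x k)]%classic.
  apply/seteqP; split=> s/=; rewrite in_itv/= andbT.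
    move=> s0; have sa0 : 0 < s `^ (- alpha) by exact: powR_gt0.
    have [k /andP[k1 k2]] := bigN _ sa0; exists k => //=; rewrite in_itv/=.
    have -> : s = F (s `^ (- alpha)).
      by rewrite /F -powRrM mulrNN mulfV ?powRr1 ?(ltW s0)// gt_eqF.
    by rewrite !Fle.
  move=> [k _ /=]; rewrite in_itv/= => /andP[+ _]; apply: lt_le_trans.
  by rewrite powR_gt0.
have c1 : (\int[leb]_(s in `[x k, y k]) (h (F s) * ml_density s)%:E @[k --> \oo] -->
    \int[leb]_(s in `]0%R, +oo[) (h (F s) * ml_density s)%:E)%E.
  rewrite U1; apply: ge0_nondecreasing_set_cvg_integral => //.
  - move=> k; apply: measurable_funTS; apply/measurable_EFinP; apply: measurable_funM.
      exact: measurableT_comp.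
    exact: measurable_ml_density.
  - by move=> k s _; rewrite lee_fin mulr_ge0 ?ml_density_ge0.
have c2 : (\int[leb]_(u in `[F (y k), F (x k)]) (h u * g u)%:E @[k --> \oo] -->
    \int[leb]_(u in `]0%R, +oo[) (h u * g u)%:E)%E.
  rewrite U2; apply: ge0_nondecreasing_set_cvg_integral => //.
  - move=> k; apply: measurable_funTS; apply/measurable_EFinP; apply: measurable_funM => //.
    exact: continuous_measurable_fun.
  - by move=> k s _; rewrite lee_fin mulr_ge0.
rewrite -(cvg_lim _ c1)// -(cvg_lim _ c2)//; congr (limn _).
by apply/funext => k; rewrite subordinator_substitution_segment.
Qed.

(** Under M the variable s^(-1/alpha) has the stable density, so this is the stable Laplace
    transform at [sigma]. *)
Lemma ml_laplace (sigma : R) : 0 <= sigma ->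
  (\int[leb]_(s in `]0%R, +oo[) (expR (- (sigma * s `^ (- alpha^-1))) * ml_density s)%:E =
   (expR (- sigma `^ alpha))%:E)%E.
Proof.
move=> s0; have [_ _ _ /(_ _ s0) <-] := gP.
rewrite (subordinator_substitution (h := fun u => expR (- (sigma * u)))).
- by apply: eq_integral => u _; rewrite mulNr.
- move=> u; apply: continuous_comp; last exact: continuous_expR.
  by apply: cvgN; apply: cvgM; [exact: cvg_cst|exact: cvg_id].
- by move=> u; exact: expR_ge0.
Qed.

End inverse_subordinator.

(** * Tonelli's theorem on a rectangle *)

Section tonelli_in.
Context d1 d2 (T1 : measurableType d1) (T2 : measurableType d2) (R : realType).
Variables (m1 : {sigma_finite_measure set T1 -> \bar R})
  (m2 : {sigma_finite_measure set T2 -> \bar R}).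
Variables (D1 : set T1) (D2 : set T2) (f : T1 * T2 -> \bar R).
Hypotheses (mD1 : measurable D1) (mD2 : measurable D2) (mf : measurable_fun setT f)
  (f0 : forall x y, D1 x -> D2 y -> (0 <= f (x, y))%E).

(** The sign of [f] is known only on the rectangle, so the global theorem is applied to its
    extension by zero. *)
Let h := f \_ (D1 `*` D2).

Let mh : measurable_fun setT h.
Proof. by apply/(measurable_restrictT f) => //; [exact: measurableX|exact: measurable_funTS]. Qed.

Let h0 z : (0 <= h z)%E.
Proof.
by apply: erestrict_ge0 => -[x y] [/= D1x D2y]; exact: f0.
Qed.

Let integral_h1 : ((fun x => \int[m2]_(y in D2) f (x, y)) \_ D1 = fun x => \int[m2]_y h (x, y))%E.
Proof.
apply/funext => x; rewrite patchE; case: ifPn => [|] xD.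
  rewrite integral_mkcond; apply: eq_integral => y _.
  by rewrite /h !patchE in_setX xD.
by rewrite integral0_eq// => y _; rewrite /h patchE in_setX (negbTE xD).
Qed.

Let integral_h2 : ((fun y => \int[m1]_(x in D1) f (x, y)) \_ D2 = fun y => \int[m1]_x h (x, y))%E.
Proof.
apply/funext => y; rewrite patchE; case: ifPn => [|] yD.
  rewrite integral_mkcond; apply: eq_integral => x _.
  by rewrite /h !patchE in_setX yD andbT.
by rewrite integral0_eq// => x _; rewrite /h patchE in_setX (negbTE yD) andbF.
Qed.

Lemma measurable_fun_integral_in : measurable_fun D1 (fun x => \int[m2]_(y in D2) f (x, y))%E.
Proof.
by apply/measurable_restrictT => //; rewrite integral_h1; exact: measurable_fun_fubini_tonelli_F.
Qed.

Lemma tonelli_in :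
  (\int[m1]_(x in D1) \int[m2]_(y in D2) f (x, y) =
   \int[m2]_(y in D2) \int[m1]_(x in D1) f (x, y))%E.
Proof.
by rewrite [LHS]integral_mkcond [RHS]integral_mkcond integral_h1 integral_h2 fubini_tonelli.
Qed.

End tonelli_in.

(** * Bounds for 1 - exp(-x) and the window inequality *)

Section one_sub_exp.
Context {R : realType}.

Lemma one_sub_expN_le (x : R) : 1 - expR (- x) <= x.
Proof. by have := expR_ge1Dx (- x); lra. Qed.

Lemma one_sub_expN_le1 (x : R) : 1 - expR (- x) <= 1.
Proof. by have := expR_ge0 (- x); lra. Qed.

Lemma one_sub_expN_ge0 (x : R) : 0 <= x -> 0 <= 1 - expR (- x).
Proof. by move=> x0; rewrite subr_ge0 expR_le1 oppr_le0. Qed.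

Lemma one_sub_expN_ge (x : R) : 0 <= x -> x / (1 + x) <= 1 - expR (- x).
Proof.
move=> x0; have x1 : 0 < 1 + x by rewrite ltr_pwDl.
have : expR (- x) <= (1 + x)^-1 by rewrite expRN lef_pV2 ?posrE ?expR_gt0// expR_ge1Dx.
have -> : x / (1 + x) = 1 - (1 + x)^-1 by field; rewrite gt_eqF.
lra.
Qed.

Lemma one_sub_expN_ge_half (x : R) : 0 <= x <= 1 -> x <= 2 * (1 - expR (- x)).
Proof.
move=> /andP[x0 x1]; have := one_sub_expN_ge x0.
have y1 : 0 < 1 + x by rewrite ltr_pwDl.
rewrite ler_pdivrMr//; have := one_sub_expN_ge0 x0.
by set z := 1 - expR (- x); nra.
Qed.

Lemma one_sub_expN_ge1 (x : R) : 1 <= x -> 1 <= 2 * (1 - expR (- x)).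
Proof.
move=> x1; have x0 : 0 <= x by lra.
have := one_sub_expN_ge x0; have y1 : 0 < 1 + x by rewrite ltr_pwDl.
rewrite ler_pdivrMr//; have := one_sub_expN_ge0 x0.
by set z := 1 - expR (- x); nra.
Qed.

(* Isolates the window in which a variable with a regularly varying Laplace
   exponent puts a definite share of its tail. *)
Lemma one_sub_expN_window (e A v : R) : 0 < e -> 0 < A -> 0 <= v ->
  1 - expR (- v) <= \1_(`]e, A]%classic : set R) v
    + 2 * e * (1 - expR (- (v / e))) + 2 * (1 - expR (- (v / A))).
Proof.
move=> e0 A0 v0.
have h1 : 0 <= 1 - expR (- (v / e)) by rewrite one_sub_expN_ge0// divr_ge0// ltW.
have h2 : 0 <= 1 - expR (- (v / A)) by rewrite one_sub_expN_ge0// divr_ge0// ltW.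
have h3 : 0 <= e * (1 - expR (- (v / e))) by rewrite mulr_ge0// ltW.
have [ve|ve] := leP v e.
  have : v / e <= 2 * (1 - expR (- (v / e))).
    by rewrite one_sub_expN_ge_half// divr_ge0 ?(ltW e0)//= ler_pdivrMr ?mul1r.
  rewrite ler_pdivrMr// => h; have := one_sub_expN_le v.
  have : 0 <= \1_(`]e, A]%classic : set R) v :> R by [].
  nra.
have [vA|vA] := leP v A.
  rewrite indicE mem_set//=; last by rewrite in_itv/= ve.
  have := one_sub_expN_le1 v; nra.
have : 1 <= 2 * (1 - expR (- (v / A))).
  by rewrite one_sub_expN_ge1// ler_pdivlMr// mul1r ltW.
have : 0 <= \1_(`]e, A]%classic : set R) v :> R by [].
have := one_sub_expN_le1 v; nra.
Qed.

(** With u = sigma^alpha, the left side of the inequality is at least u / 2, and the constant 16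
    makes each of the two error terms at most u / 8; what remains is u / 4. *)
Lemma window_arith (alpha e A sigma P : R) : 0 < alpha -> 0 < e -> 0 < A ->
  e * e `^ (- alpha) = 16^-1 -> A `^ (- alpha) = 16^-1 -> 0 < sigma <= 1 ->
  1 - expR (- sigma `^ alpha) <= P + 2 * e * (1 - expR (- (sigma / e) `^ alpha))
    + 2 * (1 - expR (- (sigma / A) `^ alpha)) ->
  sigma `^ alpha / 4 <= P.
Proof.
move=> a0 e0 A0 ea Aa /andP[s0 s1].
have sa0 : 0 <= sigma `^ alpha by exact: powR_ge0.
have sa1 : sigma `^ alpha <= 1.
  have := ge0_ler_powR (ltW a0) (_ : sigma \in Num.nneg) (_ : 1 \in Num.nneg) s1.
  by rewrite powR1; apply; rewrite nnegrE ?ler01 ?ltW.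
have h1 : sigma `^ alpha <= 2 * (1 - expR (- sigma `^ alpha)).
  by rewrite one_sub_expN_ge_half ?sa0.
have h2 : 2 * e * (1 - expR (- (sigma / e) `^ alpha)) <= 2 * e * (sigma / e) `^ alpha.
  by rewrite ler_wpM2l ?mulr_ge0 ?(ltW e0)// one_sub_expN_le.
have h3 : 2 * (1 - expR (- (sigma / A) `^ alpha)) <= 2 * (sigma / A) `^ alpha.
  by rewrite ler_wpM2l// one_sub_expN_le.
have ee : (sigma / e) `^ alpha = sigma `^ alpha * e `^ (- alpha).
  by rewrite powRM ?invr_ge0 ?(ltW s0) ?(ltW e0)// -powR_inv1 ?(ltW e0)// -powRrM mulN1r.
have eA : (sigma / A) `^ alpha = sigma `^ alpha * A `^ (- alpha).
  by rewrite powRM ?invr_ge0 ?(ltW s0) ?(ltW A0)// -powR_inv1 ?(ltW A0)// -powRrM mulN1r.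
have e2 : 2 * e * (sigma / e) `^ alpha = 2 * (sigma `^ alpha * 16^-1).
  by rewrite ee -ea; move: (sigma `^ _) (e `^ _) => u v; ring.
move: h1 h2 h3; rewrite e2 eA Aa.
move: (expR (- sigma `^ alpha)) (2 * e * _) (expR (- (sigma / A) `^ alpha)) (sigma `^ alpha) => E1 E2 E3 u.
lra.
Qed.

End one_sub_exp.

Lemma integrable_add d (T : measurableType d) (R : realType)
    (m : {measure set T -> \bar R}) (D : set T) (f1 f2 : T -> R) : measurable D ->
  m.-integrable D (EFin \o f1) -> m.-integrable D (EFin \o f2) ->
  m.-integrable D (EFin \o (fun x => f1 x + f2 x)).
Proof. by move=> mD i1 i2; exact: (integrableD mD i1 i2). Qed.

Lemma RintegralDZ2 d (T : measurableType d) (R : realType)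
    (m : {measure set T -> \bar R}) (D : set T) (f1 f2 f3 : T -> R) (a b : R) : measurable D ->
  m.-integrable D (EFin \o f1) -> m.-integrable D (EFin \o f2) -> m.-integrable D (EFin \o f3) ->
  \int[m]_(x in D) (f1 x + a * f2 x + b * f3 x) =
  \int[m]_(x in D) f1 x + a * \int[m]_(x in D) f2 x + b * \int[m]_(x in D) f3 x.
Proof.
move=> mD i1 i2 i3.
have i2' := integrable_scale a mD i2; have i3' := integrable_scale b mD i3.
rewrite (RintegralD mD (integrable_add mD i1 i2') i3') (RintegralD mD i1 i2').
by rewrite (RintegralZl _ mD i2) (RintegralZl _ mD i3).
Qed.

(** * Negative moments and mass near 0 of the inverse subordinator *)

Section subordinator_moments.
Context {R : realType}.
Local Notation leb := (@lebesgue_measure R).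
Variables (alpha : R) (g : R -> R).
Hypotheses (alpha01 : 0 < alpha < 1) (gP : one_sided_stable_density alpha g).

Let a0 : 0 < alpha. Proof. by case/andP: alpha01. Qed.
Let a1 : alpha < 1. Proof. by case/andP: alpha01. Qed.
Let M := ml_density alpha g.
Let V (s : R) : R := s `^ (- alpha^-1).
Let V0 s : 0 <= V s. Proof. exact: powR_ge0. Qed.
Let M0 s : 0 <= M s. Proof. exact: (ml_density_ge0 alpha01 gP). Qed.
Let mM : measurable_fun setT M. Proof. exact: (measurable_ml_density gP). Qed.
Let mV : measurable_fun setT V. Proof. exact: measurable_powR. Qed.

Lemma ml_mass : (\int[leb]_(s in `]0%R, +oo[) (M s)%:E = 1)%E.
Proof.
have := ml_laplace alpha01 gP (lexx 0).
rewrite powR0 ?gt_eqF// oppr0 expR0 => <-.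
by apply: eq_integral => s _; rewrite mul0r oppr0 expR0 mul1r.
Qed.

Lemma integrable_ml_density : leb.-integrable `]0%R, +oo[ (EFin \o M).
Proof.
apply/integrableP; split; first by apply: measurable_funTS; exact/measurable_EFinP.
rewrite [ltLHS](_ : _ = 1%E) ?ltry// -ml_mass; apply: eq_integral => s _ /=.
by rewrite ger0_norm.
Qed.

Lemma integrable_ml_laplace (sigma : R) : 0 <= sigma ->
  leb.-integrable `]0%R, +oo[ (EFin \o (fun s => (1 - expR (- (sigma * V s))) * M s)).
Proof.
move=> s0; apply: (@integrable_bounded_mul _ _ _ _ _ _ _ 1) => //.
- apply: measurable_funTS; apply: measurable_funB => //.
  apply: measurableT_comp => //; apply: measurableT_comp => //.
  exact: measurable_funM.
- move=> s _; rewrite ger0_norm ?one_sub_expN_le1// one_sub_expN_ge0//.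
  by rewrite mulr_ge0.
- exact: integrable_ml_density.
Qed.

Lemma Rintegral_ml_laplace (sigma : R) : 0 <= sigma ->
  \int[leb]_(s in `]0%R, +oo[) ((1 - expR (- (sigma * V s))) * M s) = 1 - expR (- sigma `^ alpha).
Proof.
move=> s0.
transitivity (\int[leb]_(s in `]0%R, +oo[) (M s - expR (- (sigma * V s)) * M s)).
  by apply: eq_Rintegral => s _; ring.
rewrite RintegralB//; last 2 first.
- exact: integrable_ml_density.
- apply: (@integrable_bounded_mul _ _ _ _ _ _ _ 1) => //.
  + apply: measurable_funTS.
    apply: measurableT_comp => //; apply: measurableT_comp => //.
    exact: measurable_funM.
  + by move=> s _; rewrite ger0_norm ?expR_ge0// expR_le1 oppr_le0 mulr_ge0.
  + exact: integrable_ml_density.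
by rewrite /Rintegral ml_mass ml_laplace.
Qed.

(** With k = alpha theta, C s^(-theta) is the integral over r of (1 - exp(-r s^(-1/alpha)))
    r^(-k-1). Tonelli and the Laplace transform turn the moment into the integral of (1 -
    exp(-r^alpha)) r^(-k-1), which converges at 0 because k < alpha. *)
Lemma ml_neg_moment (theta : R) : 0 <= theta < 1 ->
  (\int[leb]_(s in `]0%R, +oo[) (s `^ (- theta) * M s)%:E < +oo)%E.
Proof.
(* At theta = 0 the weight r^(-k-1) would not give convergence at infinity; there the moment is the
   total mass. *)
move=> /andP[]; rewrite le_eqVlt => /predU1P[<- _|th0 th1].
  under eq_integral do rewrite oppr0 powRr0 mul1r.
  by rewrite ml_mass ltry.
pose k := alpha * theta.
have k0 : 0 < k by rewrite mulr_gt0.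
have ka : k < alpha by rewrite /k gtr_pMr.
pose C := (\int[leb]_(r in `]0%R, +oo[) ((1 - expR (- r)) * r `^ (- k - 1))%:E)%E.
have mphi : measurable_fun setT (fun r : R => 1 - expR (- r)).
  by apply: measurable_funB => //; apply: measurableT_comp.
have phi0 (r : R) : 0 < r -> 0 <= 1 - expR (- r) by move=> r0; rewrite one_sub_expN_ge0// ltW.
have C0 : (0 < C)%E.
  apply: (@integral_power_weight_gt0 _ _ (1 / 2)) => //.
  move=> r /andP[r1 _]; have := one_sub_expN_ge1 r1; lra.
have mS : measurable_fun (`]0%R, +oo[%classic : set R) (fun s => (s `^ (- theta) * M s)%:E).
  apply: measurable_funTS; apply/measurable_EFinP; apply: measurable_funM => //.
have key : (C * \int[leb]_(s in `]0%R, +oo[) (s `^ (- theta) * M s)%:E < +oo)%E.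
  rewrite -ge0_integralZl//; last 2 first.
  - by move=> s _; rewrite lee_fin mulr_ge0 ?powR_ge0.
  - exact: ltW.
  pose f (z : R * R) := (M z.1 * ((1 - expR (- (V z.1 * z.2))) * z.2 `^ (- k - 1)))%:E.
  have mf : measurable_fun setT f.
    apply/measurable_EFinP; apply: measurable_funM; first exact: (measurableT_comp mM).
    apply: measurable_funM; last exact: (measurableT_comp (measurable_powR _)).
    apply: (measurableT_comp mphi); apply: measurable_funM => //.
    exact: (measurableT_comp mV).
  rewrite (eq_integral (fun s : measurableTypeR R => \int[leb]_(r in `]0%R, +oo[) f (s, r)))%E; last first.
    move=> s; rewrite inE/= in_itv/= andbT => s0.
    have Vs : 0 < V s by exact: powR_gt0.
    have := integral_power_weight_dilation k Vs mphi phi0; rewrite -/C => E.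
    rewrite (_ : s `^ (- theta) = V s `^ k); last first.
      by rewrite /V -powRrM /k; congr (_ `^ _); field; rewrite gt_eqF.
    rewrite mulrC EFinM muleCA (muleC C) -E /f -ge0_integralZl//.
    - apply: measurable_funTS; apply/measurable_EFinP; apply: measurable_funM; last exact: measurable_powR.
      by apply: (measurableT_comp mphi); exact: measurable_funM.
    - move=> r/=; rewrite in_itv/= andbT => r0.
      by rewrite lee_fin mulr_ge0 ?powR_ge0// phi0// mulr_gt0.
    - by rewrite lee_fin.
  rewrite tonelli_in//; last first.
    move=> s r /=; rewrite !in_itv/= !andbT => s0 r0.
    by rewrite /f/= lee_fin mulr_ge0// mulr_ge0 ?powR_ge0// phi0// mulr_gt0// powR_gt0.
  rewrite (eq_integral (fun r : measurableTypeR R => ((1 - expR (- r `^ alpha)) * r `^ (- k - 1))%:E)); last first.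
    move=> r; rewrite inE/= in_itv/= andbT => r0.
    rewrite -Rintegral_ml_laplace ?(ltW r0)// EFinM /Rintegral fineK; last first.
      apply: integrable_fin_num => //; exact: integrable_ml_laplace (ltW r0).
    rewrite -ge0_integralZr//.
    - by apply: eq_integral => s _; rewrite -EFinM /f/=; congr EFin; rewrite (mulrC r); ring.
    - have := integrable_ml_laplace (ltW r0); by move/measurable_int.
    - move=> s /=; rewrite in_itv/= andbT => s0; rewrite lee_fin mulr_ge0// one_sub_expN_ge0//.
      by rewrite mulr_ge0// ltW.
    - by rewrite lee_fin powR_ge0.
  apply: (@integral_power_weight_lty _ (fun r => 1 - expR (- r `^ alpha)) 1 alpha k) => //.
  - by apply: (measurableT_comp mphi); exact: measurable_powR.
  - by move=> r r0; rewrite phi0// powR_gt0.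
  - by move=> r _; rewrite mul1r; exact: one_sub_expN_le.
(* Since C > 0, an infinite moment would make the product infinite. *)
rewrite ltey; apply: contraTN key => /eqP ->.
by rewrite gt0_muley.
Qed.

(** The window inequality is integrated against M; its exponentials become Laplace transforms at
    sigma, sigma / e and sigma / A. The constants solve e^(1-alpha) = 1/16, possible as alpha < 1,
    and A^alpha = 16. *)
Lemma ml_window : exists e A, [/\ 0 < e, 0 < A &
  forall sigma, 0 < sigma <= 1 ->
  ((sigma `^ alpha / 4)%:E <=
   \int[leb]_(s in `]0%R, +oo[) (\1_(`]e, A]%classic : set R) (sigma * V s) * M s)%:E)%E].
Proof.
pose e : R := 16^-1 `^ (1 - alpha)^-1.
pose A : R := 16 `^ alpha^-1.
have e0 : 0 < e by rewrite powR_gt0.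
have A0 : 0 < A by rewrite powR_gt0.
have ea : e * e `^ (- alpha) = 16^-1.
  rewrite -{1}(powRr1 (ltW e0)) -powRD_gt0// /e -powRrM mulVf ?powRr1//.
  by rewrite gt_eqF// subr_gt0.
have Aa : A `^ (- alpha) = 16^-1.
  by rewrite /A -powRrM mulrN mulVf ?gt_eqF// powR_inv1.
exists e, A; split => // sigma sP; have /andP[s0 s1] := sP.
have mW : measurable_fun setT (fun s => \1_(`]e, A]%classic : set R) (sigma * V s) : R).
  have m1 : measurable_fun setT (\1_(`]e, A]%classic : set R) : R -> R).
    exact: measurable_indic.
  by apply: (measurableT_comp m1); exact: measurable_funM.
have intW : leb.-integrable `]0%R, +oo[ (EFin \o (fun s => \1_(`]e, A]%classic : set R) (sigma * V s) * M s)).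
  apply: (@integrable_bounded_mul _ _ _ _ _ _ _ 1) => //.
  - exact: measurable_funTS.
  - by move=> s _; rewrite ger0_norm// indicE; case: (_ \in _); rewrite ?ler01 ?lexx.
  - exact: integrable_ml_density.
rewrite -[leRHS]fineK; last exact: integrable_fin_num.
rewrite lee_fin -[leRHS]/(\int[leb]_(s in `]0%R, +oo[) (\1_(`]e, A]%classic : set R) (sigma * V s) * M s)).
have mD : measurable (`]0%R, +oo[%classic : set (measurableTypeR R)) by [].
have se0 : 0 <= sigma / e by rewrite divr_ge0// ltW.
have sA0 : 0 <= sigma / A by rewrite divr_ge0// ltW.
have i1 := integrable_ml_laplace (ltW s0).
have i2 := integrable_ml_laplace se0.
have i3 := integrable_ml_laplace sA0.
have i2' := @integrable_scale R _ _ leb _ (2 * e) _ (measurable_itv _) i2.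
have i3' := @integrable_scale R _ _ leb _ 2 _ (measurable_itv _) i3.
have i12 := integrable_add mD intW i2'.
have i123 := integrable_add mD i12 i3'.
have ptw (s : measurableTypeR R) : `]0%R, +oo[%classic s -> (1 - expR (- (sigma * V s))) * M s <=
    \1_(`]e, A]%classic : set R) (sigma * V s) * M s
    + 2 * e * ((1 - expR (- (sigma / e * V s))) * M s)
    + 2 * ((1 - expR (- (sigma / A * V s))) * M s).
  move=> _; move: (M s) (M0 s) (V s) (V0 s) => m m0 v v0.
  rewrite !mulrA -!mulrDl ler_wpM2r//.
  have := one_sub_expN_window e0 A0 (mulr_ge0 (ltW s0) v0).
  by rewrite [sigma * v / e]mulrAC [sigma * v / A]mulrAC.
have H := le_Rintegral mD i1 i123 ptw.
have E := RintegralDZ2 (2 * e) 2 mD intW i2 i3.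
apply: (window_arith a0 e0 A0 ea Aa sP).
have l1 := Rintegral_ml_laplace (ltW s0).
have l2 := Rintegral_ml_laplace se0.
have l3 := Rintegral_ml_laplace sA0.
have eqle (x y : R) : x = y -> x <= y by move=> ->.
apply: (le_trans (eqle _ _ (esym l1))); apply: (le_trans H); apply: (le_trans (eqle _ _ E)).
by rewrite l2 l3.
Qed.

End subordinator_moments.

(** * The kernel Z *)

Section kernel_scaling.
Context {R : realType} {d : nat}.
Local Notation Rd := 'rV[R]_d.
Local Notation leb := (@lebesgue_measure R).
Local Notation L := (@lebesgue_rV R d).
Variables (alpha beta : R) (mu : {finite_measure set Rd -> \bar R}) (c : R) (Ga : R -> R -> R).
Hypotheses (d_gt0 : (0 < d)%N) (alpha01 : 0 < alpha < 1) (beta02 : 0 < beta < 2)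
  (c0 : 0 < c) (psi_ge : forall xi, c * enorm xi `^ beta <= psi beta mu xi)
  (gP : one_sided_stable_density alpha (Ga 1)).
Implicit Types x xi : Rd.

Let a0 : 0 < alpha. Proof. by case/andP: alpha01. Qed.
Let beta0 : 0 < beta. Proof. by case/andP: beta02. Qed.

Lemma G_scaling t x : 0 < t ->
  G beta mu t x = t `^ (- (d%:R / beta)) * G beta mu 1 (t `^ (- beta^-1) *: x).
Proof.
move=> t0; rewrite /G mulrCA; congr (_ * _).
pose e := t `^ (- beta^-1); have e0 : 0 < e by rewrite powR_gt0.
pose h xi := cos (dot (e *: x) xi) * expR (- 1 * psi beta mu xi).
have inth : L.-integrable setT (EFin \o h).
  apply: integrable_cos_mul.
  have := integrable_exp_psi d_gt0 beta02 c0 psi_ge.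
  by congr (integrable _ _ _); apply/funext => xi /=; rewrite mulN1r.
have e'0 : 0 < e^-1 by rewrite invr_gt0.
have := Rintegral_rV_dilation e'0 inth.
rewrite (_ : e^-1 ^- d = t `^ (- (d%:R / beta))); last first.
  rewrite exprVn invrK /e -powR_mulrn ?powR_ge0// -powRrM; congr (_ `^ _).
  by rewrite mulNr mulrC.
move=> H; apply: etrans H; apply: eq_Rintegral => xi _; rewrite /h.
have -> : dot (e *: x) (e^-1 *: xi) = dot x xi.
  by rewrite dotZl dotZr mulrA mulfV ?mul1r// gt_eqF.
suff -> : - t * psi beta mu xi = - 1 * psi beta mu (e^-1 *: xi) by [].
rewrite psiZ ?(ltW e'0)// mulN1r mulNr.
suff -> : e^-1 `^ beta = t by [].
rewrite -powR_inv1 ?(ltW e0)// /e -!powRrM [X in t `^ X](_ : _ = 1) ?powRr1 ?(ltW t0)//.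
by field; rewrite gt_eqF.
Qed.

(** This is G(s,x) for s > 0, written through G(1,.) so that joint measurability in x and s reduces
    to measurability of G(1,.). *)
Definition scaled_density (z : Rd * R) : R :=
  z.2 `^ (- (d%:R / beta)) * G beta mu 1 (z.2 `^ (- beta^-1) *: z.1).

Lemma scaled_density_ge0 z : 0 <= scaled_density z.
Proof. by rewrite mulr_ge0 ?powR_ge0//; apply: G1_ge0 d_gt0 beta02 c0 psi_ge _. Qed.

Lemma measurable_scaled_density : measurable_fun setT scaled_density.
Proof.
apply: measurable_funM; first exact: (measurableT_comp (measurable_powR _)).
apply: (measurableT_comp (measurable_G1 d_gt0 beta02 c0 psi_ge)).
apply: measurable_fun_rV => i.
apply: (eq_measurable_fun (fun z : Rd * R => z.2 `^ (- beta^-1) * z.1 ord0 i)).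
  by move=> z _; rewrite mxE.
apply: measurable_funM; first exact: (measurableT_comp (measurable_powR _)).
exact: (measurableT_comp (measurable_coord i)).
Qed.

Let M := ml_density alpha (Ga 1).
Let M0 s : 0 <= M s. Proof. exact: (ml_density_ge0 alpha01 gP). Qed.
Let mM : measurable_fun setT M. Proof. exact: (measurable_ml_density gP). Qed.

Definition Z1 x : \bar R :=
  (\int[leb]_(s in `]0%R, +oo[) (scaled_density (x, s) * M s)%:E)%E.

Lemma Z1_ge0 x : (0 <= Z1 x)%E.
Proof. by apply: integral_ge0 => s _; rewrite lee_fin mulr_ge0// scaled_density_ge0. Qed.

Let measurable_integrand : measurable_fun setT (fun z : Rd * R => (scaled_density z * M z.2)%:E).
Proof.
apply/measurable_EFinP; apply: measurable_funM; first exact: measurable_scaled_density.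
exact: (measurableT_comp mM).
Qed.

Lemma measurable_Z1 : measurable_fun setT Z1.
Proof.
have h0 (x : Rd) (s : R) : setT x -> `]0%R, +oo[%classic s -> (0 <= (scaled_density (x, s) * M s)%:E)%E.
  by move=> _ _; rewrite lee_fin mulr_ge0// scaled_density_ge0.
have := @measurable_fun_integral_in _ _ _ _ _ leb setT `]0%R, +oo[%classic (fun z : Rd * R => (scaled_density z * M z.2)%:E) measurableT (measurable_itv _) measurable_integrand h0.
exact.
Qed.

Lemma Z_scaling t x : 0 < t -> Z alpha beta mu Ga t x =
  ((t `^ (- (alpha * d%:R / beta)))%:E * Z1 (t `^ (- (alpha / beta)) *: x))%E.
Proof.
move=> t0; have ta0 : 0 < t `^ alpha by rewrite powR_gt0.
have msec y : measurable_fun setT (fun s : R => (scaled_density (y, s) * M s)%:E).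
  by apply: (measurableT_comp measurable_integrand); exact: measurable_pair1.
have k0 : 0 <= t `^ (- (alpha * d%:R / beta)) by exact: powR_ge0.
pose w s := scaled_density (t `^ (- (alpha / beta)) *: x, s) * M s.
have w0 s : 0 <= w s by rewrite mulr_ge0// scaled_density_ge0.
pose h s := G beta mu (t `^ alpha * s) x * s `^ (- 1 - alpha^-1) * Ga 1 (s `^ (- alpha^-1)).
(* The factor alpha^-1 of Z is already contained in [ml_density]; hence the compensating alpha. *)
have hE s : 0 < s -> h s = alpha * (t `^ (- (alpha * d%:R / beta)) * w s).
  move=> s0; rewrite /h /w G_scaling ?mulr_gt0// /scaled_density/= scalerA.
  rewrite !powRM ?(ltW ta0) ?(ltW s0)// -!powRrM.
  have -> : alpha * - (d%:R / beta) = - (alpha * d%:R / beta) by rewrite mulrN mulrA.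
  have -> : alpha * - beta^-1 = - (alpha / beta) by rewrite mulrN.
  rewrite (mulrC (s `^ (- beta^-1))) /M /ml_density.
  move: (G _ _ _ _) (s `^ (- (d%:R / beta))) (s `^ (-1 - _)) (t `^ (- (_ * _ / _))) (Ga _ _) => g u1 u2 u3 u4.
  by field; rewrite gt_eqF.
have mw : measurable_fun setT w by apply/measurable_EFinP; exact: msec.
have mh : measurable_fun (`]0%R, +oo[%classic : set R) h.
  apply: (eq_measurable_fun (fun s => alpha * (t `^ (- (alpha * d%:R / beta)) * w s))).
    by move=> s; rewrite inE/= in_itv/= andbT => s0; rewrite hE.
  by apply: measurable_funTS; apply: measurable_funM => //; exact: measurable_funM.
transitivity (alpha^-1%:E * \int[leb]_(s in `]0%R, +oo[) (h s)%:E)%E; first by [].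
have mwE : measurable_fun (`]0%R, +oo[%classic : set R) (EFin \o w).
  by apply: measurable_funTS; exact/measurable_EFinP.
have mhE : measurable_fun (`]0%R, +oo[%classic : set R) (EFin \o h) by exact/measurable_EFinP.
have w0E s : `]0%R, +oo[%classic s -> (0 <= (EFin \o w) s)%E by rewrite /= lee_fin.
have h0E s : `]0%R, +oo[%classic s -> (0 <= (EFin \o h) s)%E.
  rewrite /= in_itv/= andbT lee_fin => s0.
  by rewrite hE// mulr_ge0 ?(ltW a0)// mulr_ge0.
have ai0 : (0 <= alpha^-1%:E :> \bar R)%E by rewrite lee_fin invr_ge0 ltW.
have kE0 : (0 <= (t `^ (- (alpha * d%:R / beta)))%:E)%E by rewrite lee_fin.
have := ge0_integralZl leb (measurable_itv `]0%R, +oo[) mhE h0E ai0.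
have := ge0_integralZl leb (measurable_itv `]0%R, +oo[) mwE w0E kE0.
rewrite /Z1 /= => <- <-.
apply: eq_integral => s; rewrite inE/= in_itv/= andbT => s0.
by rewrite hE// -EFinM mulKf ?gt_eqF.
Qed.

End kernel_scaling.

(** Convexity: y^p lies above its tangent at [a]. After division by a^p this is Young's inequality
    for y / a and 1 with the exponents p and p / (p - 1), the case p = 1 being trivial. *)
Lemma powR_ge_tangent (R : realType) (p a y : R) : 1 <= p -> 0 < a -> 0 <= y ->
  p * a `^ (p - 1) * y <= y `^ p + (p - 1) * a `^ p.
Proof.
move=> p1 a0 y0; have p0 : 0 < p by lra.
have E : a `^ p = a * a `^ (p - 1).
  by rewrite -{2}(powRr1 (ltW a0)) -powRD_gt0//; congr (_ `^ _); ring.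
have key : p * (y / a) <= (y / a) `^ p + (p - 1).
  move: p1; rewrite le_eqVlt => /predU1P[<-|p1].
    by rewrite mul1r powRr1 ?divr_ge0 ?(ltW a0)//; lra.
  pose q := p / (p - 1).
  have q0 : 0 < q by rewrite divr_gt0//; lra.
  have pq : p^-1 + q^-1 = 1 by rewrite /q; field; rewrite !gt_eqF//; lra.
  have := conjugate_powR (divr_ge0 y0 (ltW a0)) ler01 p0 q0 pq.
  rewrite mulr1 powR1 => H.
  have := ler_pM2l p0 (y / a) ((y / a) `^ p / p + 1 / q); rewrite H => /esym.
  rewrite (_ : p * ((y / a) `^ p / p + 1 / q) = (y / a) `^ p + (p - 1))//.
  by rewrite /q; move: ((y / a) `^ p) => v; field; rewrite !gt_eqF//; lra.
have ap0 : 0 < a `^ p by rewrite powR_gt0.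
have := ler_pM2l ap0 (p * (y / a)) ((y / a) `^ p + (p - 1)); rewrite key => /esym.
rewrite mulrDr -powRM ?divr_ge0 ?(ltW a0)// (mulrC a (y / a)) divfK ?gt_eqF//.
rewrite (_ : a `^ p * (p * (y / a)) = p * a `^ (p - 1) * y).
  by rewrite (mulrC (p - 1)).
by rewrite E; move: (a `^ _) => v; field; rewrite gt_eqF.
Qed.

(** Integrating the tangent inequality at a free point [a] gives a family of linear bounds, optimal
    at a = I / W; [W] only has to bound the mass of the weight. Finiteness of I has to come first
    and follows from the bound at a = 1. *)
Lemma jensen_powR d (T : measurableType d) (R : realType)
    (m : {measure set T -> \bar R}) (D : set T) (f w : T -> R) (p W : R) :
  measurable D -> measurable_fun D f -> measurable_fun D w ->
  (forall x, 0 <= f x) -> (forall x, 0 <= w x) -> 1 <= p -> 0 < W ->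
  (\int[m]_(x in D) (w x)%:E <= W%:E)%E ->
  ((\int[m]_(x in D) (f x * w x)%:E) `^ p <=
    (W `^ (p - 1))%:E * \int[m]_(x in D) (f x `^ p * w x)%:E)%E.
Proof.
move=> mD mf mw f0 w0 p1 W0 wW; have p0 : 0 < p by lra.
have mfp : measurable_fun D (fun x => f x `^ p).
  exact: (measurableT_comp (measurable_powR p) mf).
set I := (\int[m]_(x in D) (f x * w x)%:E)%E.
set J := (\int[m]_(x in D) (f x `^ p * w x)%:E)%E.
have I0 : (0 <= I)%E by apply: integral_ge0 => x _; rewrite lee_fin mulr_ge0.
have J0 : (0 <= J)%E by apply: integral_ge0 => x _; rewrite lee_fin mulr_ge0// powR_ge0.
have [Joo|Joo] := eqVneq J +oo%E.
  by rewrite Joo gt0_muley ?leey// lte_fin powR_gt0.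
have key a : 0 < a -> ((p * a `^ (p - 1))%:E * I <= J + ((p - 1) * a `^ p * W)%:E)%E.
  move=> a0.
  have c1 : 0 <= p * a `^ (p - 1) by rewrite mulr_ge0 ?powR_ge0// ltW.
  have c2 : 0 <= (p - 1) * a `^ p by rewrite mulr_ge0 ?powR_ge0// subr_ge0.
  have H : (\int[m]_(x in D) ((p * a `^ (p - 1))%:E * (f x * w x)%:E) <=
            \int[m]_(x in D) ((f x `^ p * w x)%:E + ((p - 1) * a `^ p)%:E * (w x)%:E))%E.
    apply: ge0_le_integral => //.
    - by move=> x _; rewrite -EFinM lee_fin mulr_ge0// mulr_ge0.
    - by apply/measurable_EFinP; apply: measurable_funM => //; exact: measurable_funM.
    - apply/measurable_EFinP; apply: measurable_funD; first exact: measurable_funM.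
      exact: measurable_funM.
    - move=> x _; rewrite -!EFinM -EFinD lee_fin !mulrA -mulrDl ler_wpM2r//.
      exact: powR_ge_tangent.
  move: H; rewrite ge0_integralZl ?lee_fin//; last 2 first.
  - by apply/measurable_EFinP; exact: measurable_funM.
  - by move=> x _; rewrite lee_fin mulr_ge0.
  rewrite ge0_integralD//; last 4 first.
  - by move=> x _; rewrite lee_fin mulr_ge0// powR_ge0.
  - by apply/measurable_EFinP; exact: measurable_funM.
  - by move=> x _; rewrite -EFinM lee_fin mulr_ge0.
  - by apply/measurable_EFinP; exact: measurable_funM.
  rewrite ge0_integralZl ?lee_fin//; last 2 first.
  - exact/measurable_EFinP.
  - by move=> x _; rewrite lee_fin.
  move=> /le_trans; apply; rewrite leeD2l// [leRHS]EFinM.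
  by rewrite lee_wpmul2l ?lee_fin.
have Jf : J \is a fin_num by rewrite ge0_fin_numE// ltey.
have If : I \is a fin_num.
  rewrite ge0_fin_numE//; have := key 1 ltr01; rewrite !powR1 !mulr1 => H.
  rewrite ltey; apply: contraTneq H => ->; rewrite gt0_muley ?lte_fin// -ltNge.
  by rewrite -(fineK Jf) -EFinD ltry.
move: I0 J0 key; rewrite -(fineK If) -(fineK Jf); move: (fine I) (fine J) => {If I Jf J Joo} i j.
rewrite !lee_fin le_eqVlt => /predU1P[<- j0 _|i0 _ key].
  by rewrite powR0 ?gt_eqF// mulr_ge0// powR_ge0.
have a0 : 0 < i / W by rewrite divr_gt0.

have := key _ a0; rewrite -EFinM -EFinD lee_fin.
have split_pow x : 0 < x -> x `^ p = x * x `^ (p - 1).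
  by move=> x0; rewrite -{2}(powRr1 (ltW x0)) -powRD_gt0//; congr (_ `^ _); ring.
rewrite !split_pow// [i `^ (p - 1)](_ : _ = (i / W) `^ (p - 1) * W `^ (p - 1)); last first.
  by rewrite -powRM ?(ltW a0) ?(ltW W0)// divfK ?gt_eqF.
move=> H; rewrite (mulrC (W `^ _)) [leLHS]mulrA; apply: ler_wpM2r; first exact: powR_ge0.
move: H; move: ((i / W) `^ (p - 1)) => v.
have -> : (p - 1) * (i / W * v) * W = (p - 1) * (i * v) by field; rewrite gt_eqF.
lra.
Qed.

(** * Uniform and L_p upper bounds for the rescaled kernel *)

Section kernel_upper_bound.
Context {R : realType} {d : nat}.
Local Notation Rd := 'rV[R]_d.
Local Notation leb := (@lebesgue_measure R).
Local Notation L := (@lebesgue_rV R d).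
Variables (alpha beta : R) (mu : {finite_measure set Rd -> \bar R}) (c : R) (Ga : R -> R -> R).
Hypotheses (d_gt0 : (0 < d)%N) (alpha01 : 0 < alpha < 1) (beta02 : 0 < beta < 2)
  (c0 : 0 < c) (psi_ge : forall xi, c * enorm xi `^ beta <= psi beta mu xi)
  (gP : one_sided_stable_density alpha (Ga 1)).
Implicit Types x xi : Rd.

Let a0 : 0 < alpha. Proof. by case/andP: alpha01. Qed.
Let beta0 : 0 < beta. Proof. by case/andP: beta02. Qed.
Let M := ml_density alpha (Ga 1).
Let M0 s : 0 <= M s. Proof. exact: (ml_density_ge0 alpha01 gP). Qed.
Let mM : measurable_fun setT M. Proof. exact: (measurable_ml_density gP). Qed.
Let g x := G beta mu 1 x.
Let g0 x : 0 <= g x. Proof. exact: (G1_ge0 d_gt0 beta02 c0 psi_ge). Qed.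
Let mg : measurable_fun setT g. Proof. exact: (measurable_G1 d_gt0 beta02 c0 psi_ge). Qed.

Let ml_moment_le theta : 0 <= theta < 1 ->
  exists2 W, 0 < W & (\int[leb]_(s in `]0%R, +oo[) (s `^ (- theta) * M s)%:E <= W%:E)%E.
Proof.
move=> th; have := ml_neg_moment alpha01 gP th; rewrite -/M.
set I := integral _ _ _ => Ioo.
have I0 : (0 <= I)%E by apply: integral_ge0 => s _; rewrite lee_fin mulr_ge0 ?powR_ge0.
exists (fine I + 1); first by rewrite ltr_wpDl ?fine_ge0.
by rewrite EFinD fineK ?ge0_fin_numE// leeDl.
Qed.

(** For p = +oo the relevant moment has order -d / beta, and d / beta < 1 is the assumption. *)
Lemma Z1_bounded : d%:R < beta -> exists C, forall x, (Z1 alpha beta mu Ga x <= C%:E)%E.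
Proof.
move=> db.
have [|W W0 HW] := @ml_moment_le (d%:R / beta).
  by rewrite divr_ge0 ?ler0n ?(ltW beta0)//= ltr_pdivrMr// mul1r.
exists (G1_sup beta mu * W) => x.
have S0 : 0 <= G1_sup beta mu by exact: le_trans (g0 0) (G1_le d_gt0 beta02 c0 psi_ge 0).
rewrite EFinM; apply: le_trans (lee_wpmul2l _ HW); last by rewrite lee_fin.
have mw : measurable_fun setT (fun s : R => s `^ (- (d%:R / beta)) * M s).
  by apply: measurable_funM => //; exact: measurable_powR.
rewrite -ge0_integralZl ?lee_fin//; last 2 first.
- by apply: measurable_funTS; exact/measurable_EFinP.
- by move=> s _; rewrite lee_fin mulr_ge0 ?powR_ge0.
apply: ge0_le_integral => //.
- by move=> s _; rewrite lee_fin mulr_ge0// (scaled_density_ge0 d_gt0 beta02 c0 psi_ge).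
- apply: measurable_funTS; apply/measurable_EFinP; apply: measurable_funM => //.
  exact: (measurableT_comp (measurable_scaled_density d_gt0 beta02 c0 psi_ge) (measurable_pair1 x)).
- by apply: measurable_funTS; apply/measurable_EFinP; exact: measurable_funM.
- move=> s _; have H : scaled_density beta mu (x, s) <= G1_sup beta mu * s `^ (- (d%:R / beta)).
    by rewrite /scaled_density/= mulrC ler_wpM2r ?powR_ge0// (G1_le d_gt0 beta02 c0 psi_ge).
  by rewrite -[leRHS]EFinM lee_fin [leRHS]mulrA; exact: ler_wpM2r.
Qed.

Let integral_G1_powR (p : R) : 1 <= p -> (\int[L]_x (g x `^ p)%:E < +oo)%E.
Proof.
move=> p1.
have S0 : 0 <= G1_sup beta mu by exact: le_trans (g0 0) (G1_le d_gt0 beta02 c0 psi_ge 0).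
apply: (@le_lt_trans _ _ ((G1_sup beta mu `^ (p - 1))%:E * \int[L]_x (g x)%:E)%E); last first.
  apply: (@le_lt_trans _ _ ((G1_sup beta mu `^ (p - 1))%:E * 1)%E); last by rewrite mule1 ltry.
  by rewrite lee_wpmul2l ?lee_fin ?powR_ge0// (integral_G1_lty d_gt0 beta02 c0 psi_ge).
rewrite -ge0_integralZl ?lee_fin ?powR_ge0//; last 2 first.
- exact/measurable_EFinP.
- by move=> x _; rewrite lee_fin.
apply: ge0_le_integral => //.
- by move=> x _; rewrite lee_fin powR_ge0.
- by apply/measurable_EFinP; exact: (measurableT_comp (measurable_powR p)).
- by apply/measurable_EFinP; exact: measurable_funM.
- move=> x _; rewrite -EFinM lee_fin; have := g0 x; rewrite le_eqVlt => /predU1P[<-|gx].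
    by rewrite powR0 ?mulr0// gt_eqF//; lra.
  have -> : g x `^ p = g x `^ (p - 1) * g x.
    apply: (@etrans _ _ (g x `^ (p - 1) * g x `^ 1)); last by rewrite powRr1// ltW.
    by rewrite -powRD_gt0//; congr (_ `^ _); ring.
  apply: ler_wpM2r => //.
  by rewrite ge0_ler_powR ?nnegrE ?subr_ge0// (G1_le d_gt0 beta02 c0 psi_ge).
Qed.

Lemma integral_Z1_powR_lty (p : R) : 1 <= p -> d%:R / beta * (1 - p^-1) < 1 ->
  (\int[L]_x (Z1 alpha beta mu Ga x `^ p) < +oo)%E.
Proof.
move=> p1 th1; have p0 : 0 < p by lra.
pose th := d%:R / beta * (1 - p^-1).
have th0 : 0 <= th.
  by rewrite mulr_ge0 ?divr_ge0 ?ler0n ?(ltW beta0)// subr_ge0 invf_le1.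
have [|W W0 HW] := @ml_moment_le th; first by rewrite th0.
pose w s := s `^ (- th) * M s.
have w0 s : 0 <= w s by rewrite mulr_ge0 ?powR_ge0.
have mw : measurable_fun setT w by apply: measurable_funM => //; exact: measurable_powR.
pose sd := @scaled_density R d beta mu.
have sd0 z : 0 <= sd z by exact: (scaled_density_ge0 d_gt0 beta02 c0 psi_ge).
have msd : measurable_fun setT sd by exact: (measurable_scaled_density d_gt0 beta02 c0 psi_ge).
pose f (z : Rd * R) := z.2 `^ th * sd z.
have f0 z : 0 <= f z by rewrite mulr_ge0 ?powR_ge0.
have mf : measurable_fun setT f.
  by apply: measurable_funM => //; exact: (measurableT_comp (measurable_powR _)).
pose F (z : Rd * R) : \bar R := (f z `^ p * w z.2)%:E.
have mF : measurable_fun setT F.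
  apply/measurable_EFinP; apply: measurable_funM.
    exact: (measurableT_comp (measurable_powR _)).
  exact: (measurableT_comp mw).
have F0 x (s : R) : setT x -> `]0%R, +oo[%classic s -> (0 <= F (x, s))%E.
  by move=> _ _; rewrite lee_fin mulr_ge0 ?powR_ge0.
pose J := (\int[L]_x (g x `^ p)%:E)%E.
have mgp : measurable_fun setT (fun x => g x `^ p) by exact: (measurableT_comp (measurable_powR p)).
have J0 : (0 <= J)%E by apply: integral_ge0 => x _; rewrite lee_fin powR_ge0.
have Joo : (J < +oo)%E by exact: integral_G1_powR.
(* theta is the exponent for which s^theta G(s,.) has an L_p norm independent of s: the powers of s
   coming from the prefactor and from the dilation cancel, and only the weight remains. *)
have inner (s : R) : 0 < s -> (\int[L]_x F (x, s) = (w s)%:E * J)%E.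
  move=> s0; have e0 : 0 < s `^ (- beta^-1) by rewrite powR_gt0.
  pose k := (s `^ th * s `^ (- (d%:R / beta))) `^ p * w s.
  have k0 : 0 <= k by rewrite mulr_ge0 ?powR_ge0.
  transitivity (\int[L]_x (k%:E * (g (s `^ (- beta^-1) *: x) `^ p)%:E))%E.
    apply: eq_integral => x _; rewrite -EFinM /F /f /sd /scaled_density/= -/(g _) mulrA.
    rewrite (@powRM _ _ _ p _ (g0 _)) ?mulr_ge0 ?powR_ge0//; congr EFin; rewrite /k.
    by move: (_ `^ p) (_ `^ p) (w s) => u1 u2 u3; ring.
  have mgpE : measurable_fun setT (fun y : Rd => (g y `^ p)%:E) by exact/measurable_EFinP.
  have gpE0 y : (0 <= (g y `^ p)%:E)%E by rewrite lee_fin powR_ge0.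
  have mX : measurable_fun setT (fun x : Rd => (g (s `^ (- beta^-1) *: x) `^ p)%:E).
    by apply: (measurableT_comp mgpE); exact: measurable_rV_scale.
  have X0 (x : Rd) : setT x -> (0 <= (g (s `^ (- beta^-1) *: x) `^ p)%:E)%E.
    by move=> _; exact: gpE0.
  have kE0 : (0 <= k%:E)%E by rewrite lee_fin.
  apply: (etrans (ge0_integralZl L measurableT mX X0 kE0)).
  have DE := ge0_integral_rV_dilation e0 mgpE gpE0.
  apply: (etrans (congr1 (fun y => k%:E * y)%E DE)).
  rewrite -/J muleA -EFinM /k.
  congr (EFin _ * _)%E; rewrite mulrAC -[RHS]mul1r; congr (_ * _).
  rewrite -powRD_gt0// -powR_mulrn ?powR_ge0// -!powRrM -[X in _ * X]powR_inv1 ?powR_ge0// -powRrM.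
  rewrite -powRD_gt0// [X in s `^ X](_ : _ = 0) ?powRr0// /th.
  by field; rewrite !gt_eqF.
apply: (@le_lt_trans _ _ ((W `^ (p - 1))%:E * \int[L]_x \int[leb]_(s in `]0%R, +oo[) F (x, s))%E).
  have mH : measurable_fun setT (fun x => \int[leb]_(s in `]0%R, +oo[) F (x, s))%E.
    by have := @measurable_fun_integral_in _ _ _ _ _ leb setT `]0%R, +oo[%classic F measurableT (measurable_itv _) mF F0; exact.
  have H0 x : (0 <= \int[leb]_(s in `]0%R, +oo[) F (x, s))%E.
    by apply: integral_ge0 => s s0; exact: F0.
  rewrite -ge0_integralZl ?lee_fin ?powR_ge0//.
  apply: ge0_le_integral => //.
  - by move=> x _; exact: poweR_ge0.
  - apply: (measurableT_comp (measurable_poweR p)).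
    exact: (measurable_Z1 d_gt0 alpha01 beta02 c0 psi_ge gP).
  - exact: measurable_funeM.
  - move=> x _.
    have mfx : measurable_fun (`]0%R, +oo[%classic : set R) (fun s => f (x, s)).
      by apply: measurable_funTS; exact: (measurableT_comp mf (measurable_pair1 x)).
    have mwD : measurable_fun (`]0%R, +oo[%classic : set R) w by exact: measurable_funTS.
    have := jensen_powR (m := leb) (measurable_itv _) mfx mwD (fun s => f0 (x, s)) w0 p1 W0 HW.
    apply: le_trans; rewrite le_eqVlt; apply/orP; left; apply/eqP.
    congr (_ `^ _)%E; apply: eq_integral => s; rewrite inE/= in_itv/= andbT => s0.
    rewrite /f /w/= /sd -/M; congr EFin.
    rewrite powRN; move: (scaled_density _ _ _) (M s) => u v.
    by field; rewrite gt_eqF// powR_gt0.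
have TF := @tonelli_in _ _ _ _ _ L leb setT `]0%R, +oo[%classic F measurableT (measurable_itv _) mF F0.
rewrite TF (eq_integral (fun s : measurableTypeR R => (w s)%:E * J)%E); last first.
  by move=> s; rewrite inE/= in_itv/= andbT => s0; exact: inner.
rewrite ge0_integralZr//; last 2 first.
- by apply: measurable_funTS; exact/measurable_EFinP.
- by move=> s _; rewrite lee_fin.
have Jf : J \is a fin_num by rewrite ge0_fin_numE.
apply: (@le_lt_trans _ _ ((W `^ (p - 1))%:E * (W%:E * J))%E).
  rewrite lee_wpmul2l ?lee_fin ?powR_ge0//; exact: lee_wpmul2r.
by rewrite -(fineK Jf) -!EFinM ltry.
Qed.

End kernel_upper_bound.

(** * Annuli and non-integrable powers of the norm at the origin *)

Section annulus.
Context {R : realType} {d : nat}.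
Local Notation Rd := 'rV[R]_d.
Local Notation L := (@lebesgue_rV R d).
Hypothesis d_gt0 : (0 < d)%N.
Implicit Types x : Rd.

Definition annulus (a b : R) : set Rd := [set x | a < enorm x <= b].

Lemma measurable_annulus a b : measurable (annulus a b).
Proof.
rewrite (_ : annulus a b = setT `&` @enorm R d @^-1` `]a, b]); first exact: measurable_enorm.
by rewrite setTI; apply/seteqP; split=> x; rewrite /annulus/= in_itv.
Qed.

Lemma in_annulus a b x : (x \in annulus a b) = (a < enorm x <= b).
Proof. by apply/idP/idP; rewrite inE. Qed.

(** The annulus contains a box: one coordinate lies between 2r/3 and 3r/4, the others in [0,h] with
    h = r / (8 d), so that the squared norm is at most 9/16 r^2 + r^2/64. *)
Lemma lebesgue_rV_annulus_gt0 (r : R) : 0 < r -> (0 < L (annulus (r / 2) r))%E.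
Proof.
move=> r0; pose i0 : 'I_d := Ordinal d_gt0.
have dR : 0 < d%:R :> R by rewrite ltr0n.
have dR1 : 1 <= d%:R :> R by rewrite ler1n.
pose h : R := r / (8 * d%:R).
have h0 : 0 < h by rewrite divr_gt0// mulr_gt0.
pose A (i : 'I_d) : set (measurableTypeR R) :=
  if i == i0 then `[2 * r / 3, 3 * r / 4]%classic else `[0, h]%classic.
have mA i : measurable (A i) by rewrite /A; case: ifP => _; exact: measurable_itv.
have : (0 < L [set x : Rd | forall i, A i (x ord0 i)])%E.
  rewrite lebesgue_rV_box//; apply: (big_ind (fun y => 0 < y)%E) => //.
    by move=> x y; exact: mule_gt0.
  move=> i _; rewrite /A; case: ifP => _; rewrite lebesgue_measure_itv/= lte_fin.
    rewrite ifT; last by lra.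
    by rewrite -EFinB lte_fin; lra.
  by rewrite h0 -EFinB lte_fin subr0.
move=> /lt_le_trans; apply; apply: le_measure; rewrite ?inE//.
- exact: measurable_rV_box.
- exact: measurable_annulus.
move=> x /= Ax.
have := Ax i0; rewrite /A eqxx/= in_itv/= => /andP[x1 x2].
apply/andP; split.
  apply: (@lt_le_trans _ _ `|x ord0 i0|); last exact: coord_le_enorm.
  by rewrite ger0_norm; lra.
rewrite -(@ler_pXn2r _ 2)// ?nnegrE ?enorm_ge0 ?(ltW r0)// sqr_enorm.
apply: (@le_trans _ _ (\sum_(i < d) ((if i == i0 then (3 * r / 4) ^+ 2 else 0) + h ^+ 2))).
  apply: ler_sum => i _; rewrite -expr2; have := Ax i; rewrite /A; case: eqP => [->|_]/=; rewrite in_itv/= => /andP[y1 y2].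
    by rewrite -[leLHS]addr0 lerD ?sqr_ge0// ler_pXn2r ?nnegrE//; lra.
  by rewrite add0r ler_pXn2r ?nnegrE// ltW.
rewrite big_split/= -big_mkcond/= big_pred1_eq sumr_const card_ord.
have -> : h ^+ 2 *+ d = r ^+ 2 / (64 * d%:R).
  by rewrite -mulr_natr /h; field; rewrite gt_eqF.
have : r ^+ 2 / (64 * d%:R) <= r ^+ 2 / 64.
  rewrite ler_wpM2l ?sqr_ge0// lef_pV2 ?posrE ?mulr_gt0//.
  by rewrite ler_peMr.
have : 0 <= r ^+ 2 by exact: sqr_ge0.
rewrite (_ : (3 * r / 4) ^+ 2 = 9 / 16 * r ^+ 2); last by field.
by move: (r ^+ 2 / (64 * d%:R)) (r ^+ 2) => u v; lra.
Qed.

(** Self-similarity replaces polar coordinates: f(x) dominates 2^d f(2x) plus a function [a]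
    supported on the outer annulus, while 2^d f(2x) has the same integral as f. Hence I + m <= I
    with m > 0, which forces I = +oo, the borderline q = d included. *)
Lemma integral_enorm_powR_eqy (q r : R) : d%:R <= q -> 0 < r ->
  (\int[L]_(x in annulus 0 r) (enorm x `^ (- q))%:E = +oo)%E.
Proof.
move=> dq r0; have q0 : 0 <= q by apply: le_trans dq; exact: ler0n.
pose f x : \bar R := ((\1_(annulus 0 r) x) * enorm x `^ (- q))%:E.
rewrite integral_mkcond (eq_integral f); last first.
  move=> x _; rewrite patchE /f indicE.
  by case: ifP; rewrite ?mul1r ?mul0r.
have f0 x : (0 <= f x)%E by rewrite lee_fin mulr_ge0 ?powR_ge0// indicE ler0n.
have mf : measurable_fun setT f.
  apply/measurable_EFinP; apply: measurable_funM.
    by apply: measurable_indic; exact: measurable_annulus.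
  exact: (measurableT_comp (measurable_powR _) measurable_enorm).
pose a x : \bar R := (r `^ (- q) * \1_(annulus (r / 2) r) x)%:E.
have ma : measurable_fun setT a.
  by apply/measurable_EFinP; apply: measurable_funM => //; apply: measurable_indic; exact: measurable_annulus.
have ai0 x : (0 <= a x)%E by rewrite lee_fin mulr_ge0 ?powR_ge0// indicE ler0n.
have two0 : 0 < 2 :> R by [].
have mf2 : measurable_fun setT (fun x => f (2 *: x)).
  by apply: (measurableT_comp mf); exact: measurable_rV_scale.
have le_f x : ((2 ^+ d)%:E * f (2 *: x) + a x <= f x)%E.
  rewrite /f /a -EFinM -EFinD lee_fin !indicE !in_annulus enormZ//.
  have := enorm_ge0 x; move: (enorm x) => n; rewrite le_eqVlt => /predU1P[<-|n0].
    by rewrite mulr0 ltxx !mul0r mulr0 add0r (_ : r / 2 < 0 = false) ?mulr0//; apply/negbTE; lra.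
  rewrite n0 mulr_gt0//=.
  have [nr|nr] := leP n (r / 2).
    rewrite (_ : 2 * n <= r); last by lra.
    rewrite (_ : n <= r); last by lra.
    rewrite mulr0 addr0 !mul1r powRM ?(ltW n0)// mulrA ler_piMl ?powR_ge0//.
    rewrite -powR_mulrn// -powRD_gt0// -[leRHS](powRr0 (2 : R)) ler_powR ?ler1n//.
    by rewrite subr_le0.
  rewrite (_ : (2 * n <= r) = false); last by apply/negbTE; lra.
  rewrite mul0r mulr0 add0r.
  have [nr'|_] := leP n r; last by rewrite mulr0 mul0r.
  rewrite mulr1 mul1r !powRN lef_pV2 ?posrE ?powR_gt0//.
  by rewrite ge0_ler_powR// ?nnegrE ltW.
have : ((2 ^+ d)%:E * \int[L]_x f (2 *: x) + \int[L]_x a x <= \int[L]_x f x)%E.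
  have p0 : (0 <= (2 ^+ d)%:E :> \bar R)%E by rewrite lee_fin exprn_ge0.
  have f20 x : setT x -> (0 <= f (2 *: x)%R)%E by move=> _; exact: f0.
  have := ge0_integralZl L measurableT mf2 f20 p0 => <-.
  rewrite -ge0_integralD//; last 2 first.
  - by move=> x _; rewrite mule_ge0.
  - exact: measurable_funeM.
  have h0 x : setT x -> (0 <= (2 ^+ d)%:E * f (2 *: x)%R + a x)%E.
    by move=> _; rewrite adde_ge0// mule_ge0.
  have mh : measurable_fun setT (fun x => (2 ^+ d)%:E * f (2 *: x)%R + a x)%E.
    by apply: emeasurable_funD => //; exact: measurable_funeM.
  have leh x : setT x -> ((2 ^+ d)%:E * f (2 *: x)%R + a x <= f x)%E by move=> _; exact: le_f.
  exact: (@ge0_le_integral _ _ _ L _ measurableT _ f h0 mh mf leh).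
have -> : ((2 ^+ d)%:E * \int[L]_x f (2 *: x)%R = \int[L]_x f x)%E.
  apply: (etrans (congr1 (fun y => (2 ^+ d)%:E * y)%E (ge0_integral_rV_dilation two0 mf f0))).
  by rewrite muleA -EFinM mulfV ?expf_neq0// mul1e.
have : (0 < \int[L]_x a x)%E.
  have mia : measurable_fun setT (fun x : Rd => (\1_(annulus (r / 2) r) x : R)%:E).
    by apply/measurable_EFinP; apply: measurable_indic; exact: measurable_annulus.
  rewrite /a; under eq_integral do rewrite EFinM.
  have i10 x : setT x -> (0 <= (\1_(annulus (r / 2) r) x : R)%:E)%E.
    by move=> _; rewrite lee_fin indicE ler0n.
  have rq0 : (0 <= (r `^ (- q))%:E)%E by rewrite lee_fin powR_ge0.
  have := ge0_integralZl L measurableT mia i10 rq0 => ->.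
  rewrite integral_indic//; last exact: measurable_annulus.
  by rewrite setIT mule_gt0 ?lte_fin ?powR_gt0 ?lebesgue_rV_annulus_gt0.
set I := integral _ _ f; set m := integral _ _ a => m0 H.
have I0 : (0 <= I)%E by apply: integral_ge0 => x _; exact: f0.
apply/eqP; rewrite eq_le leey/= leNgt -ge0_fin_numE//.
apply/negP => If; move: H; rewrite leNgt => /negP; apply.
by rewrite lteDl.
Qed.

End annulus.

(** * Pointwise lower bound of the rescaled kernel near the origin *)

Section kernel_lower_bound.
Context {R : realType} {d : nat}.
Local Notation Rd := 'rV[R]_d.
Local Notation leb := (@lebesgue_measure R).
Local Notation L := (@lebesgue_rV R d).
Variables (alpha beta : R) (mu : {finite_measure set Rd -> \bar R}) (c : R) (Ga : R -> R -> R).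
Hypotheses (d_gt0 : (0 < d)%N) (alpha01 : 0 < alpha < 1) (beta02 : 0 < beta < 2)
  (c0 : 0 < c) (psi_ge : forall xi, c * enorm xi `^ beta <= psi beta mu xi)
  (gP : one_sided_stable_density alpha (Ga 1)).
Implicit Types x xi : Rd.

Let a0 : 0 < alpha. Proof. by case/andP: alpha01. Qed.
Let beta0 : 0 < beta. Proof. by case/andP: beta02. Qed.
Let M := ml_density alpha (Ga 1).
Let M0 s : 0 <= M s. Proof. exact: (ml_density_ge0 alpha01 gP). Qed.
Let mM : measurable_fun setT M. Proof. exact: (measurable_ml_density gP). Qed.

(** On the window, v = s^(-1/alpha) lies in ]e/sigma, A/sigma]. The upper end places the argument of
    G(1,.) in the ball where it is at least [e0]: [B] is chosen so that (A/sigma)^(alpha/beta) |x| =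
    r0. The lower end bounds the prefactor s^(-d/beta) = v^b, and with the window mass the exponent
    of |x| becomes (beta/alpha)(alpha - b) = beta - d. At the radius chosen, sigma = 1. *)
Lemma Z1_lower : exists k r, [/\ 0 < k, 0 < r & forall x, 0 < enorm x <= r ->
  ((k * enorm x `^ (beta - d%:R))%:E <= Z1 alpha beta mu Ga x)%E].
Proof.
have [r0 [e0 [r00 e00 Glow]]] := G1_lower d_gt0 beta02 c0 psi_ge.
have [e [A [e1 A0 win]]] := ml_window alpha01 gP.
pose b := alpha * d%:R / beta.
pose B := A * r0 `^ (- (beta / alpha)).
have B0 : 0 < B by rewrite mulr_gt0// powR_gt0.
exists (e0 / 4 * e `^ b * B `^ (alpha - b)), (r0 * A `^ (- (alpha / beta))); split.
- by rewrite !mulr_gt0 ?powR_gt0// invr_gt0.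
- by rewrite mulr_gt0 ?powR_gt0.
move=> x /andP[]; set rho := enorm x => rho0 rho1.
pose sigma := B * rho `^ (beta / alpha).
have sigma0 : 0 < sigma by rewrite mulr_gt0 ?powR_gt0.
have ba0 : 0 < beta / alpha by rewrite divr_gt0.
have ab0 : 0 < alpha / beta by rewrite divr_gt0.
have sigma1 : sigma <= 1.
  have /(ge0_ler_powR (ltW ba0)) : rho <= r0 * A `^ (- (alpha / beta)) by [].
  rewrite !nnegrE ?(ltW rho0) ?mulr_ge0 ?powR_ge0 ?(ltW r00)// => /(_ isT isT) H.
  apply: (@le_trans _ _ (B * (r0 * A `^ (- (alpha / beta))) `^ (beta / alpha))).
    by rewrite ler_wpM2l// ltW.
  rewrite powRM ?powR_ge0 ?(ltW r00)// -powRrM.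
  rewrite (_ : - (alpha / beta) * (beta / alpha) = -1); last by field; rewrite !gt_eqF.
  rewrite /B powRN (powR_inv1 (ltW A0)).
  have r0b : r0 `^ (beta / alpha) != 0 by rewrite gt_eqF ?powR_gt0.
  rewrite le_eqVlt; apply/orP; left; apply/eqP.
  by move: (r0 `^ _) r0b => u u0; field; rewrite u0 gt_eqF.
have /win : 0 < sigma <= 1 by rewrite sigma0.
rewrite -/M => H.
pose K := e0 * (e / sigma) `^ b.
have K0 : 0 <= K by rewrite mulr_ge0 ?powR_ge0 ?ltW.
have -> : (e0 / 4 * e `^ b * B `^ (alpha - b) * rho `^ (beta - d%:R))%:E
    = (K%:E * (sigma `^ alpha / 4)%:E)%E.
  rewrite -EFinM /K; congr EFin.
  rewrite [(e / sigma) `^ b]powRM ?invr_ge0 ?(ltW e1) ?(ltW sigma0)//.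
  rewrite -(powR_inv1 (ltW sigma0)) -powRrM mulN1r.
  have hB : B `^ (alpha - b) * rho `^ (beta - d%:R) = sigma `^ (- b) * sigma `^ alpha.
    apply: (@etrans _ _ (sigma `^ (- b + alpha))); last exact: powRD_gt0.
    rewrite (addrC _ alpha) /sigma (powRM (alpha - b) (ltW B0) (powR_ge0 _ _)) -powRrM.
    by congr (_ * _ `^ _); rewrite /b; field; rewrite !gt_eqF.
  apply: (etrans (esym (mulrA _ _ _))); apply: (etrans (congr1 (fun y => e0 / 4 * e `^ b * y) hB)).
  by move: (e `^ b) (sigma `^ (- b)) (sigma `^ alpha) => u1 u2 u3; field.
apply: (@le_trans _ _ (K%:E * \int[leb]_(s in `]0%R, +oo[) (\1_(`]e, A]%classic : set R) (sigma * s `^ (- alpha^-1)) * M s)%:E)%E).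
  by rewrite lee_wpmul2l ?lee_fin.
have mi : measurable_fun setT (fun s : R => \1_(`]e, A]%classic : set R) (sigma * s `^ (- alpha^-1)) * M s : R).
  apply: measurable_funM => //; apply: measurableT_comp; first exact: measurable_indic.
  by apply: measurable_funM => //; exact: measurable_powR.
have msx : measurable_fun setT (fun s : R => scaled_density beta mu (x, s) * M s).
  apply: measurable_funM => //.
  exact: (measurableT_comp (measurable_scaled_density d_gt0 beta02 c0 psi_ge) (measurable_pair1 x)).
rewrite -ge0_integralZl ?lee_fin//; last 2 first.
- by apply: measurable_funTS; exact/measurable_EFinP.
- by move=> s _; rewrite lee_fin mulr_ge0// indicE ler0n.
apply: ge0_le_integral => //.
- by move=> s _; rewrite -EFinM lee_fin; apply: mulr_ge0 => //; apply: mulr_ge0.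
- by apply: measurable_funTS; apply/measurable_EFinP; exact: measurable_funM.
- by apply: measurable_funTS; exact/measurable_EFinP.
move=> s/=; rewrite in_itv/= andbT => s0.
rewrite -EFinM lee_fin mulrA; apply: ler_wpM2r => //.
have sd0 := scaled_density_ge0 d_gt0 beta02 c0 psi_ge.
rewrite indicE; case: (boolP (_ \in _)) => [|_]; last by rewrite mulr0 sd0.
rewrite inE/= in_itv/= mulr1 => /andP[w1 w2].
pose v := s `^ (- alpha^-1).
have v0 : 0 < v by rewrite powR_gt0.
have ve : s `^ (- beta^-1) = v `^ (alpha / beta).
  by rewrite /v -powRrM; congr (_ `^ _); field; rewrite !gt_eqF.
rewrite /scaled_density/=.
have -> : s `^ (- (d%:R / beta)) = v `^ b.
  by rewrite /v -powRrM /b; congr (_ `^ _); field; rewrite !gt_eqF.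
rewrite /K mulrC; apply: ler_pM; rewrite ?powR_ge0 ?(ltW e00)//.
  have b0 : 0 <= b by rewrite divr_ge0 ?(ltW beta0)// mulr_ge0 ?ler0n// ltW.
  have es0 : 0 <= e / sigma by exact: divr_ge0 (ltW e1) (ltW sigma0).
  apply: (ge0_ler_powR b0); rewrite ?nnegrE ?(ltW v0)//.
  by rewrite ler_pdivrMr// mulrC; exact: ltW.
apply: Glow; rewrite enormZ ?powR_ge0// -/rho ve.
have vA : v <= A / sigma by rewrite ler_pdivlMr// mulrC.
apply: (@le_trans _ _ ((A / sigma) `^ (alpha / beta) * rho)).
  rewrite ler_wpM2r ?(ltW rho0)// ge0_ler_powR ?nnegrE ?(ltW ab0) ?(ltW v0)//.
  by rewrite divr_ge0 ?(ltW A0) ?(ltW sigma0).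
rewrite le_eqVlt; apply/orP; left; apply/eqP.
have -> : A / sigma = (r0 / rho) `^ (beta / alpha).
  rewrite /sigma /B powRM ?invr_ge0 ?(ltW r00) ?(ltW rho0)//.
  rewrite -(powR_inv1 (ltW rho0)) -powRrM mulN1r !powRN.
  have r0b : r0 `^ (beta / alpha) != 0 by rewrite gt_eqF ?powR_gt0.
  have rhob : rho `^ (beta / alpha) != 0 by rewrite gt_eqF ?powR_gt0.
  by move: (r0 `^ _) (rho `^ _) r0b rhob => u1 u2 u10 u20; field; rewrite u10 u20 gt_eqF.
rewrite -powRrM (_ : beta / alpha * (alpha / beta) = 1); last by field; rewrite !gt_eqF.
by rewrite powRr1 ?divr_ge0 ?(ltW r00) ?(ltW rho0)// divfK ?gt_eqF.
Qed.

End kernel_lower_bound.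

(** * Norms of Z and the critical exponent *)

Section kernel_norms.
Context {R : realType} {d : nat}.
Local Notation Rd := 'rV[R]_d.
Local Notation leb := (@lebesgue_measure R).
Local Notation L := (@lebesgue_rV R d).
Variables (alpha beta : R) (mu : {finite_measure set Rd -> \bar R}) (c : R) (Ga : R -> R -> R).
Hypotheses (d_gt0 : (0 < d)%N) (alpha01 : 0 < alpha < 1) (beta02 : 0 < beta < 2)
  (c0 : 0 < c) (psi_ge : forall xi, c * enorm xi `^ beta <= psi beta mu xi)
  (gP : one_sided_stable_density alpha (Ga 1)).
Implicit Types x xi : Rd.

Let a0 : 0 < alpha. Proof. by case/andP: alpha01. Qed.
Let beta0 : 0 < beta. Proof. by case/andP: beta02. Qed.
Let z1 := Z1 alpha beta mu Ga.
Let z1_ge0 x : (0 <= z1 x)%E. Proof. exact: (Z1_ge0 d_gt0 alpha01 beta02 c0 psi_ge gP). Qed.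
Let mz1 : measurable_fun setT z1.
Proof. exact: (measurable_Z1 d_gt0 alpha01 beta02 c0 psi_ge gP). Qed.
Let Zt t : 0 < t -> Z alpha beta mu Ga t = fun x =>
  ((t `^ (- (alpha * d%:R / beta)))%:E * z1 (t `^ (- (alpha / beta)) *: x))%E.
Proof.
by move=> t0; apply/funext => x; exact: (Z_scaling d_gt0 alpha01 beta02 c0 psi_ge gP).
Qed.
Let I p := (\int[L]_x (z1 x `^ p))%E.

Lemma measurable_Z t : 0 < t -> measurable_fun setT (Z alpha beta mu Ga t).
Proof.
move=> t0; rewrite Zt//; apply: measurable_funeM.
by apply: (measurableT_comp mz1); exact: measurable_rV_scale.
Qed.

(** An identity in [0,+oo]: it serves the two-sided estimate as well as the failure of
    integrability. *)
Lemma Lnorm_Z (p t : R) : 1 <= p -> 0 < t -> ('N[L]_p%:E[Z alpha beta mu Ga t] =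
  (t `^ (- (alpha * d%:R / beta * (1 - p^-1))))%:E * I p `^ p^-1)%E.
Proof.
move=> p1 t0; have p0 : 0 < p by lra.
rewrite unlock Zt//.
pose k := t `^ (- (alpha * d%:R / beta)); have k0 : 0 < k by rewrite powR_gt0.
pose e := t `^ (- (alpha / beta)); have e0 : 0 < e by rewrite powR_gt0.
have mzp : measurable_fun setT (fun x => z1 x `^ p)%E.
  exact: (measurableT_comp (measurable_poweR p) mz1).
have zp0 x : (0 <= z1 x `^ p)%E by exact: poweR_ge0.
have mzpe : measurable_fun setT (fun x : Rd => z1 (e *: x)%R `^ p)%E.
  by apply: (measurableT_comp mzp); exact: measurable_rV_scale.
have zpe0 x : setT x -> (0 <= z1 (e *: x)%R `^ p)%E by move=> _; exact: zp0.
have kp0 : (0 <= (k `^ p)%:E)%E by rewrite lee_fin powR_ge0.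
have -> : (\int[L]_x (`|k%:E * z1 (e *: x)%R| `^ p) = (k `^ p * e ^- d)%:E * I p)%E.
  transitivity (\int[L]_x ((k `^ p)%:E * z1 (e *: x)%R `^ p))%E.
    apply: eq_integral => x _; rewrite gee0_abs; last by rewrite mule_ge0// lee_fin ltW.
    by rewrite poweRM ?lee_fin ?(ltW k0)// poweR_EFin.
  apply: (etrans (ge0_integralZl L measurableT mzpe zpe0 kp0)).
  apply: (etrans (congr1 (fun y => (k `^ p)%:E * y)%E (ge0_integral_rV_dilation e0 mzp zp0))).
  by rewrite muleA -EFinM.
have I0 : (0 <= I p)%E by apply: integral_ge0 => x _; exact: zp0.
have kep0 : 0 <= k `^ p * e ^- d by rewrite mulr_ge0 ?powR_ge0// invr_ge0 exprn_ge0// ltW.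
rewrite poweRM ?lee_fin//; congr (_ * _)%E; rewrite poweR_EFin; congr EFin.
rewrite -powR_mulrn ?(ltW e0)// -powRN -!powRrM -powRD_gt0// -powRrM; congr (_ `^ _).
by field; rewrite !gt_eqF.
Qed.

(** beta - d may have either sign, so |x|^beta and |x|^(-d) are bounded below separately, at
    opposite ends of the annulus. *)
Lemma Z1_lower_annulus : exists k r, [/\ 0 < k, 0 < r &
  forall x, annulus (r / 2) r x -> (k%:E <= z1 x)%E].
Proof.
have [k [r [k0 r0 H]]] := Z1_lower d_gt0 alpha01 beta02 c0 psi_ge gP.
exists (k * ((r / 2) `^ beta * r `^ (- d%:R))), r; split => //.
  by rewrite !mulr_gt0 ?powR_gt0// divr_gt0.
move=> x /andP[x1 x2]; have x0 : 0 < enorm x by apply: lt_trans x1; rewrite divr_gt0.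
apply: le_trans (H x _); last by rewrite x0.
rewrite lee_fin ler_wpM2l ?(ltW k0)// powRD_gt0//.
apply: ler_pM; rewrite ?powR_ge0//.
  by rewrite ge0_ler_powR ?nnegrE ?(ltW beta0) ?(ltW x1) ?(ltW x0)// divr_ge0// ltW.
rewrite !powRN lef_pV2 ?posrE ?powR_gt0//.
by rewrite ge0_ler_powR ?nnegrE ?ler0n ?(ltW x0) ?(ltW r0).
Qed.

Let integral_Z1_powR_ge (p : R) (A : set Rd) (f : Rd -> R) : 0 <= p -> measurable A ->
  measurable_fun A f -> (forall x, A x -> 0 <= f x) -> (forall x, A x -> ((f x)%:E <= z1 x)%E) ->
  (\int[L]_(x in A) (f x `^ p)%:E <= I p)%E.
Proof.
move=> p0 mA mf f0 fz.
have mzp : measurable_fun setT (fun x => z1 x `^ p)%E.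
  exact: (measurableT_comp (measurable_poweR p) mz1).
apply: (@le_trans _ _ (\int[L]_(x in A) (z1 x `^ p))%E); last first.
  by apply: ge0_subset_integral => // x _; exact: poweR_ge0.
have fp0 x : A x -> (0 <= (f x `^ p)%:E)%E by rewrite lee_fin powR_ge0.
have mfp : measurable_fun A (fun x => (f x `^ p)%:E).
  by apply/measurable_EFinP; exact: (measurableT_comp (measurable_powR p) mf).
have le x : A x -> ((f x `^ p)%:E <= z1 x `^ p)%E.
  move=> Ax; rewrite -poweR_EFin; apply: gt0_ler_poweR => //; last exact: fz.
  - by rewrite in_itv/= leey lee_fin f0.
  - by rewrite in_itv/= leey z1_ge0.
by apply: (@ge0_le_integral _ _ _ L _ mA _ _ fp0 mfp _ le); exact: measurable_funTS.
Qed.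

Lemma integral_Z1_powR_gt0 (p : R) : 0 <= p -> (0 < I p)%E.
Proof.
move=> p0; have [k [r [k0 r0 H]]] := Z1_lower_annulus.
have mA := @measurable_annulus R d (r / 2) r.
apply: lt_le_trans (integral_Z1_powR_ge p0 mA (measurable_cst k) (fun _ _ => ltW k0) H).
rewrite [X in (0 < X)%E](integral_cst L mA (k `^ p)%:E) mule_gt0 ?lte_fin ?powR_gt0//.
exact: lebesgue_rV_annulus_gt0.
Qed.

(** The assumption on p reads (d - beta) p >= d, so the p-th power of the lower bound near 0 is not
    integrable. *)
Lemma integral_Z1_powR_eqy (p : R) : beta < d%:R -> d%:R / (d%:R - beta) <= p -> I p = +oo%E.
Proof.
move=> bd dp; have db0 : 0 < d%:R - beta by rewrite subr_gt0.
have p0 : 0 <= p by apply: le_trans dp; rewrite divr_ge0 ?ler0n// ltW.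
have [k [r [k0 r0 H]]] := Z1_lower d_gt0 alpha01 beta02 c0 psi_ge gP.
have mA := @measurable_annulus R d 0 r.
pose f x := k * enorm x `^ (beta - d%:R).
have mf : measurable_fun (annulus 0 r) f.
  apply: measurable_funTS; apply: measurable_funM => //.
  exact: (measurableT_comp (measurable_powR _) (@measurable_enorm R d)).
have f0 x : annulus 0 r x -> 0 <= f x by move=> _; rewrite mulr_ge0 ?powR_ge0// ltW.
apply/eqP; rewrite -leye_eq; apply: le_trans (integral_Z1_powR_ge p0 mA mf f0 H).
have mq : measurable_fun (annulus 0 r) (fun x => (enorm x `^ (- ((d%:R - beta) * p)))%:E).
  apply: measurable_funTS; apply/measurable_EFinP.
  exact: (measurableT_comp (measurable_powR _) (@measurable_enorm R d)).
have q0 x : annulus 0 r x -> (0 <= (enorm x `^ (- ((d%:R - beta) * p)))%:E)%E.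
  by rewrite lee_fin powR_ge0.
have kp0 : (0 <= (k `^ p)%:E)%E by rewrite lee_fin powR_ge0.
rewrite (eq_integral (fun x => (k `^ p)%:E * (enorm x `^ (- ((d%:R - beta) * p)))%:E)%E); last first.
  move=> x _; rewrite -EFinM /f powRM ?powR_ge0 ?(ltW k0)// -powRrM.
  by congr (EFin (_ * _ `^ _)); ring.
have := ge0_integralZl L mA mq q0 kp0 => ->.
rewrite integral_enorm_powR_eqy//; last by rewrite mulrC -ler_pdivrMr.
by rewrite gt0_muley ?lte_fin ?powR_gt0.
Qed.

(** Links the critical exponent to the order of the moment: for beta < d both conditions read p (d -
    beta) < d, and otherwise d / beta <= 1 while 1 - 1/p < 1. *)
Lemma lt_kappa1 (p : R) : 1 <= p -> (p%:E < kappa1 d beta)%E -> d%:R / beta * (1 - p^-1) < 1.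
Proof.
move=> p1; have p0 : 0 < p by lra.
rewrite /kappa1; have [bd|db _] := ltP beta d%:R.
  rewrite lte_fin ltr_pdivlMr ?subr_gt0// => H.
  rewrite mulrAC ltr_pdivrMr// mul1r -(ltr_pM2r p0).
  rewrite -mulrA mulrBl mul1r mulVf ?gt_eqF//; nra.
apply: (@le_lt_trans _ _ (1 - p^-1)); last by rewrite ltrBlDr ltrDl invr_gt0.
by rewrite ler_piMl ?subr_ge0 ?invf_le1// ler_pdivrMr ?mul1r.
Qed.

(** By scaling the norm is an exact multiple of the power of t, so both constants are the L_p norm
    of Z1. *)
Lemma two_sided_LnormZ (p : R) : 1 <= p -> (p%:E < kappa1 d beta)%E ->
  two_sided (fun t => 'N[L]_(p%:E)[Z alpha beta mu Ga t])%E
    (fun t => t `^ (- (alpha * d%:R / beta * (1 - p^-1)))).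
Proof.
move=> p1 pk; have p0 : 0 <= p by lra.
have I0 := integral_Z1_powR_gt0 p0.
have Ioo : (I p < +oo)%E.
  exact: (integral_Z1_powR_lty d_gt0 alpha01 beta02 c0 psi_ge gP p1 (lt_kappa1 p1 pk)).
have If : I p \is a fin_num by rewrite ge0_fin_numE// ltW.
have C0 : 0 < fine (I p) `^ p^-1 by rewrite powR_gt0// fine_gt0// I0.
exists (fine (I p) `^ p^-1), (fine (I p) `^ p^-1); split => // t t0.
by rewrite Lnorm_Z// -(fineK If) poweR_EFin -EFinM [in X in (_ <= X)%E]mulrC fineK// mulrC lexx.
Qed.

Lemma in_Lp_ZP (p : R) : 1 <= p ->
  (forall t, 0 < t -> in_Lp p%:E (Z alpha beta mu Ga t)) <-> (p%:E < kappa1 d beta)%E.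
Proof.
move=> p1; split=> [H|pk t t0]; last first.
  split; first exact: measurable_Z.
  have [_ [C [_ _ /(_ t t0)/andP[_ H]]]] := two_sided_LnormZ p1 pk.
  by apply: le_lt_trans H _; rewrite ltry.
(* One time suffices for this direction; at t = 1 the power of t disappears. *)
have [_] := H 1 ltr01; rewrite Lnorm_Z// powR1 mul1e.
apply: contraTT; rewrite /kappa1; case: ifPn => bd; last by rewrite ltry.
rewrite -!leNgt lee_fin => dp; rewrite integral_Z1_powR_eqy//.
by rewrite /poweR invr_eq0 gt_eqF//; lra.
Qed.

(** For the lower bound: were the essential supremum smaller, the dilated annulus on which Z1 is at
    least k would lie in a null set, although its measure is positive. *)
Lemma two_sided_supZ : d%:R < beta ->
  two_sided (fun t => 'N[L]_(+oo)[Z alpha beta mu Ga t])%E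
    (fun t => t `^ (- (alpha * d%:R / beta))).
Proof.
move=> db; have [k [r [k0 r0 H]]] := Z1_lower_annulus.
have [C HC] := Z1_bounded d_gt0 alpha01 beta02 c0 psi_ge gP db.
(* [Z1_bounded] does not assert that [C] is positive; the maximum with 1 is. *)
exists k, (Num.max C 1); split => // [|t t0]; first by rewrite lt_max ltr01 orbT.
(* The norm at +oo is the essential supremum when the whole space has positive measure. *)
rewrite unlock (@lebesgue_rVT_gt0 R d) Zt//.
pose K := t `^ (- (alpha * d%:R / beta)); have K0 : 0 < K by rewrite powR_gt0.
pose e := t `^ (- (alpha / beta)); have e0 : 0 < e by rewrite powR_gt0.
rewrite -/K -/e; set f := abse \o _.
have fE x : f x = (K%:E * z1 (e *: x)%R)%E.
  by rewrite /f/= gee0_abs// mule_ge0// lee_fin ltW.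
apply/andP; split; last first.
  apply/ess_supP; apply: aeW => x; rewrite fE mulrC EFinM lee_wpmul2l ?lee_fin ?(ltW K0)//.
  by apply: le_trans (HC _) _; rewrite lee_fin le_max lexx.
rewrite leNgt; apply/negP => lt_k.
have [N [mN N0 sN]] := ess_sup_ge L f.
have re0 : 0 < r / e by rewrite divr_gt0.
have := lebesgue_rV_annulus_gt0 d_gt0 re0; apply/negP; rewrite -leNgt -N0.
apply: le_measure; rewrite ?inE//; first exact: measurable_annulus.
move=> x /andP[x1 x2]; apply: sN => /= /le_lt_trans/(_ lt_k).
rewrite fE mulrC EFinM; apply/negP; rewrite -leNgt lee_wpmul2l ?lee_fin ?(ltW K0)//.
apply: H; rewrite /annulus/= enormZ ?(ltW e0)// (mulrC e); apply/andP; split.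
  by rewrite -ltr_pdivrMr// mulrAC.
by rewrite -ler_pdivlMr.
Qed.

End kernel_norms.

(** * Passage to a finite measure and conclusion *)

Section finite_copy.
Context {R : realType} {d : nat}.
Variables (mu : {measure set 'rV[R]_d -> \bar R}) (mu_lty : (mu setT < +oo)%E).

(* The bound is an argument so that the finiteness instance can be inferred. *)
Definition finite_copy of (mu setT < +oo)%E : set 'rV[R]_d -> \bar R := mu.

HB.instance Definition _ := Measure.copy (finite_copy mu_lty) mu.

Let finite_copy_fin : fin_num_fun (finite_copy mu_lty).
Proof.
move=> A mA; rewrite ge0_fin_numE//; apply: le_lt_trans mu_lty.
by apply: le_measure; rewrite ?inE.
Qed.

HB.instance Definition _ := Measure_isFinite.Build _ _ _ (finite_copy mu_lty) finite_copy_fin.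

End finite_copy.

(** The two measures agree as set functions but carry different structures, so their integrals are
    compared through the values on measurable sets. *)
Lemma eq_omega (R : realType) (d : nat) (beta : R) (mu nu : {measure set 'rV[R]_d -> \bar R}) :
  mu = nu :> (set _ -> \bar R) -> omega beta mu = omega beta nu.
Proof.
move=> e; apply/funext => x; congr fine; apply: eq_measure_integral => A _ _.
by rewrite e.
Qed.

Lemma eq_Z (R : realType) (d : nat) (alpha beta : R) (mu nu : {measure set 'rV[R]_d -> \bar R}) Ga t :
  mu = nu :> (set _ -> \bar R) -> Z alpha beta mu Ga t = Z alpha beta nu Ga t.
Proof. by move=> e; rewrite /Z /G /psi (eq_omega beta e). Qed.

Theorem theorem2p1 (R : realType) (d : nat) (alpha beta : R)
    (mu : {measure set 'rV[R]_d -> \bar R}) (Ga : R -> R -> R)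
    (d_gt0 : (0 < d)%N) (alpha01 : 0 < alpha < 1) (beta02 : 0 < beta < 2)
    (mu_spectral : spectral_measure mu) (mu_density : has_positive_density mu)
    (omega_gt0 : forall theta, sphere theta -> 0 < omega beta mu theta)
    (omega_Ck : sphere_Ck (d + 1 + Num.truncn beta) (omega beta mu))
    (Ga_green : frac_green alpha Ga)
    (Ga_stable : one_sided_stable_density alpha (Ga 1)) :
  [/\ forall p : R, 1 <= p ->
        (forall t, 0 < t -> in_Lp p%:E (Z alpha beta mu Ga t)) <->
        (p%:E < kappa1 d beta)%E,
      forall p : R, 1 <= p -> (p%:E < kappa1 d beta)%E ->
        two_sided (fun t => 'N[lebesgue_rV d]_(p%:E)[Z alpha beta mu Ga t])%E
          (fun t => t `^ (- (alpha * d%:R / beta * (1 - p^-1)))) &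
      d%:R < beta ->
        two_sided (fun t => 'N[lebesgue_rV d]_(+oo)[Z alpha beta mu Ga t])%E
          (fun t => t `^ (- (alpha * d%:R / beta)))].
Proof.
have [mu_fin _ _] := mu_spectral.
pose nu : {finite_measure set 'rV[R]_d -> \bar R} := finite_copy mu_fin.
have nuE : mu = nu :> (set _ -> \bar R) by [].
have beta0 : 0 < beta by case/andP: beta02.
have nu_gt0 theta : sphere theta -> 0 < omega beta nu theta.
  by rewrite -(eq_omega beta nuE); exact: omega_gt0.
have nu_Ck : sphere_Ck (d + 1 + Num.truncn beta) (omega beta nu).
  by rewrite -(eq_omega beta nuE).
have [c c0 psi_ge] := psi_lower_bound d_gt0 beta0 nu_gt0 nu_Ck.
have -> : Z alpha beta mu Ga = Z alpha beta nu Ga by apply/funext => t; exact: eq_Z.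
split.
- exact: (in_Lp_ZP d_gt0 alpha01 beta02 c0 psi_ge Ga_stable).
- exact: (two_sided_LnormZ d_gt0 alpha01 beta02 c0 psi_ge Ga_stable).
- exact: (two_sided_supZ d_gt0 alpha01 beta02 c0 psi_ge Ga_stable).
Qed.
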